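(* The space $\mathfrak R(G_0)$ of regular functions on $G_0$ is spanned by the matrix elements of all big projective modules in the category $\mathcal O$, $$\mathfrak R(G_0)\cong\bigoplus_{\lambda\in-\mathbf P^{++}}\mathbb M(P_\lambda).$$ As a $\mathfrak g\oplus\mathfrak g$-module, $\mathfrak R(G_0)$ is given by $$\mathfrak R(G_0)\cong\bigoplus_{\lambda\in-\mathbf P^{++}}\left(P_\lambda\otimes P_\lambda^\star\right)\big/I_\lambda,$$ where the $I_\lambda$ are the $\mathfrak g\oplus\mathfrak g$-submodules of $P_\lambda\otimes P_\lambda^\star$ corresponding to identically vanishing matrix elements, i.e. $I_\lambda$ is the kernel of the map $P_\lambda\otimes P_\lambda^\star\to\mathcal U(\mathfrak g)'$, $v\otimes v'\mapsto\phi_{v,v'}$.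
   Context: Let $G=SL(2,\mathbb C)$, $\mathfrak g=\mathfrak{sl}(2,\mathbb C)$ with standard basis $\mathbf e,\mathbf h,\mathbf f$, $\mathfrak n_+=\mathbb C\mathbf e$, $\mathfrak h=\mathbb C\mathbf h$. Weights are identified with complex numbers, $\mathbf P=\mathbb Z$, $\mathbf P^+=\mathbb Z_{\ge0}$, $\mathbf P^{++}=\mathbf P^++\rho=\mathbb Z_{\ge1}$. The big Bruhat cell $G_0\subset G$ is the set of $g=\begin{pmatrix}1&x\\0&1\end{pmatrix}\mathbf w_0\begin{pmatrix}\zeta&0\\0&\zeta^{-1}\end{pmatrix}\begin{pmatrix}1&y\\0&1\end{pmatrix}$, $\mathbf w_0=\begin{pmatrix}0&-1\\1&0\end{pmatrix}$, with $x,y\in\mathbb C$, $\zeta\in\mathbb C^\times$; $\mathfrak R(G_0)=\mathbb C[x,y,\zeta^{\pm1}]$. It is a $\mathfrak g\oplus\mathfrak g$-module by $(\pi_l(u)\psi)(g)=\frac{d}{dt}\psi(e^{-tu}g)|_{t=0}$, $(\pi_r(u)\psi)(g)=\frac{d}{dt}\psi(ge^{tu})|_{t=0}$. $\mathcal O$ is the Bernstein–Gelfand–Gelfand category of finitely generated, locally $\mathfrak n_+$-nilpotent, $\mathfrak h$-diagonalizable $\mathfrak g$-modules. $V_\lambda$ is the irreducible module of highest weight $\lambda$, and $P_\lambda$ is its indecomposable projective cover in $\mathcal O$; the big projective modules are the $P_\lambda$ with $\lambda\in-\mathbf P^{++}$. For $V\in\mathcal O$, $V'$ is the restricted dual (sum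 of duals of weight spaces) and $V^\star$ is $V'$ with action $\langle gv',v\rangle=-\langle v',\omega(g)v\rangle$, where $\omega(\mathbf e)=-\mathbf f$, $\omega(\mathbf h)=-\mathbf h$, $\omega(\mathbf f)=-\mathbf e$. $\mathcal U(\mathfrak g)'$ is the restricted dual of the universal enveloping algebra, with $\mathfrak g\oplus\mathfrak g$-action $(\pi_l(g)\phi)(x)=\phi(xg)$, $(\pi_r(g)\phi)(x)=-\phi(\omega(g)x)$. For a module $V$, $\mathbb M(V)\subset\mathcal U(\mathfrak g)'$ is the span of the matrix elements $\phi_{v,v'}(x)=\langle v',xv\rangle$, $v\in V$, $v'\in V'$; it is a $\mathfrak g\oplus\mathfrak g$-submodule. The space $\mathfrak R(G_0)$ is viewed as a subspace of $\mathcal U(\mathfrak g)'$ through the injective $\mathfrak g\oplus\mathfrak g$-homomorphism sending $\psi$ to the functional $x\mapsto(\pi_l(x)\psi)(\mathbf w_0)$. *)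

(* Defs.v *)
From HB Require Import structures.
From mathcomp Require Import all_boot all_order all_algebra generic_quotient.
From mathcomp Require Import ring_quotient complex.
From mathcomp Require Import all_classical all_reals.
From mathcomp Require Import topology normedtype sequences derive.
From mathcomp Require Import ring.

Set Implicit Arguments.
Unset Strict Implicit.
Unset Printing Implicit Defensive.

Import GRing.Theory Num.Theory numFieldNormedType.Exports.
Local Open Scope classical_set_scope.
Local Open Scope ring_scope.
Local Open Scope quotient_scope.


Lemma linear_map0 (K : fieldType) (V W : lmodType K) (f : V -> W) :
  linear f -> f 0 = 0.
Proof. by move=> lf; have := lf (-1) 0 0; rewrite scaler0 addr0 scaleN1r addNr. Qed.

Definition is_submodule (K : fieldType) (V : lmodType K) (S : set V) : Prop :=
  S 0 /\ forall (a : K) (x y : V), S x -> S y -> S (a *: x + y).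

Definition lspan (K : fieldType) (V : lmodType K) (A : set V) : set V :=
  [set x | exists (n : nat) (a : 'I_n -> K) (v : 'I_n -> V),
     (forall i, A (v i)) /\ x = \sum_(i < n) a i *: v i].

(* The support condition is essential: [\sum_(i \in _)] is 0 by convention on
   families of infinite support. *)
Definition family_in (K : fieldType) (V : lmodType K) (I : choiceType)
    (M : I -> set V) (m : I -> V) : Prop :=
  finite_set [set i | m i != 0] /\ forall i, M i (m i).

Definition sum_of_subspaces (K : fieldType) (V : lmodType K) (I : choiceType)
    (M : I -> set V) : set V :=
  [set x | exists2 m : I -> V, family_in M m & x = \sum_(i \in [set: I]) m i].

Definition sum_is_direct (K : fieldType) (V : lmodType K) (I : choiceType)
    (M : I -> set V) : Prop :=
  forall m : I -> V, family_in M m ->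
    \sum_(i \in [set: I]) m i = 0 -> forall i, m i = 0.

Section QuotientSpace.
Variables (K : fieldType) (V : lmodType K) (S : set V) (hS : is_submodule S).

Definition subspace_pred of is_submodule S : {pred V} := fun x => `[< S x >].

Let subspace_pred_closed : subsemimod_closed (subspace_pred hS).
Proof.
have [S0 SL] := hS; split; first split.
- exact/asboolP.
- move=> x y /asboolP Sx /asboolP Sy; apply/asboolP.
  by rewrite -[x]scale1r; apply: SL.
- move=> a x /asboolP Sx; apply/asboolP.
  by rewrite -[_ *: _]addr0; apply: SL.
Qed.

HB.instance Definition _ :=
  GRing.isSubmodClosed.Build K V (subspace_pred hS) subspace_pred_closed.

Definition quotient_space : Type := Quotient.quot (subspace_pred hS).
HB.instance Definition _ := GRing.Zmodule.on quotient_space.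

Definition quotient_proj (x : V) : quotient_space :=
  \pi_(Quotient.quot (subspace_pred hS)) x.

Lemma quotient_proj_eq x y : quotient_proj x = quotient_proj y <-> S (x - y).
Proof.
rewrite /quotient_proj; split=> [/eqP|Sxy].
  by rewrite -Quotient.idealrBE => /asboolP.
by apply/eqP; rewrite -Quotient.idealrBE; apply/asboolP.
Qed.

Definition quotient_repr (q : quotient_space) : V :=
  repr (q : Quotient.quot (subspace_pred hS)).

Lemma quotient_reprK q : quotient_proj (quotient_repr q) = q.
Proof. exact: reprK. Qed.

Lemma quotient_projD x y :
  quotient_proj (x + y) = quotient_proj x + quotient_proj y.
Proof. exact: raddfD. Qed.

Definition quotient_scale (a : K) (q : quotient_space) : quotient_space :=
  quotient_proj (a *: quotient_repr q).

Lemma quotient_projZ a x : quotient_proj (a *: x) = quotient_scale a (quotient_proj x).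
Proof.
apply/quotient_proj_eq; rewrite -scalerBr -[_ *: _]addr0.
have [S0 SL] := hS; apply: SL => //.
by apply/quotient_proj_eq; rewrite quotient_reprK.
Qed.

Let qscaleA a b q : quotient_scale a (quotient_scale b q) = quotient_scale (a * b) q.
Proof. by rewrite -(quotient_reprK q) -!quotient_projZ scalerA. Qed.
Let qscale1 : left_id 1 quotient_scale.
Proof. by move=> q; rewrite -(quotient_reprK q) -!quotient_projZ scale1r. Qed.
Let qscaleDr : right_distributive quotient_scale +%R.
Proof.
move=> a p q; rewrite -(quotient_reprK q) -(quotient_reprK p) -quotient_projD.
by rewrite -!quotient_projZ -quotient_projD scalerDr.
Qed.
Let qscaleDl q : {morph quotient_scale^~ q : a b / a + b}.
Proof.
by move=> a b; rewrite -(quotient_reprK q) -!quotient_projZ -quotient_projD scalerDl.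
Qed.
HB.instance Definition _ := GRing.Zmodule_isLmodule.Build K quotient_space
  qscaleA qscale1 qscaleDr qscaleDl.

End QuotientSpace.

Section DirectSum.
Variables (K : fieldType) (I : choiceType) (W : I -> lmodType K).

Record direct_sum : Type := DirectSum {
  dsum_fun :> forall i, W i;
  dsum_finite : finite_set [set i | dsum_fun i != 0] }.

Lemma dsumP (f g : direct_sum) : (forall i, f i = g i) -> f = g.
Proof.
case: f g => f hf [g hg] /= fg; have fg' : f = g by apply: functional_extensionality_dep.
by subst g; congr DirectSum; apply: Prop_irrelevance.
Qed.

HB.instance Definition _ := gen_eqMixin direct_sum.
HB.instance Definition _ := gen_choiceMixin direct_sum.

Let fin0 : finite_set [set i | (0 : W i) != 0].
Proof. by rewrite (_ : [set _ | _] = set0)//; apply/seteqP; split=> i //=; rewrite eqxx. Qed.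
Let finD (f g : direct_sum) : finite_set [set i | f i + g i != 0].
Proof.
apply: (@sub_finite_set _ _ ([set i | f i != 0] `|` [set i | g i != 0])).
  move=> i /= fg; case: (eqVneq (f i) 0) => fi; [right|by left].
  by move: fg; rewrite fi add0r.
by rewrite finite_setU; split; apply: dsum_finite.
Qed.
Let finZ a (f : direct_sum) : finite_set [set i | a *: f i != 0].
Proof.
apply: (@sub_finite_set _ _ [set i | f i != 0]); last exact: dsum_finite.
by move=> i /=; apply: contraNneq => ->; rewrite scaler0.
Qed.

Definition dsum_zero := DirectSum fin0.
Definition dsum_add f g := DirectSum (finD f g).
Definition dsum_scale a f := DirectSum (finZ a f).

Let dsum_addA : associative dsum_add.
Proof. by move=> f g h; apply: dsumP => i /=; rewrite addrA. Qed.
Let dsum_addC : commutative dsum_add.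
Proof. by move=> f g; apply: dsumP => i /=; rewrite addrC. Qed.
Let dsum_add0 : left_id dsum_zero dsum_add.
Proof. by move=> f; apply: dsumP => i /=; rewrite add0r. Qed.
Let dsum_addN : left_inverse dsum_zero (dsum_scale (-1)) dsum_add.
Proof. by move=> f; apply: dsumP => i /=; rewrite scaleN1r addNr. Qed.
HB.instance Definition _ :=
  GRing.isZmodule.Build direct_sum dsum_addA dsum_addC dsum_add0 dsum_addN.

Let dsum_scaleA a b f : dsum_scale a (dsum_scale b f) = dsum_scale (a * b) f.
Proof. by apply: dsumP => i /=; rewrite scalerA. Qed.
Let dsum_scale1 : left_id 1 dsum_scale.
Proof. by move=> f; apply: dsumP => i /=; rewrite scale1r. Qed.
Let dsum_scaleDr : right_distributive dsum_scale +%R.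
Proof. by move=> a f g; apply: dsumP => i /=; rewrite scalerDr. Qed.
Let dsum_scaleDl f : {morph dsum_scale^~ f : a b / a + b}.
Proof. by move=> a b; apply: dsumP => i /=; rewrite scalerDl. Qed.
HB.instance Definition _ := GRing.Zmodule_isLmodule.Build K direct_sum
  dsum_scaleA dsum_scale1 dsum_scaleDr dsum_scaleDl.

End DirectSum.

(* Tensor product: formal expressions in the symbols v (x) w, modulo the
   congruence generated by the vector space axioms and bilinearity *)
Section Tensor.
Variables (K : fieldType) (V W : lmodType K).

Inductive tensor_term : Type :=
| TPure of V & W
| TZero
| TAdd of tensor_term & tensor_term
| TScale of K & tensor_term.

Inductive tensor_eq : tensor_term -> tensor_term -> Prop :=
| teq_refl s : tensor_eq s s
| teq_sym s t : tensor_eq s t -> tensor_eq t s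
| teq_trans s t r : tensor_eq s t -> tensor_eq t r -> tensor_eq s r
| teq_add s s' t t' : tensor_eq s s' -> tensor_eq t t' ->
    tensor_eq (TAdd s t) (TAdd s' t')
| teq_scale a s s' : tensor_eq s s' -> tensor_eq (TScale a s) (TScale a s')
| teq_addA s t r : tensor_eq (TAdd s (TAdd t r)) (TAdd (TAdd s t) r)
| teq_addC s t : tensor_eq (TAdd s t) (TAdd t s)
| teq_add0 s : tensor_eq (TAdd TZero s) s
| teq_addN s : tensor_eq (TAdd (TScale (-1) s) s) TZero
| teq_scaleA a b s : tensor_eq (TScale a (TScale b s)) (TScale (a * b) s)
| teq_scale1 s : tensor_eq (TScale 1 s) s
| teq_scaleDr a s t : tensor_eq (TScale a (TAdd s t)) (TAdd (TScale a s) (TScale a t))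
| teq_scaleDl a b s : tensor_eq (TScale (a + b) s) (TAdd (TScale a s) (TScale b s))
| teq_pureDl v v' w : tensor_eq (TPure (v + v') w) (TAdd (TPure v w) (TPure v' w))
| teq_pureDr v w w' : tensor_eq (TPure v (w + w')) (TAdd (TPure v w) (TPure v w'))
| teq_pureZl a v w : tensor_eq (TPure (a *: v) w) (TScale a (TPure v w))
| teq_pureZr a v w : tensor_eq (TPure v (a *: w)) (TScale a (TPure v w)).

HB.instance Definition _ := gen_eqMixin tensor_term.
HB.instance Definition _ := gen_choiceMixin tensor_term.

Definition tensor_eqb (s t : tensor_term) : bool := `[< tensor_eq s t >].

Let tensor_eqb_equiv : equiv_class_of tensor_eqb.
Proof.
split=> [s|s t|t s r].
- by apply/asboolP; apply: teq_refl.
- by apply/asboolP/asboolP; apply: teq_sym.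
- by move=> /asboolP st /asboolP tr; apply/asboolP; apply: teq_trans st tr.
Qed.
Canonical tensor_equiv := EquivRelPack tensor_eqb_equiv.

Definition tensor : Type := {eq_quot tensor_eqb}.
HB.instance Definition _ := Choice.on tensor.

Definition tclass (t : tensor_term) : tensor := \pi_({eq_quot tensor_eqb}) t.
Definition trepr (x : tensor) : tensor_term := repr (x : {eq_quot tensor_eqb}).

Lemma treprK x : tclass (trepr x) = x. Proof. exact: reprK. Qed.
Lemma tclassP s t : tclass s = tclass t <-> tensor_eq s t.
Proof. by split=> [/eqmodP/asboolP|st]; last apply/eqmodP/asboolP. Qed.
Lemma trepr_class t : tensor_eq (trepr (tclass t)) t.
Proof. by apply/tclassP; rewrite treprK. Qed.

Definition tens_add x y := tclass (TAdd (trepr x) (trepr y)).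
Definition tens_scale a x := tclass (TScale a (trepr x)).

Lemma tclassD s t : tclass (TAdd s t) = tens_add (tclass s) (tclass t).
Proof. by apply/tclassP; apply: teq_add; apply/teq_sym/trepr_class. Qed.
Lemma tclassZ a s : tclass (TScale a s) = tens_scale a (tclass s).
Proof. by apply/tclassP; apply: teq_scale; apply/teq_sym/trepr_class. Qed.

Let tens_addA : associative tens_add.
Proof.
move=> x y z; rewrite -(treprK x) -(treprK y) -(treprK z) -!tclassD.
exact/tclassP/teq_addA.
Qed.
Let tens_addC : commutative tens_add.
Proof. by move=> x y; apply/tclassP/teq_addC. Qed.
Let tens_add0 : left_id (tclass TZero) tens_add.
Proof. by move=> x; rewrite -(treprK x) -!tclassD; apply/tclassP/teq_add0. Qed.
Let tens_addN : left_inverse (tclass TZero) (tens_scale (-1)) tens_add.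
Proof.
by move=> x; rewrite -(treprK x) -tclassZ -!tclassD; apply/tclassP/teq_addN.
Qed.
HB.instance Definition _ :=
  GRing.isZmodule.Build tensor tens_addA tens_addC tens_add0 tens_addN.

Let tens_scaleA a b x : tens_scale a (tens_scale b x) = tens_scale (a * b) x.
Proof. by rewrite -(treprK x) -!tclassZ; apply/tclassP/teq_scaleA. Qed.
Let tens_scale1 : left_id 1 tens_scale.
Proof. by move=> x; rewrite -(treprK x) -!tclassZ; apply/tclassP/teq_scale1. Qed.
Let tens_scaleDr : right_distributive tens_scale +%R.
Proof.
move=> a x y; rewrite -(treprK x) -(treprK y) -[X in tens_scale a X]tclassD.
rewrite -!tclassZ -[RHS]tclassD; exact/tclassP/teq_scaleDr.
Qed.
Let tens_scaleDl x : {morph tens_scale^~ x : a b / a + b}.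
Proof.
move=> a b; rewrite -(treprK x) -!tclassZ -[RHS]tclassD; exact/tclassP/teq_scaleDl.
Qed.
HB.instance Definition _ := GRing.Zmodule_isLmodule.Build K tensor
  tens_scaleA tens_scale1 tens_scaleDr tens_scaleDl.

Definition pure (v : V) (w : W) : tensor := tclass (TPure v w).

Fixpoint tensor_term_lift (X : lmodType K) (b : V -> W -> X) (t : tensor_term) : X :=
  match t with
  | TPure v w => b v w
  | TZero => 0
  | TAdd s t => tensor_term_lift b s + tensor_term_lift b t
  | TScale a s => a *: tensor_term_lift b s
  end.

Definition tensor_lift (X : lmodType K) (b : V -> W -> X) (x : tensor) : X :=
  tensor_term_lift b (trepr x).

Definition bilinear_map (X : lmodType K) (b : V -> W -> X) : Prop :=
  (forall w, linear (b^~ w)) /\ (forall v, linear (b v)).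

Section Lift.
Variables (X : lmodType K) (b : V -> W -> X) (hb : bilinear_map b).

Lemma tensor_term_lift_eq s t :
  tensor_eq s t -> tensor_term_lift b s = tensor_term_lift b t.
Proof.
have [bl br] := hb.
elim=> /= {s t}.
- by [].
- by [].
- by move=> s t r _ -> _ ->.
- by move=> s s' t t' _ -> _ ->.
- by move=> a s s' _ ->.
- by move=> s t r; rewrite addrA.
- by move=> s t; rewrite addrC.
- by move=> s; rewrite add0r.
- by move=> s; rewrite scaleN1r addNr.
- by move=> a c s; rewrite scalerA.
- by move=> s; rewrite scale1r.
- by move=> a s t; rewrite scalerDr.
- by move=> a c s; rewrite scalerDl.
- by move=> v v' w; have := bl w 1 v v'; rewrite /= !scale1r.
- by move=> v w w'; have := br v 1 w w'; rewrite /= !scale1r.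
- move=> a v w; have b0 : b 0 w = 0 by apply: (linear_map0 (bl w)).
  by have := bl w a v 0; rewrite /= b0 !addr0.
- move=> a v w; have b0 : b v 0 = 0 by apply: (linear_map0 (br v)).
  by have := br v a w 0; rewrite /= b0 !addr0.
Qed.

Lemma tensor_lift_class t : tensor_lift b (tclass t) = tensor_term_lift b t.
Proof. exact/tensor_term_lift_eq/trepr_class. Qed.

Lemma tensor_lift_pure v w : tensor_lift b (pure v w) = b v w.
Proof. exact: tensor_lift_class. Qed.

Lemma tensor_lift_linear : linear (tensor_lift b).
Proof.
move=> a x y; rewrite -(treprK x) -(treprK y).
have -> : a *: tclass (trepr x) + tclass (trepr y)
        = tclass (TAdd (TScale a (trepr x)) (trepr y)) by rewrite tclassD tclassZ.
by rewrite !tensor_lift_class.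
Qed.
End Lift.

Lemma pureDl w : linear (pure^~ w).
Proof.
move=> a v v'; rewrite /pure.
have -> : a *: tclass (TPure v w) + tclass (TPure v' w)
        = tclass (TAdd (TScale a (TPure v w)) (TPure v' w)) by rewrite tclassD tclassZ.
apply/tclassP; apply: teq_trans (teq_pureDl _ _ _) _.
by apply: teq_add (teq_refl _); apply: teq_pureZl.
Qed.

Lemma pureDr v : linear (pure v).
Proof.
move=> a w w'; rewrite /pure.
have -> : a *: tclass (TPure v w) + tclass (TPure v w')
        = tclass (TAdd (TScale a (TPure v w)) (TPure v w')) by rewrite tclassD tclassZ.
apply/tclassP; apply: teq_trans (teq_pureDr _ _ _) _.
by apply: teq_add (teq_refl _); apply: teq_pureZr.
Qed.

Lemma tensor_ind (T : tensor -> Prop) :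
  (forall v w, T (pure v w)) -> T 0 -> (forall x y, T x -> T y -> T (x + y)) ->
  (forall a x, T x -> T (a *: x)) -> forall x, T x.
Proof.
move=> Tp T0 TD TZ x; rewrite -(treprK x); elim: (trepr x) => [v w||s IHs t IHt|a s IHs].
- exact: Tp.
- exact: T0.
- by rewrite tclassD; apply: TD.
- by rewrite tclassZ; apply: TZ.
Qed.

End Tensor.


Record lie_algebra (K : fieldType) := LieAlgebra {
  lie_space :> lmodType K;
  bracket : lie_space -> lie_space -> lie_space;
  bracket_linearl : forall y, linear (bracket^~ y);
  bracket_linearr : forall x, linear (bracket x);
  bracket_alt : forall x, bracket x x = 0;
  bracket_jacobi : forall x y z,
    bracket x (bracket y z) + bracket y (bracket z x) + bracket z (bracket x y) = 0 }.

Record lie_module (K : fieldType) (L : lie_algebra K) := LieModule {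
  lmod_space :> lmodType K;
  act : L -> lmod_space -> lmod_space;
  act_linearl : forall v, linear (act^~ v);
  act_linearr : forall x, linear (act x);
  act_bracket : forall x y v,
    act (bracket x y) v = act x (act y v) - act y (act x v) }.

Section LieModules.
Variables (K : fieldType) (L : lie_algebra K).

Section Misc.
Variable V : lie_module L.
Lemma act0r (x : L) : act x (0 : V) = 0.
Proof. exact: linear_map0 (act_linearr x). Qed.
Lemma act0l (v : V) : act (0 : L) v = 0.
Proof. exact: (linear_map0 (act_linearl v)). Qed.
Lemma actDr (x : L) (v w : V) : act x (v + w) = act x v + act x w.
Proof. by have := act_linearr x 1 v w; rewrite !scale1r. Qed.
Lemma actDl (x y : L) (v : V) : act (x + y) v = act x v + act y v.
Proof. by have := act_linearl v 1 x y; rewrite /= !scale1r. Qed.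
Lemma actZr (x : L) a (v : V) : act x (a *: v) = a *: act x v.
Proof. by have := act_linearr x a v 0; rewrite act0r !addr0. Qed.
Lemma actZl (x : L) a (v : V) : act (a *: x) v = a *: act x v.
Proof. by have := act_linearl v a x 0; rewrite /= act0l !addr0. Qed.
End Misc.

Definition is_hom (V W : lie_module L) (f : V -> W) : Prop :=
  linear f /\ forall (x : L) (v : V), f (act x v) = act x (f v).

Definition is_lie_submodule (V : lie_module L) (N : set V) : Prop :=
  is_submodule N /\ forall (x : L) (v : V), N v -> N (act x v).

Definition finitely_generated (V : lie_module L) : Prop :=
  exists s : seq V, forall N : set V, is_lie_submodule N ->
    (forall v, v \in s -> N v) -> N = setT.

Definition irreducible (V : lie_module L) : Prop :=
  (exists v : V, v != 0) /\
  forall N : set V, is_lie_submodule N -> N = [set 0] \/ N = setT.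

Definition indecomposable (V : lie_module L) : Prop :=
  (exists v : V, v != 0) /\
  forall A B : set V, is_lie_submodule A -> is_lie_submodule B ->
    A `&` B = [set 0] -> (forall v, exists2 a, A a & exists2 b, B b & v = a + b) ->
    A = [set 0] \/ B = [set 0].

(* S is an L-submodule of V and [f] restricts to an isomorphism of L-modules from
   S onto T.  The maps [aV], [aW] need not be Lie algebra actions outside S, T. *)
Definition iso_on (V W : lmodType K) (aV : L -> V -> V) (aW : L -> W -> W)
    (S : set V) (T : set W) (f : V -> W) : Prop :=
  [/\ is_submodule S /\ (forall x v, S v -> S (aV x v)),
      forall a v w, S v -> S w -> f (a *: v + w) = a *: f v + f w,
      forall x v, S v -> f (aV x v) = aW x (f v),
      forall v w, S v -> S w -> f v = f w -> v = w &
      f @` S = T].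

Section QuotientModule.
Variables (V : lie_module L) (N : set V) (hN : is_lie_submodule N).

Let Q := quotient_space hN.1.
Definition quotient_act (x : L) (q : Q) : Q :=
  quotient_proj hN.1 (act x (quotient_repr q)).

Lemma quotient_act_proj x v :
  quotient_act x (quotient_proj hN.1 v) = quotient_proj hN.1 (act x v).
Proof.
apply/quotient_proj_eq; rewrite -scaleN1r -actZr -actDr scaleN1r; apply: hN.2.
by apply/(quotient_proj_eq hN.1); rewrite quotient_reprK.
Qed.

Let projL a (u v : V) :
  quotient_proj hN.1 (a *: u + v) = a *: quotient_proj hN.1 u + quotient_proj hN.1 v.
Proof. by rewrite quotient_projD quotient_projZ. Qed.

Let quotient_act_linearl q : linear (quotient_act^~ q).
Proof.
move=> a x y; rewrite -(quotient_reprK q) /= !quotient_act_proj.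
by rewrite actDl actZl projL.
Qed.
Let quotient_act_linearr x : linear (quotient_act x).
Proof.
move=> a p q; rewrite -(quotient_reprK p) -(quotient_reprK q) -projL.
by rewrite !quotient_act_proj actDr actZr projL.
Qed.
Let quotient_act_bracket x y q : quotient_act (bracket x y) q =
  quotient_act x (quotient_act y q) - quotient_act y (quotient_act x q).
Proof.
rewrite -(quotient_reprK q) !quotient_act_proj act_bracket.
by rewrite addrC -scaleN1r projL scaleN1r addrC.
Qed.
Definition quotient_module : lie_module L :=
  LieModule quotient_act_linearl quotient_act_linearr quotient_act_bracket.
End QuotientModule.

Section DirectSumModule.
Variables (I : choiceType) (W : I -> lie_module L).
Let DS := direct_sum (fun i => W i : lmodType K).

Let dsum_act_fin (x : L) (f : DS) : finite_set [set i | act x (f i) != 0].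
Proof.
apply: (@sub_finite_set _ _ [set i | f i != 0]); last exact: dsum_finite.
by move=> i /=; apply: contraNneq => ->; rewrite act0r.
Qed.
Definition dsum_act (x : L) (f : DS) : DS := DirectSum (dsum_act_fin x f).

Let dsum_act_linearl f : linear (dsum_act^~ f).
Proof. by move=> a x y; apply: dsumP => i /=; rewrite actDl actZl. Qed.
Let dsum_act_linearr x : linear (dsum_act x).
Proof. by move=> a f g; apply: dsumP => i /=; rewrite actDr actZr. Qed.
Let dsum_act_bracket x y f :
  dsum_act (bracket x y) f = dsum_act x (dsum_act y f) - dsum_act y (dsum_act x f).
Proof. by apply: dsumP => i /=; rewrite act_bracket scaleN1r. Qed.
Definition direct_sum_module : lie_module L :=
  LieModule dsum_act_linearl dsum_act_linearr dsum_act_bracket.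
End DirectSumModule.

(* The universal enveloping algebra: formal noncommutative expressions in the
   elements of L, modulo the congruence generated by the axioms of associative
   unital K-algebras, the linearity of L -> U(L), and xy - yx = [x, y] *)
Inductive ue_term : Type :=
| UGen of L
| UZero
| UOne
| UAdd of ue_term & ue_term
| UMul of ue_term & ue_term
| UScale of K & ue_term.

Inductive ue_eq : ue_term -> ue_term -> Prop :=
| ueq_refl s : ue_eq s s
| ueq_sym s t : ue_eq s t -> ue_eq t s
| ueq_trans s t r : ue_eq s t -> ue_eq t r -> ue_eq s r
| ueq_add s s' t t' : ue_eq s s' -> ue_eq t t' -> ue_eq (UAdd s t) (UAdd s' t')
| ueq_mul s s' t t' : ue_eq s s' -> ue_eq t t' -> ue_eq (UMul s t) (UMul s' t')
| ueq_scale a s s' : ue_eq s s' -> ue_eq (UScale a s) (UScale a s')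
| ueq_addA s t r : ue_eq (UAdd s (UAdd t r)) (UAdd (UAdd s t) r)
| ueq_addC s t : ue_eq (UAdd s t) (UAdd t s)
| ueq_add0 s : ue_eq (UAdd UZero s) s
| ueq_addN s : ue_eq (UAdd (UScale (-1) s) s) UZero
| ueq_mulA s t r : ue_eq (UMul s (UMul t r)) (UMul (UMul s t) r)
| ueq_mul1l s : ue_eq (UMul UOne s) s
| ueq_mul1r s : ue_eq (UMul s UOne) s
| ueq_mulDl s t r : ue_eq (UMul (UAdd s t) r) (UAdd (UMul s r) (UMul t r))
| ueq_mulDr s t r : ue_eq (UMul s (UAdd t r)) (UAdd (UMul s t) (UMul s r))
| ueq_scaleA a b s : ue_eq (UScale a (UScale b s)) (UScale (a * b) s)
| ueq_scale1 s : ue_eq (UScale 1 s) s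
| ueq_scaleDr a s t : ue_eq (UScale a (UAdd s t)) (UAdd (UScale a s) (UScale a t))
| ueq_scaleDl a b s : ue_eq (UScale (a + b) s) (UAdd (UScale a s) (UScale b s))
| ueq_scaleAl a s t : ue_eq (UScale a (UMul s t)) (UMul (UScale a s) t)
| ueq_scaleAr a s t : ue_eq (UScale a (UMul s t)) (UMul s (UScale a t))
| ueq_genD x y : ue_eq (UGen (x + y)) (UAdd (UGen x) (UGen y))
| ueq_genZ a x : ue_eq (UGen (a *: x)) (UScale a (UGen x))
| ueq_bracket x y : ue_eq (UGen (bracket x y))
    (UAdd (UMul (UGen x) (UGen y)) (UScale (-1) (UMul (UGen y) (UGen x)))).

Fixpoint ue_term_act (V : lmodType K) (a : L -> V -> V) (t : ue_term) (v : V) : V :=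
  match t with
  | UGen x => a x v
  | UZero => 0
  | UOne => v
  | UAdd s t => ue_term_act a s v + ue_term_act a t v
  | UMul s t => ue_term_act a s (ue_term_act a t v)
  | UScale c s => c *: ue_term_act a s v
  end.

Section TermAction.
Variable V : lie_module L.

Lemma ue_term_act_linear t : linear (ue_term_act (@act K L V) t).
Proof.
elim: t => [x|||s IHs t IHt|s IHs t IHt|c s IHs] a v w //=.
- by rewrite actDr actZr.
- by rewrite scaler0 addr0.
- by rewrite IHs IHt scalerDr addrACA.
- by rewrite IHt IHs.
- by rewrite IHs scalerDr !scalerA mulrC.
Qed.

Lemma ue_term_act_eq s t (v : V) :
  ue_eq s t -> ue_term_act (@act K L V) s v = ue_term_act (@act K L V) t v.
Proof.
move=> st; elim: st v => /= {s t}.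
- by [].
- by move=> s t _ IH v; rewrite IH.
- by move=> s t r _ IH1 _ IH2 v; rewrite IH1 IH2.
- by move=> s s' t t' _ IH1 _ IH2 v; rewrite IH1 IH2.
- by move=> s s' t t' _ IH1 _ IH2 v; rewrite IH1 IH2.
- by move=> a s s' _ IH v; rewrite IH.
- by move=> s t r v; rewrite addrA.
- by move=> s t v; rewrite addrC.
- by move=> s v; rewrite add0r.
- by move=> s v; rewrite scaleN1r addNr.
- by [].
- by [].
- by [].
- by [].
- move=> s t r v.
  by have := ue_term_act_linear s 1 (ue_term_act (@act K L V) t v)
    (ue_term_act (@act K L V) r v); rewrite !scale1r.
- by move=> a b s v; rewrite scalerA.
- by move=> s v; rewrite scale1r.
- by move=> a s t v; rewrite scalerDr.
- by move=> a b s v; rewrite scalerDl.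
- by [].
- move=> a s t v; have h0 := linear_map0 (ue_term_act_linear s).
  by have := ue_term_act_linear s a (ue_term_act (@act K L V) t v) 0; rewrite h0 !addr0.
- by move=> x y v; rewrite actDl.
- by move=> a x v; rewrite actZl.
- by move=> x y v; rewrite act_bracket scaleN1r.
Qed.
End TermAction.

HB.instance Definition _ := gen_eqMixin ue_term.
HB.instance Definition _ := gen_choiceMixin ue_term.

Definition ue_eqb (s t : ue_term) : bool := `[< ue_eq s t >].

Let ue_eqb_equiv : equiv_class_of ue_eqb.
Proof.
split=> [s|s t|t s r].
- by apply/asboolP; apply: ueq_refl.
- by apply/asboolP/asboolP; apply: ueq_sym.
- by move=> /asboolP st /asboolP tr; apply/asboolP; apply: ueq_trans st tr.
Qed.
Canonical ue_equiv := EquivRelPack ue_eqb_equiv.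

Definition uea : Type := {eq_quot ue_eqb}.
HB.instance Definition _ := Choice.on uea.

Definition uclass (t : ue_term) : uea := \pi_({eq_quot ue_eqb}) t.
Definition urepr (x : uea) : ue_term := repr (x : {eq_quot ue_eqb}).

Lemma ureprK x : uclass (urepr x) = x. Proof. exact: reprK. Qed.
Lemma uclassP s t : uclass s = uclass t <-> ue_eq s t.
Proof. by split=> [/eqmodP/asboolP|st]; last apply/eqmodP/asboolP. Qed.
Lemma urepr_class t : ue_eq (urepr (uclass t)) t.
Proof. by apply/uclassP; rewrite ureprK. Qed.

Definition uea_add x y := uclass (UAdd (urepr x) (urepr y)).
Definition uea_mul x y := uclass (UMul (urepr x) (urepr y)).
Definition uea_scale a x := uclass (UScale a (urepr x)).

Lemma uclassD s t : uclass (UAdd s t) = uea_add (uclass s) (uclass t).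
Proof. by apply/uclassP; apply: ueq_add; apply/ueq_sym/urepr_class. Qed.
Lemma uclassM s t : uclass (UMul s t) = uea_mul (uclass s) (uclass t).
Proof. by apply/uclassP; apply: ueq_mul; apply/ueq_sym/urepr_class. Qed.
Lemma uclassZ a s : uclass (UScale a s) = uea_scale a (uclass s).
Proof. by apply/uclassP; apply: ueq_scale; apply/ueq_sym/urepr_class. Qed.

Let uea_addA : associative uea_add.
Proof.
move=> x y z; rewrite -(ureprK x) -(ureprK y) -(ureprK z) -!uclassD.
exact/uclassP/ueq_addA.
Qed.
Let uea_addC : commutative uea_add.
Proof. by move=> x y; apply/uclassP/ueq_addC. Qed.
Let uea_add0 : left_id (uclass UZero) uea_add.
Proof. by move=> x; rewrite -(ureprK x) -!uclassD; apply/uclassP/ueq_add0. Qed.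
Let uea_addN : left_inverse (uclass UZero) (uea_scale (-1)) uea_add.
Proof. by move=> x; rewrite -(ureprK x) -uclassZ -!uclassD; apply/uclassP/ueq_addN. Qed.
HB.instance Definition _ :=
  GRing.isZmodule.Build uea uea_addA uea_addC uea_add0 uea_addN.

Let uea_mulA : associative uea_mul.
Proof.
move=> x y z; rewrite -(ureprK x) -(ureprK y) -(ureprK z) -!uclassM.
exact/uclassP/ueq_mulA.
Qed.
Let uea_mul1l : left_id (uclass UOne) uea_mul.
Proof. by move=> x; rewrite -(ureprK x) -!uclassM; apply/uclassP/ueq_mul1l. Qed.
Let uea_mul1r : right_id (uclass UOne) uea_mul.
Proof. by move=> x; rewrite -(ureprK x) -!uclassM; apply/uclassP/ueq_mul1r. Qed.
Let uea_mulDl : left_distributive uea_mul +%R.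
Proof.
move=> x y z; rewrite -(ureprK x) -(ureprK y) -(ureprK z) -[_ + _]uclassD.
rewrite -!uclassM -[RHS]uclassD; exact/uclassP/ueq_mulDl.
Qed.
Let uea_mulDr : right_distributive uea_mul +%R.
Proof.
move=> x y z; rewrite -(ureprK x) -(ureprK y) -(ureprK z) -[_ + _]uclassD.
rewrite -!uclassM -[RHS]uclassD; exact/uclassP/ueq_mulDr.
Qed.
Let trivial_module : lie_module L.
Proof.
refine (@LieModule K L (K^o : lmodType K) (fun _ _ => 0) _ _ _).
- by move=> v a x y; rewrite scaler0 addr0.
- by move=> v a x y; rewrite scaler0 addr0.
- by move=> x y v; rewrite subr0.
Defined.
Let uea_1neq0 : uclass UOne != 0.
Proof.
apply/eqP => /uclassP /(@ue_term_act_eq trivial_module _ _ (1 : K^o)) /= /eqP.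
by rewrite oner_eq0.
Qed.
HB.instance Definition _ := GRing.Zmodule_isNzRing.Build uea
  uea_mulA uea_mul1l uea_mul1r uea_mulDl uea_mulDr uea_1neq0.

Let uea_scaleA a b x : uea_scale a (uea_scale b x) = uea_scale (a * b) x.
Proof. by rewrite -(ureprK x) -!uclassZ; apply/uclassP/ueq_scaleA. Qed.
Let uea_scale1 : left_id 1 uea_scale.
Proof. by move=> x; rewrite -(ureprK x) -!uclassZ; apply/uclassP/ueq_scale1. Qed.
Let uea_scaleDr : right_distributive uea_scale +%R.
Proof.
move=> a x y; rewrite -(ureprK x) -(ureprK y) -[X in uea_scale a X]uclassD.
rewrite -!uclassZ -[RHS]uclassD.
exact/uclassP/ueq_scaleDr.
Qed.
Let uea_scaleDl x : {morph uea_scale^~ x : a b / a + b}.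
Proof.
move=> a b; rewrite -(ureprK x) -!uclassZ -[RHS]uclassD; exact/uclassP/ueq_scaleDl.
Qed.
HB.instance Definition _ := GRing.Zmodule_isLmodule.Build K uea
  uea_scaleA uea_scale1 uea_scaleDr uea_scaleDl.

Let uea_scaleAl (a : K) (x y : uea) : a *: (x * y) = (a *: x) * y.
Proof.
rewrite -(ureprK x) -(ureprK y) -[X in a *: X]uclassM -[LHS]uclassZ.
by rewrite -[X in X * _]uclassZ -[RHS]uclassM; apply/uclassP/ueq_scaleAl.
Qed.
HB.instance Definition _ := GRing.Lmodule_isLalgebra.Build K uea uea_scaleAl.
Let uea_scaleAr (a : K) (x y : uea) : a *: (x * y) = x * (a *: y).
Proof.
rewrite -(ureprK x) -(ureprK y) -[X in a *: X]uclassM -[LHS]uclassZ.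
by rewrite -[X in _ * X]uclassZ -[RHS]uclassM; apply/uclassP/ueq_scaleAr.
Qed.
HB.instance Definition _ := GRing.Lalgebra_isAlgebra.Build K uea uea_scaleAr.

Definition ugen (x : L) : uea := uclass (UGen x).

(* The extension of an action of L to U(L).  It is defined for any map [a], but
   independent of the representative only at vectors lying in a subspace on
   which [a] is a Lie algebra action. *)
Definition uact (V : lmodType K) (a : L -> V -> V) (x : uea) (v : V) : V :=
  ue_term_act a (urepr x) v.

Section UAct.
Variable V : lie_module L.

Lemma uact_class t (v : V) : uact (@act K L V) (uclass t) v = ue_term_act (@act K L V) t v.
Proof. exact/ue_term_act_eq/urepr_class. Qed.

Lemma uact_gen x (v : V) : uact (@act K L V) (ugen x) v = act x v.
Proof. exact: uact_class. Qed.

Lemma uactM x y (v : V) :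
  uact (@act K L V) (x * y) v = uact (@act K L V) x (uact (@act K L V) y v).
Proof.
rewrite -(ureprK x) -(ureprK y) -[X in uact _ X](uclassM) !uact_class.
by [].
Qed.

Lemma uact_linear x : linear (uact (@act K L V) x).
Proof. exact: ue_term_act_linear. Qed.
End UAct.

End LieModules.

Section LieSum.
Variables (K : fieldType) (L1 L2 : lie_algebra K).

Definition sum_bracket (x y : L1 * L2) : L1 * L2 :=
  (bracket x.1 y.1, bracket x.2 y.2).

Let sum_bracket_linearl y : linear (sum_bracket^~ y).
Proof. by move=> a u v; rewrite /sum_bracket /= bracket_linearl bracket_linearl. Qed.
Let sum_bracket_linearr x : linear (sum_bracket x).
Proof. by move=> a u v; rewrite /sum_bracket /= bracket_linearr bracket_linearr. Qed.
Let sum_bracket_alt x : sum_bracket x x = 0.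
Proof. by rewrite /sum_bracket !bracket_alt. Qed.
Let sum_bracket_jacobi x y z : sum_bracket x (sum_bracket y z) +
  sum_bracket y (sum_bracket z x) + sum_bracket z (sum_bracket x y) = 0.
Proof. by congr pair => /=; apply: bracket_jacobi. Qed.
Definition lie_sum : lie_algebra K := LieAlgebra
  sum_bracket_linearl sum_bracket_linearr sum_bracket_alt sum_bracket_jacobi.

Section ExternalTensor.
Variables (V : lie_module L1) (W : lie_module L2).

Definition tensor_act_pure (x : lie_sum) (v : V) (w : W) : tensor V W :=
  pure (act x.1 v) w + pure v (act x.2 w).

Definition tensor_act (x : lie_sum) : tensor V W -> tensor V W :=
  tensor_lift (tensor_act_pure x).

Let tensor_act_bil x : bilinear_map (tensor_act_pure x).
Proof.
split=> [w|v] a u u'; rewrite /tensor_act_pure /=.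
- by rewrite actDr actZr !pureDl scalerDr addrACA.
- by rewrite actDr actZr !pureDr scalerDr addrACA.
Qed.

Let tensor_act_linearr x : linear (tensor_act x).
Proof. exact: tensor_lift_linear. Qed.

Lemma tensor_act_pureE x v w : tensor_act x (pure v w) = tensor_act_pure x v w.
Proof. exact: tensor_lift_pure. Qed.

Let taD x (t s : tensor V W) : tensor_act x (t + s) = tensor_act x t + tensor_act x s.
Proof. by have := tensor_act_linearr x 1 t s; rewrite !scale1r. Qed.
Let ta0 x : tensor_act x 0 = 0.
Proof. exact: linear_map0 (tensor_act_linearr x). Qed.
Let taZ x a (t : tensor V W) : tensor_act x (a *: t) = a *: tensor_act x t.
Proof. by have := tensor_act_linearr x a t 0; rewrite ta0 !addr0. Qed.

Let tensor_act_linearl t : linear (tensor_act^~ t).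
Proof.
move=> a x y /=; elim/(@tensor_ind K): t => [v w||s t IHs IHt|c t IHt].
- rewrite !tensor_act_pureE /tensor_act_pure /= !actDl !actZl.
  by rewrite pureDl pureDr scalerDr addrACA.
- by rewrite !ta0 scaler0 addr0.
- by rewrite !taD IHs IHt scalerDr addrACA.
- by rewrite !taZ IHt scalerDr !scalerA mulrC.
Qed.

Let pureBl (v v' : V) (w : W) : pure (v - v') w = pure v w - pure v' w.
Proof. by have := pureDl w (-1) v' v; rewrite /= !scaleN1r ![- _ + _]addrC. Qed.
Let pureBr (v : V) (w w' : W) : pure v (w - w') = pure v w - pure v w'.
Proof. by have := pureDr v (-1) w' w; rewrite /= !scaleN1r ![- _ + _]addrC. Qed.
Let zmod_shuffle (A : zmodType) (a b c d m n : A) :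
  (a - b) + (c - d) = ((a + n) + (m + c)) - ((b + m) + (n + d)).
Proof.
rewrite [m + c]addrC [n + d]addrC [a + n + _]addrACA [b + m + _]addrACA.
by rewrite [m + n]addrC [b + d + _]addrC addrKA opprD addrACA.
Qed.

Let tensor_act_bracket x y t : tensor_act (bracket x y) t =
  tensor_act x (tensor_act y t) - tensor_act y (tensor_act x t).
Proof.
elim/(@tensor_ind K): t => [v w||s t IHs IHt|c t IHt].
- rewrite !tensor_act_pureE /tensor_act_pure !taD !tensor_act_pureE /tensor_act_pure /=.
  by rewrite !act_bracket pureBl pureBr; apply: zmod_shuffle.
- by rewrite !ta0 subrr.
- by rewrite !taD IHs IHt opprD addrACA.
- by rewrite !taZ IHt scalerBr.
Qed.
Definition tensor_module : lie_module lie_sum :=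
  LieModule tensor_act_linearl tensor_act_linearr tensor_act_bracket.
End ExternalTensor.
End LieSum.


Definition mx2 (K : pzRingType) (a b c d : K) : 'M[K]_2 :=
  \matrix_(i < 2, j < 2)
    if i == 0 then (if j == 0 then a else b) else (if j == 0 then c else d).

Section SL2.
Variable K : fieldType.

Definition traceless : {pred 'M[K]_2} := fun A => \tr A == 0.

Let traceless_closed : subsemimod_closed traceless.
Proof.
split; first split.
- by rewrite unfold_in mxtrace0.
- by move=> A B /eqP trA /eqP trB; rewrite unfold_in mxtraceD trA trB addr0.
- by move=> a A /eqP trA; rewrite unfold_in mxtraceZ trA mulr0.
Qed.
HB.instance Definition _ :=
  GRing.isSubmodClosed.Build K 'M[K]_2 traceless traceless_closed.

Record sl2_mx : Type := SL2Mx { sl2_val :> 'M[K]_2; _ : sl2_val \in traceless }.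
HB.instance Definition _ := [isSub for sl2_val].
HB.instance Definition _ := [Choice of sl2_mx by <:].
HB.instance Definition _ := [SubChoice_isSubLmodule of sl2_mx by <:].

Lemma sl2_trace (A : sl2_mx) : \tr A = 0.
Proof. exact/eqP/(valP A). Qed.

Let sl2_bracket_tr (A B : sl2_mx) : A *m B - B *m A \in traceless.
Proof. by rewrite unfold_in raddfB /= mxtrace_mulC subrr. Qed.
Definition sl2_bracket (A B : sl2_mx) : sl2_mx := SL2Mx (sl2_bracket_tr A B).

Let sl2_bracket_linearl B : linear (sl2_bracket^~ B).
Proof.
move=> a A A'; apply: val_inj; rewrite /= mulmxDl mulmxDr -scalemxAl -scalemxAr.
by rewrite scalerBr opprD addrACA.
Qed.
Let sl2_bracket_linearr A : linear (sl2_bracket A).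
Proof.
move=> a B B'; apply: val_inj; rewrite /= mulmxDl mulmxDr -scalemxAl -scalemxAr.
by rewrite scalerBr opprD addrACA.
Qed.
Let sl2_bracket_alt A : sl2_bracket A A = 0.
Proof. by apply: val_inj; rewrite /= subrr. Qed.
Let sl2_bracket_jacobi A B D : sl2_bracket A (sl2_bracket B D) +
  sl2_bracket B (sl2_bracket D A) + sl2_bracket D (sl2_bracket A B) = 0.
Proof.
apply: val_inj; apply/matrixP => i j /=.
by rewrite !(mxE, big_ord_recl, big_ord0) /=; ring.
Qed.
Definition sl2 : lie_algebra K := LieAlgebra
  sl2_bracket_linearl sl2_bracket_linearr sl2_bracket_alt sl2_bracket_jacobi.

Let sl2_e_tr : mx2 0 1 0 0 \in traceless.
Proof. by rewrite unfold_in /mxtrace !big_ord_recl big_ord0 !mxE /= !addr0. Qed.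
Let sl2_f_tr : mx2 0 0 1 0 \in traceless.
Proof. by rewrite unfold_in /mxtrace !big_ord_recl big_ord0 !mxE /= !addr0. Qed.
Let sl2_h_tr : mx2 1 0 0 (-1) \in traceless.
Proof. by rewrite unfold_in /mxtrace !big_ord_recl big_ord0 !mxE /= !addr0 subrr. Qed.
Definition sl2_e : sl2 := SL2Mx sl2_e_tr.
Definition sl2_f : sl2 := SL2Mx sl2_f_tr.
Definition sl2_h : sl2 := SL2Mx sl2_h_tr.

Let sl2_omega_tr (A : sl2_mx) : - (A : 'M[K]_2)^T \in traceless.
Proof. by rewrite unfold_in raddfN /= mxtrace_tr sl2_trace oppr0. Qed.
Definition sl2_omega (A : sl2) : sl2 := SL2Mx (sl2_omega_tr A).

Let mx2P (A B : 'M[K]_2) :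
  A 0 0 = B 0 0 -> A 0 1 = B 0 1 -> A 1 0 = B 1 0 -> A 1 1 = B 1 1 -> A = B.
Proof.
have i2 (i : 'I_2) : i = 0 \/ i = 1.
  by case: i => -[|[|//]] ?; [left|right]; apply: val_inj.
by move=> ? ? ? ?; apply/matrixP => i j; have [->|->] := i2 i; have [->|->] := i2 j.
Qed.

Lemma omega_e : sl2_omega sl2_e = - sl2_f.
Proof. by apply/val_inj/mx2P; rewrite /= !mxE /= ?oppr0. Qed.
Lemma omega_h : sl2_omega sl2_h = - sl2_h.
Proof. by apply/val_inj/mx2P; rewrite /= !mxE /= ?oppr0. Qed.
Lemma omega_f : sl2_omega sl2_f = - sl2_e.
Proof. by apply/val_inj/mx2P; rewrite /= !mxE /= ?oppr0. Qed.

Lemma omega_linear : linear sl2_omega.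
Proof. by move=> a A B; apply: val_inj; rewrite /= linearP /= scalerN opprD. Qed.
Lemma omega_bracket A B : sl2_omega (bracket A B) = bracket (sl2_omega A) (sl2_omega B).
Proof.
apply: val_inj => /=; rewrite raddfB /= !trmx_mul !mulNmx !mulmxN !opprK.
by rewrite opprB.
Qed.

Lemma bracket_he : bracket sl2_h sl2_e = 2 *: sl2_e.
Proof.
by apply/val_inj/mx2P; rewrite /= !mxE !big_ord_recl !big_ord0 !mxE /=; ring.
Qed.
Lemma bracket_hf : bracket sl2_h sl2_f = - 2 *: sl2_f.
Proof.
by apply/val_inj/mx2P; rewrite /= !mxE !big_ord_recl !big_ord0 !mxE /=; ring.
Qed.
Lemma sl2_decomp (A : sl2) : A = A 0 1 *: sl2_e + A 0 0 *: sl2_h + A 1 0 *: sl2_f.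
Proof.
have A11 : A 1 1 = - A 0 0.
  have := sl2_trace A; rewrite /mxtrace !big_ord_recl big_ord0 addr0.
  have -> : lift ord0 ord0 = 1 :> 'I_2 by apply: val_inj.
  by move/eqP; rewrite addrC addr_eq0 => /eqP.
by apply/val_inj/mx2P; rewrite /= !mxE /= ?A11; ring.
Qed.

Definition weight_space (V : lie_module sl2) (mu : K) : set V :=
  [set v | act sl2_h v = mu *: v].

Definition h_diagonalizable (V : lie_module sl2) : Prop :=
  forall v : V, exists (n : nat) (mu : 'I_n -> K) (w : 'I_n -> V),
    (forall i, weight_space (mu i) (w i)) /\ v = \sum_(i < n) w i.

Definition locally_e_nilpotent (V : lie_module sl2) : Prop :=
  forall v : V, exists n : nat, iter n (act sl2_e) v = 0.

Definition in_category_O (V : lie_module sl2) : Prop :=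
  [/\ finitely_generated V, locally_e_nilpotent V & h_diagonalizable V].

Definition highest_weight_irreducible (lambda : K) (V : lie_module sl2) : Prop :=
  irreducible V /\
  exists v : V, [/\ v != 0, act sl2_e v = 0 & weight_space lambda v].

Definition projective_in_O (P : lie_module sl2) : Prop :=
  in_category_O P /\
  forall (A B : lie_module sl2) (p : A -> B) (g : P -> B),
    in_category_O A -> in_category_O B ->
    is_hom p -> (forall b, exists a, p a = b) -> is_hom g ->
    exists2 g' : P -> A, is_hom g' & forall x, p (g' x) = g x.

Definition is_projective_cover (P V : lie_module sl2) : Prop :=
  [/\ projective_in_O P, indecomposable P &
      exists p : P -> V, [/\ is_hom p, (forall v, exists x, p x = v) &
        forall N : set P, is_lie_submodule N ->
          (forall v, exists2 x, N x & p x = v) -> N = setT]].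

Section RestrictedDual.
Variable V : lie_module sl2.

(* A linear form lies in the sum of the duals of the weight spaces iff it
   vanishes on all but finitely many of them (V is the sum of its weight spaces) *)
Definition restricted : {pred (V -> K^o)} := fun phi =>
  `[< linear phi /\ exists s : seq K, forall mu v,
        mu \notin s -> weight_space mu v -> phi v = 0 >].

Let restricted_closed : subsemimod_closed restricted.
Proof.
split; first split.
- apply/asboolP; split; last by exists [::].
  by move=> a u v; rewrite scaler0 addr0.
- move=> phi psi /asboolP [lphi [s hs]] /asboolP [lpsi [t ht]]; apply/asboolP; split.
    by move=> a u v; rewrite !fctE lphi lpsi scalerDr addrACA.
  exists (s ++ t) => mu v; rewrite mem_cat negb_or => /andP[ms mt] hv.
  by rewrite !fctE (hs mu) // (ht mu) // addr0.
- move=> a phi /asboolP [lphi [s hs]]; apply/asboolP; split.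
    by move=> b u v; rewrite !fctE lphi scalerDr !scalerA mulrC.
  by exists s => mu v ms hv; rewrite !fctE (hs mu) // scaler0.
Qed.
HB.instance Definition _ :=
  GRing.isSubmodClosed.Build K (V -> K^o) restricted restricted_closed.

Record restricted_dual : Type := RDual { rdual_fun :> V -> K^o; _ : rdual_fun \in restricted }.
HB.instance Definition _ := [isSub for rdual_fun].
HB.instance Definition _ := [Choice of restricted_dual by <:].
HB.instance Definition _ := [SubChoice_isSubLmodule of restricted_dual by <:].

Lemma rdual_linear (phi : restricted_dual) : linear phi.
Proof. by have /asboolP[] := valP phi. Qed.

Let weight_e mu v : weight_space mu v -> weight_space (mu + 2) (act sl2_e v : V).
Proof.
rewrite /weight_space /= => hv.
have := act_bracket sl2_h sl2_e v; rewrite bracket_he actZl hv actZr.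
by move/esym/eqP; rewrite subr_eq -scalerDl => /eqP ->; rewrite addrC.
Qed.
Let weight_f mu v : weight_space mu v -> weight_space (mu - 2) (act sl2_f v : V).
Proof.
rewrite /weight_space /= => hv.
have := act_bracket sl2_h sl2_f v; rewrite bracket_hf actZl hv actZr.
by move/esym/eqP; rewrite subr_eq -scalerDl => /eqP ->; rewrite addrC.
Qed.

Let star_restricted (A : sl2) (phi : restricted_dual) :
  (fun v => - phi (act (sl2_omega A) v)) \in restricted.
Proof.
have lphi := rdual_linear phi; have /asboolP[_ [s hs]] := valP phi.
apply/asboolP; split.
  by move=> a u v; rewrite actDr actZr lphi scalerN opprD.
exists (s ++ [seq mu - 2 | mu <- s] ++ [seq mu + 2 | mu <- s]) => mu v.
rewrite !mem_cat !negb_or => /and3P[m0 m1 m2] hv.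
have he : phi (act sl2_e v) = 0.
  apply: hs (weight_e hv); apply: contra m1 => m1.
  by apply/mapP; exists (mu + 2) => //; rewrite addrK.
have hf : phi (act sl2_f v) = 0.
  apply: hs (weight_f hv); apply: contra m2 => m2.
  by apply/mapP; exists (mu - 2) => //; rewrite subrK.
have hh : phi (act sl2_h v) = 0.
  by rewrite hv -[_ *: v]addr0 lphi (linear_map0 lphi) (hs mu) // scaler0 addr0.
rewrite (sl2_decomp (sl2_omega A)) !actDl !actZl -addrA !lphi -[_ *: act sl2_f v]addr0 lphi.
by rewrite he hh hf (linear_map0 lphi) !scaler0 !addr0 oppr0.
Qed.

Definition star_act (A : sl2) (phi : restricted_dual) : restricted_dual := RDual (star_restricted A phi).

Let star_linearl phi : linear (star_act^~ phi).
Proof.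
move=> a A B; apply: val_inj; apply/funext => v.
rewrite /= !fctE /= omega_linear actDl actZl rdual_linear.
by rewrite scalerN opprD.
Qed.
Let star_linearr A : linear (star_act A).
Proof. by move=> a p q; apply: val_inj; apply/funext => v; rewrite /= !fctE /= opprD scalerN. Qed.
Let star_bracket A B phi :
  star_act (bracket A B) phi = star_act A (star_act B phi) - star_act B (star_act A phi).
Proof.
apply: val_inj; apply/funext => v; rewrite /= !fctE /= omega_bracket act_bracket.
have phiB x y : phi (x - y) = phi x - phi y.
  by have := rdual_linear phi (-1) y x; rewrite !scaleN1r ![- _ + _]addrC.
by rewrite phiB opprB !opprK.
Qed.
Definition star : lie_module sl2 := LieModule star_linearl star_linearr star_bracket.

Definition matrix_element (v : V) (v' : star) : uea sl2 -> K^o :=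
  fun x => (v' : restricted_dual) (uact (@act K sl2 V) x v).

Definition matrix_elements : set (uea sl2 -> K^o) :=
  lspan [set phi | exists v v', phi = matrix_element v v'].

Lemma matrix_element_bilinear : bilinear_map matrix_element.
Proof.
split=> [v'|v] a u w; apply/funext => x; rewrite /matrix_element !fctE.
- by rewrite uact_linear rdual_linear.
- by [].
Qed.

Definition matrix_element_map : tensor V star -> (uea sl2 -> K^o) :=
  tensor_lift matrix_element.
End RestrictedDual.

Definition gg : lie_algebra K := lie_sum sl2 sl2.

(* (A_1, A_2) acts by pi_l(A_1) + pi_r(A_2).  Functionals are arbitrary maps
   U(g) -> K: all those considered below lie in the restricted dual of U(g). *)
Definition uea_dual_act (A : gg) (phi : uea sl2 -> K^o) : uea sl2 -> K^o :=
  (fun x => phi (x * ugen A.1)) + (fun x => - phi (ugen (sl2_omega A.2) * x)).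

Section Kernel.
Variable V : lie_module sl2.

Lemma matrix_element_map_hom (A : gg) (t : tensor V (star V)) :
  matrix_element_map (tensor_act A t) = uea_dual_act A (matrix_element_map t).
Proof.
have bil := @matrix_element_bilinear V.
have lin := tensor_lift_linear bil.
have linA : linear (tensor_act A : tensor V (star V) -> _) by exact: (@act_linearr _ _ (tensor_module V (star V))).
have mm0 : matrix_element_map (0 : tensor V (star V)) = 0 by exact: linear_map0 lin.
have mmD (x y : tensor V (star V)) : matrix_element_map (x + y) = matrix_element_map x + matrix_element_map y.
  by have := lin 1 x y; rewrite !scale1r.
have mmZ a (x : tensor V (star V)) : matrix_element_map (a *: x) = a *: matrix_element_map x.
  by have := lin a x 0; rewrite -/(matrix_element_map _) addr0 => ->; rewrite (linear_map0 lin) addr0.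
elim/(@tensor_ind K): t => [v w||s t IHs IHt|c t IHt].
- rewrite tensor_act_pureE mmD /matrix_element_map !tensor_lift_pure //.
  apply/funext => x; rewrite /uea_dual_act /matrix_element !fctE /=.
  by rewrite !uactM !uact_gen.
- rewrite (linear_map0 linA) mm0; apply/funext => x.
  by rewrite /uea_dual_act !fctE oppr0 addr0.
- have := linA 1 s t; rewrite !scale1r => ->; rewrite !mmD IHs IHt; apply/funext => x.
  by rewrite /uea_dual_act !fctE opprD addrACA.
- have := linA c t 0; rewrite (linear_map0 linA) !addr0 => ->; rewrite !mmZ IHt; apply/funext => x.
  by rewrite /uea_dual_act !fctE scalerDr scalerN.
Qed.

Definition vanishing_elements : set (tensor_module V (star V)) :=
  [set t | matrix_element_map t = 0].

Lemma vanishing_elements_submodule : is_lie_submodule vanishing_elements.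
Proof.
have lin := tensor_lift_linear (@matrix_element_bilinear V).
split; first split.
- exact: linear_map0 lin.
- move=> a x y; rewrite /vanishing_elements /= => hx hy.
  by rewrite [LHS]lin -!/(matrix_element_map _) hx hy scaler0 addr0.
- move=> A t; rewrite /vanishing_elements /= => ht.
  rewrite [LHS]matrix_element_map_hom ht; apply/funext => x.
  by rewrite /uea_dual_act !fctE oppr0 addr0.
Qed.

Definition tensor_mod_vanishing : lie_module gg :=
  quotient_module vanishing_elements_submodule.
End Kernel.

End SL2.


(* Naming the field makes the topology of [numFieldType]s available on R[i]. *)
Definition complexes (R : realType) : numClosedFieldType := R[i].

Section BigCell.
Variable R : realType.
Local Notation C := (complexes R).

Definition w0 : 'M[C]_2 := mx2 0 (-1) 1 0.

Definition bruhat (x z y : C) : 'M[C]_2 :=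
  mx2 1 x 0 1 *m w0 *m mx2 z 0 0 z^-1 *m mx2 1 y 0 1.

Definition in_big_cell (g : 'M[C]_2) : Prop :=
  exists x z y, z != 0 /\ g = bruhat x z y.

Definition big_cell : Type := {g : 'M[C]_2 | `[< in_big_cell g >]}.

(* The value of psi at a matrix; it is meaningful on the big cell only. *)
Definition cell_eval (psi : big_cell -> C^o) (g : 'M[C]_2) : C :=
  if insub g is Some g' then psi g' else 0.

(* C[x, y, z, z^-1] : monomials are given as (coefficient, (deg x, deg z, deg y)) *)
Definition regular_functions : set (big_cell -> C^o) :=
  [set psi | exists s : seq (C * (nat * int * nat)),
     forall x z y : C, z != 0 -> cell_eval psi (bruhat x z y) =
       \sum_(m <- s) m.1 * x ^+ m.2.1.1 * z ^ m.2.1.2 * y ^+ m.2.2].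

Definition mx_exp (A : 'M[C]_2) : 'M[C]_2 :=
  \matrix_(i, j) lim (series (fun k => (k`!%:R^-1 *: A ^+ k) i j : C) @ \oo).

Definition pi_l (u : sl2 C) (psi : big_cell -> C^o) : big_cell -> C^o :=
  fun g => derive1 (fun t : C => cell_eval psi (mx_exp (- t *: (u : sl2_mx C)) *m val g)) 0.

Definition pi_r (u : sl2 C) (psi : big_cell -> C^o) : big_cell -> C^o :=
  fun g => derive1 (fun t : C => cell_eval psi (val g *m mx_exp (t *: (u : sl2_mx C)))) 0.

Definition pi_lr (u : gg C) (psi : big_cell -> C^o) : big_cell -> C^o :=
  pi_l u.1 psi + pi_r u.2 psi.

(* [uact pi_l] is only meaningful on [regular_functions], which pi_l makes into
   a g-module; pi_l is not a Lie algebra action on all functions. *)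
Definition regular_to_dual (psi : big_cell -> C^o) : uea (sl2 C) -> C^o :=
  fun x => cell_eval (uact pi_l x psi) w0.

End BigCell.

(* -P^++ *)
Definition big_weight : choiceType := {l : int | l <= -1}.

(* Main.v *)
From HB Require Import structures.
Require Import Defs.
From mathcomp Require Import all_boot all_order all_algebra.
From mathcomp Require Import complex.
From mathcomp Require Import all_classical all_reals.
From mathcomp Require Import topology normedtype sequences derive exp.
From mathcomp Require Import ring zify.

(**
  On the big cell [pi_l], [pi_r] act on the monomials x^i z^k y^j by differential operators;
  with coefficients [u (i, k, j)] taken relative to (-1)^i x^i z^k y^j / (i! j!), the functional
  attached to a regular function sends f^a h^c e^b to the sum over k of k^c u(b, k, a).  This gives
  injectivity (Vandermonde) and identifies the image with the functionals for which only finitely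
  many (a, b) occur and h acts semisimply with integral eigenvalues, so that it contains the matrix
  elements of every module of the category O with integral weights.

  For the converse, no description of P_lambda is needed: if x in P_lambda is a vector of weight
  lambda over the highest weight vector of V_lambda, projectivity maps P_lambda to an explicit
  module D, an extension of two Verma modules mapping onto V_lambda, and the matrix elements of D
  between the image of x and two coordinate functionals generate, as lambda varies, all monomials
  under g + g (induction on k).

  Finally x generates P_lambda and is killed by a polynomial in the Casimir operator, whence
  P_lambda has a single generalized Casimir eigenvalue.  These eigenvalues are distinct for distinct
  lambda < 0, so the sum of the spaces of matrix elements is direct.
*)

Set Implicit Arguments.
Unset Strict Implicit.
Unset Printing Implicit Defensive.

Import Order.TTheory GRing.Theory Num.Theory.
Local Open Scope classical_set_scope.
Local Open Scope ring_scope.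

(** * The coefficient model of the regular functions *)

(** The obstruction behind the converse is visible on monomials: [f] sends the one of index (i, k,
    j) to (i + 1)(k - i) times the one of index (i + 1, k, j), plus a term with k lowered by 2. For
    k < 0 the factor never vanishes, so one seed per k gives all monomials. For k = n >= 0 it
    vanishes at i = n, and for the right action at j = n: the indices fall into four quadrants, each
    of which is given a seed. The Verma quotient of D, of highest weight lambda, supplies the seeds
    with k < 0. For lambda < -1 the others come from its Verma submodule, of highest weight - lambda
    - 2, because a power of e carries the image of x to a nonzero multiple of the highest weight
    vector there. That image is known only up to a multiple alpha of the singular vector of the
    submodule, over which projectivity gives no control; alpha only multiplies a monomial with k =
    lambda < 0, which is already available. The factorials in the normalization make the operators
    on coefficients agree with e^b f = f e^b + b e^(b-1) (h + b - 1), so that functions on the cell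
    and matrix elements obey the same formulas. *)

Lemma ord2E : ((0 : 'I_2) = ord0) * ((1 : 'I_2) = lift ord0 ord0).
Proof. by split; apply: val_inj. Qed.

Lemma ord2P (i : 'I_2) : i = 0 \/ i = 1.
Proof. by case: i => -[|[|//]] ?; [left|right]; apply: val_inj. Qed.

Lemma fsbig_uniq (V : nmodType) (I : choiceType) (s : seq I) (F : I -> V) :
  uniq s -> (forall i, i \notin s -> F i = 0) ->
  \sum_(i \in [set: I]) F i = \sum_(i <- s) F i.
Proof.
move=> us hs; rewrite -(fsbig_widen [set` s]) //=; last first.
  by move=> i [_ /negP si] /=; exact: hs.
exact/esym/fsbig_seq.
Qed.

Lemma finite_support_seq (V : nmodType) (I : choiceType) (F : I -> V) :
  finite_set [set i | F i != 0] -> exists2 s : seq I, uniq s & forall i, i \notin s -> F i = 0.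
Proof.
move=> /finite_seqP[s hs]; exists (undup s); first exact: undup_uniq.
move=> i; rewrite mem_undup => si; apply/eqP; apply: contraNT si => Fi.
by have : [set i | F i != 0] i by []; rewrite hs.
Qed.

Section Coefficients.
Variable K : fieldType.

Definition mindex : choiceType := (nat * int * nat)%type.
Implicit Types (u v : mindex -> K^o) (A B : sl2 K).

(** [lower_e], [weight_h] and [raise_f] are -d/dx, z d/dz - 2 x d/dx and x^2 d/dx - x z d/dz +
    z^(-2) d/dy, read on normalized coefficients. *)
Definition lower_e u : mindex -> K^o := fun m => u (m.1.1.+1, m.1.2, m.2).
Definition weight_h u : mindex -> K^o := fun m => (m.1.2%:~R - 2 * m.1.1%:R) * u m.
Definition raise_f u : mindex -> K^o := fun m =>
  m.1.1%:R * (m.1.2%:~R - m.1.1%:R + 1) * u (m.1.1.-1, m.1.2, m.2)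
  + u (m.1.1, m.1.2 + 2, m.2.+1).

Definition coef_act A u : mindex -> K^o :=
  A 0 1 *: lower_e u + A 0 0 *: weight_h u + A 1 0 *: raise_f u.

Lemma coef_actE A u i k j : coef_act A u (i, k, j) =
  A 0 1 * u (i.+1, k, j) + A 0 0 * ((k%:~R - 2 * i%:R) * u (i, k, j))
  + A 1 0 * (i%:R * (k%:~R - i%:R + 1) * u (i.-1, k, j) + u (i, k + 2, j.+1)).
Proof. by []. Qed.

Lemma sl2_11 A : A 1 1 = - A 0 0.
Proof.
have := sl2_trace A; rewrite /mxtrace !big_ord_recl big_ord0 addr0.
have -> : lift ord0 ord0 = 1 :> 'I_2 by apply: val_inj.
by move/eqP; rewrite addrC addr_eq0 => /eqP.
Qed.

Lemma sl2_bracketE A B : let D := bracket A B : sl2 K in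
  [/\ D 0 1 = 2 * (A 0 0 * B 0 1 - A 0 1 * B 0 0),
      D 0 0 = A 0 1 * B 1 0 - B 0 1 * A 1 0 &
      D 1 0 = 2 * (A 1 0 * B 0 0 - A 0 0 * B 1 0)].
Proof.
have -> : (0 : 'I_2) = ord0 by apply: val_inj.
have E : (1 : 'I_2) = lift ord0 ord0 by apply: val_inj.
rewrite /=; split; rewrite !mxE !big_ord_recl !big_ord0 -?E ?sl2_11; ring.
Qed.

Lemma coef_act_linearl u : linear (coef_act^~ u).
Proof.
move=> a A B; apply/funext => -[[i k] j]; rewrite !fctE /= !coef_actE /= !mxE.
rewrite /GRing.scale /=.
ring.
Qed.

Lemma coef_act_linearr A : linear (coef_act A).
Proof.
move=> a u v; apply/funext => -[[i k] j]; rewrite !fctE /= !coef_actE.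
rewrite /GRing.scale /=.
ring.
Qed.

Lemma coef_act_bracket A B u : coef_act (bracket A B) u =
  coef_act A (coef_act B u) - coef_act B (coef_act A u).
Proof.
apply/funext => -[[i k] j]; rewrite !fctE /= !coef_actE.
have [-> -> ->] := sl2_bracketE A B.
case: i => [|i] /=; rewrite ?rmorphD /= -?natr1.
all: ring.
Qed.

Definition coef_module : lie_module (sl2 K) :=
  LieModule coef_act_linearl coef_act_linearr coef_act_bracket.

(** Pullback along g |-> - g^(-1), which maps the coordinates (x, z, y) of the cell to (-y, z, -x);
    the signs are absorbed by the normalization. This map exchanges the two translations, hence
    conjugation by it turns the left action into the right one. *)
Definition swap_xy u : mindex -> K^o := fun m => u (m.2, m.1.2, m.1.1).
Definition coef_act_r A u := swap_xy (coef_act A (swap_xy u)).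

Lemma coef_act_comm A B u : coef_act A (coef_act_r B u) = coef_act_r B (coef_act A u).
Proof.
apply/funext => -[[i k] j]; rewrite /coef_act_r /swap_xy /= !coef_actE /=.
case: i => [|i]; case: j => [|j] /=; rewrite ?rmorphD /= -?natr1.
all: ring.
Qed.

Definition delta (m : mindex) : mindex -> K^o := fun m' => (m' == m)%:R.

Lemma coef_act_delta A i k j : coef_act A (delta (i, k, j)) =
  (A 0 1 *: (if i is i'.+1 then delta (i', k, j) else 0)
   + (A 0 0 * (k%:~R - 2 * i%:R)) *: delta (i, k, j))
  + A 1 0 *: ((i.+1%:R * (k%:~R - i%:R)) *: delta (i.+1, k, j)
     + (if j is j'.+1 then delta (i, k - 2, j') else 0)).
Proof.
apply/funext => -[[a c] b]; rewrite coef_actE !fctE /delta /GRing.scale /= !xpair_eqE.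
have -> : (c + 2 == k) = (c == k - 2) by rewrite -[RHS](inj_eq (addIr 2)) subrK.
congr (_ + _ + _ * (_ + _)).
- by congr (_ * _); case: i => [|i]; rewrite ?eqSS // fctE.
- rewrite mulrA; case: eqP => [->|_] /=; last by rewrite !mulr0.
  by case: eqP => [->|_] //=; rewrite !mulr0.
- case: a => [|a] /=; first by rewrite !mul0r mulr0.
  rewrite eqSS; case: eqP => [->|_] /=; last by rewrite !mulr0.
  case: eqP => [->|_] /=; last by rewrite !mulr0.
  by rewrite -[i.+1]addn1 natrD; congr (_ * _ * _); ring.
- by case: j => [|j]; rewrite ?andbF ?fctE //= eqSS.
Qed.

Definition finsupp u := exists s : seq mindex, forall m, m \notin s -> u m = 0.

Lemma finsupp0 : finsupp 0. Proof. by exists [::]. Qed.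
Lemma finsupp_lin a u v : finsupp u -> finsupp v -> finsupp (a *: u + v).
Proof.
move=> [s hs] [t ht]; exists (s ++ t) => m; rewrite mem_cat negb_or => /andP[ms mt].
by rewrite !fctE hs // ht // scaler0 addr0.
Qed.
Lemma finsuppD u v : finsupp u -> finsupp v -> finsupp (u + v).
Proof. by move=> hu hv; rewrite -[u]scale1r; apply: finsupp_lin. Qed.
Lemma finsuppZ a u : finsupp u -> finsupp (a *: u).
Proof. by move=> hu; rewrite -[_ *: _]addr0; apply: finsupp_lin => //; exact: finsupp0. Qed.
Lemma finsupp_delta m : finsupp (delta m).
Proof. by exists [:: m] => n; rewrite inE /delta => /negbTE ->. Qed.

Lemma finsupp_span (P : (mindex -> K^o) -> Prop) :
  P 0 -> (forall a u v, P u -> P v -> P (a *: u + v)) -> (forall m, P (delta m)) ->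
  forall u, finsupp u -> P u.
Proof.
move=> P0 PL Pd u [s hs].
have -> : u = \sum_(m <- undup s) u m *: delta m.
  apply/funext => n; rewrite fct_sumE.
  case: (boolP (n \in undup s)) => [ns|]; last first.
    move=> ns; rewrite (hs n); last by rewrite -mem_undup.
    rewrite big_seq big1 // => m ms.
    rewrite fctE /delta; case: eqP => [E|_]; last by rewrite scaler0.
    by rewrite E ms in ns.
  rewrite (bigD1_seq n) ?undup_uniq //= big1 ?addr0.
    by rewrite fctE /delta eqxx /GRing.scale /= mulr1.
  by move=> m mn; rewrite fctE /delta eq_sym (negbTE mn) scaler0.
elim: (undup s) => [|m t IH]; first by rewrite big_nil.
by rewrite big_cons; apply: PL.
Qed.

Lemma finsupp_act A u : finsupp u -> finsupp (coef_act A u).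
Proof.
move: u; apply: finsupp_span.
- by rewrite (linear_map0 (coef_act_linearr A)); exact: finsupp0.
- by move=> a u v hu hv; rewrite coef_act_linearr; exact: finsupp_lin.
move=> [[i k] j]; rewrite coef_act_delta; apply: finsuppD; first apply: finsuppD.
- by apply: finsuppZ; case: i => [|i]; [exact: finsupp0|exact: finsupp_delta].
- exact/finsuppZ/finsupp_delta.
- apply/finsuppZ/finsuppD; first exact/finsuppZ/finsupp_delta.
  by case: j => [|j]; [exact: finsupp0|exact: finsupp_delta].
Qed.

Lemma finsupp_swap u : finsupp u -> finsupp (swap_xy u).
Proof.
move=> [s hs]; exists [seq (m.2, m.1.2, m.1.1) | m <- s] => -[[i k] j] h.
by apply: hs; apply: contra h => h; apply/mapP; exists (j, k, i).
Qed.

Lemma finsupp_act_r A u : finsupp u -> finsupp (coef_act_r A u).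
Proof. by move=> hu; apply/finsupp_swap/finsupp_act/finsupp_swap. Qed.

(** F is an arbitrary family of values: evaluation at a matrix, derivative along a curve and
    evaluation at [w0] are all pairings of this kind. *)
Definition fsum u (F : mindex -> K) : K := \sum_(m \in [set: mindex]) u m * F m.

Lemma fsumE s u F : uniq s -> (forall m, m \notin s -> u m = 0) ->
  fsum u F = \sum_(m <- s) u m * F m.
Proof.
by move=> us hs; rewrite /fsum (fsbig_uniq us) // => m /hs ->; rewrite mul0r.
Qed.

Lemma fsum_lin a u v F : finsupp u -> finsupp v ->
  fsum (a *: u + v) F = a * fsum u F + fsum v F.
Proof.
move=> [s hs] [t ht]; have U := undup_uniq (s ++ t).
have hs' m : m \notin undup (s ++ t) -> u m = 0 /\ v m = 0.
  by rewrite mem_undup mem_cat negb_or => /andP[/hs -> /ht ->].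
rewrite !(fsumE _ U); try by move=> m /hs' [].
  rewrite mulr_sumr -big_split /=; apply: eq_bigr => m _.
  by rewrite !fctE mulrDl mulrA.
by move=> m /hs' []; rewrite !fctE => -> ->; rewrite scaler0 addr0.
Qed.

Lemma fsum0 F : fsum 0 F = 0.
Proof. by rewrite (@fsumE [::]) // big_nil. Qed.

Lemma fsum_delta m F : fsum (delta m) F = F m.
Proof.
rewrite (@fsumE [:: m]) ?big_seq1 /delta ?eqxx ?mul1r // => n.
by rewrite inE => /negbTE ->.
Qed.

Lemma finsuppB u v : finsupp u -> finsupp v -> finsupp (u - v).
Proof. by move=> hu hv; apply: finsuppD => //; rewrite -scaleN1r; exact: finsuppZ. Qed.

Lemma fsumD u v F : finsupp u -> finsupp v -> fsum (u + v) F = fsum u F + fsum v F.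
Proof. by move=> hu hv; have := fsum_lin 1 F hu hv; rewrite scale1r mul1r. Qed.
Lemma fsumZ a u F : finsupp u -> fsum (a *: u) F = a * fsum u F.
Proof. by move=> hu; have := fsum_lin a F hu (finsupp0); rewrite fsum0 !addr0. Qed.

(** The transpose of [coef_act]: its value at m is the pairing of [coef_act A (delta m)] with F. It
    reduces identities about the action to identities on single monomials. *)
Definition coef_act_tr A (F : mindex -> K) : mindex -> K := fun m =>
  let: (i, k, j) := m in
  A 0 1 * (if i is i'.+1 then F (i', k, j) else 0)
  + A 0 0 * (k%:~R - 2 * i%:R) * F (i, k, j)
  + A 1 0 * (i.+1%:R * (k%:~R - i%:R) * F (i.+1, k, j)
     + (if j is j'.+1 then F (i, k - 2, j') else 0)).

Lemma fsum_act A u F : finsupp u -> fsum (coef_act A u) F = fsum u (coef_act_tr A F).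
Proof.
move=> hu; suff [] : finsupp u /\ fsum (coef_act A u) F = fsum u (coef_act_tr A F) by [].
move: u hu; apply: finsupp_span.
- by split; [exact: finsupp0|rewrite (linear_map0 (coef_act_linearr A)) !fsum0].
- move=> a u v [hu Eu] [hv Ev]; split; first exact: finsupp_lin.
  by rewrite coef_act_linearr !fsum_lin ?Eu ?Ev //; exact: finsupp_act.
move=> [[i k] j]; split; first exact: finsupp_delta.
have fi : finsupp (if i is i'.+1 then delta (i', k, j) else 0).
  by case: i => [|i]; [exact: finsupp0|exact: finsupp_delta].
have fj : finsupp (if j is j'.+1 then delta (i, k - 2, j') else 0).
  by case: j {fi} => [|j]; [exact: finsupp0|exact: finsupp_delta].
rewrite coef_act_delta fsumD; last first.
- by apply/finsuppZ/finsuppD; [exact/finsuppZ/finsupp_delta|].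
- by apply: finsuppD; [exact: finsuppZ|exact/finsuppZ/finsupp_delta].
rewrite fsumD; last first.
- exact/finsuppZ/finsupp_delta.
- exact: finsuppZ.
rewrite !fsumZ //; last first.
- exact: finsupp_delta.
- by apply/finsuppD; [exact/finsuppZ/finsupp_delta|].
rewrite fsumD //; last exact/finsuppZ/finsupp_delta.
rewrite fsumZ; last exact: finsupp_delta.
rewrite !fsum_delta /=; congr (_ * _ + _ + _ * (_ + _)).
- by case: i {fi fj} => [|i]; rewrite ?fsum0 ?fsum_delta.
- by case: j {fi fj} => [|j]; rewrite ?fsum0 ?fsum_delta.
Qed.

Lemma fsum_swap u F : finsupp u ->
  fsum (swap_xy u) F = fsum u (fun m => F (m.2, m.1.2, m.1.1)).
Proof.
move=> hu; suff [] : finsupp u /\ fsum (swap_xy u) F = fsum u (fun m => F (m.2, m.1.2, m.1.1)) by [].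
move: u hu; apply: finsupp_span.
- by split; [exact: finsupp0|rewrite (_ : swap_xy 0 = 0) ?fsum0].
- move=> a u v [hu Eu] [hv Ev]; split; first exact: finsupp_lin.
  by rewrite (_ : swap_xy _ = a *: swap_xy u + swap_xy v) // !fsum_lin ?Eu ?Ev //; exact: finsupp_swap.
move=> [[i k] j]; split; first exact: finsupp_delta.
rewrite (_ : swap_xy _ = delta (j, k, i)) ?fsum_delta //.
apply/funext => -[[a c] b]; rewrite /swap_xy /delta !xpair_eqE /=.
by rewrite andbC andbA andbAC.
Qed.

(* Evaluation at [w0], where x = y = 0 and z = 1. *)
Definition base_value u : K := fsum u (fun m => ((m.1.1 == 0%N) && (m.2 == 0%N))%:R).

(** One has w0 exp(tA) = exp(t w0 A w0^(-1)) w0, and w0 A w0^(-1) is minus the transpose of A, that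
    is [sl2_omega A]: at w0 a right translation is a left translation. *)
Lemma base_value_act_r A u : finsupp u ->
  base_value (coef_act_r A u) = - base_value (coef_act (sl2_omega A) u).
Proof.
move=> hu; rewrite /base_value /coef_act_r fsum_swap; last exact/finsupp_act/finsupp_swap.
rewrite fsum_act ?fsum_swap ?fsum_act //; last exact: finsupp_swap.
suff E m : coef_act_tr A (fun m : mindex => ((m.2 == 0%N) && (m.1.1 == 0%N))%:R) (m.2, m.1.2, m.1.1)
    = -1 * coef_act_tr (sl2_omega A) (fun m : mindex => ((m.1.1 == 0%N) && (m.2 == 0%N))%:R) m.
  case: hu => s hs; have U := undup_uniq s.
  have hs' m : m \notin undup s -> u m = 0 by rewrite mem_undup => /hs.
  rewrite !(fsumE _ U) // -sumrN; apply: eq_bigr => m _.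
  by rewrite E mulN1r mulrN.
case: m => [[i k] j] /=; rewrite !mxE.
case: i => [|[|i]]; case: j => [|[|j]] /=; ring.
Qed.

Lemma coef_uact_comm A (t : ue_term (sl2 K)) u :
  ue_term_act coef_act t (coef_act_r A u) = coef_act_r A (ue_term_act coef_act t u).
Proof.
have linA : linear (coef_act_r A).
  move=> a v w; rewrite /coef_act_r (_ : swap_xy (a *: v + w) = a *: swap_xy v + swap_xy w) //.
  by rewrite coef_act_linearr.
elim: t u => [B|||s IHs t IHt|s IHs t IHt|c s IHs] u /=.
- exact: coef_act_comm.
- by rewrite (linear_map0 linA).
- by [].
- by rewrite IHs IHt; have := linA 1 (ue_term_act coef_act s u) (ue_term_act coef_act t u); rewrite !scale1r.
- by rewrite IHt IHs.
- by rewrite IHs; have := linA c (ue_term_act coef_act s u) 0; rewrite (linear_map0 linA) !addr0.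
Qed.

Lemma finsupp_uact (t : ue_term (sl2 K)) u : finsupp u -> finsupp (ue_term_act coef_act t u).
Proof.
elim: t u => [B|||s IHs t IHt|s IHs t IHt|c s IHs] u hu //=.
- exact: finsupp_act.
- exact: finsupp0.
- by apply: finsuppD; [exact: IHs|exact: IHt].
- exact/IHs/IHt.
- exact/finsuppZ/IHs.
Qed.

Definition coef_functional u : uea (sl2 K) -> K^o :=
  fun x => base_value (uact coef_act x u).

Lemma coef_uactM x y u :
  uact coef_act (x * y) u = uact coef_act x (uact coef_act y u).
Proof. exact: (@uactM _ _ coef_module). Qed.
Lemma coef_uact_gen A u : uact coef_act (ugen A) u = coef_act A u.
Proof. exact: (@uact_gen _ _ coef_module). Qed.

Lemma base_value_lin a u v : finsupp u -> finsupp v ->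
  base_value (a *: u + v) = a * base_value u + base_value v.
Proof. exact: fsum_lin. Qed.

Lemma coef_functional_lin a u v : finsupp u -> finsupp v ->
  coef_functional (a *: u + v) = a *: coef_functional u + coef_functional v.
Proof.
move=> hu hv; apply/funext => x; rewrite /coef_functional !fctE.
rewrite [X in base_value X](@uact_linear _ _ coef_module) base_value_lin //; exact: finsupp_uact.
Qed.

(** The left action becomes right multiplication in the enveloping algebra. The right action
    commutes with the operators of x, hence can be moved next to the evaluation at w0, where
    [base_value_act_r] makes it a left operator. *)
Lemma coef_functional_act (A : gg K) u : finsupp u ->
  coef_functional (coef_act A.1 u + coef_act_r A.2 u) = uea_dual_act A (coef_functional u).
Proof.
move=> hu; apply/funext => x; rewrite /coef_functional /uea_dual_act !fctE.
have -> : uact coef_act x (coef_act A.1 u + coef_act_r A.2 u) =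
   uact coef_act x (coef_act A.1 u) + coef_act_r A.2 (uact coef_act x u).
  rewrite /uact -coef_uact_comm.
  by have := @ue_term_act_linear _ _ coef_module (urepr x) 1 (coef_act A.1 u) (coef_act_r A.2 u); rewrite !scale1r.
rewrite /base_value fsumD -!/(base_value _).
- rewrite base_value_act_r ?coef_uactM ?coef_uact_gen //; exact: finsupp_uact.
- exact/finsupp_uact/finsupp_act.
- exact/finsupp_act_r/finsupp_uact.
Qed.

End Coefficients.

(** * Injectivity of the map from coefficients to functionals *)

Section Injectivity.
Variable K : numFieldType.

Let iter_tr_e n i k j (F : mindex -> K) :
  iter n (coef_act_tr (sl2_e K)) F (i, k, j) = if (n <= i)%N then F ((i - n)%N, k, j) else 0.
Proof.
elim: n i => [|n IH] i; first by rewrite subn0.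
rewrite iterS /= !mxE /= !mul0r !addr0 mul1r.
by case: i => [|i] //; rewrite IH ltnS subSS.
Qed.

Let iter_tr_f n i k j (F : mindex -> K) : (forall i k j, F (i.+1, k, j) = 0) ->
  iter n (coef_act_tr (sl2_f K)) F (i, k, j) = if (i == 0%N) && (n <= j)%N then F (0%N, k - 2 *+ n, (j - n)%N) else 0.
Proof.
move=> F0; elim: n i k j => [|n IH] i k j.
  by rewrite subn0 mulr0n subr0 andbT; case: i => [|i] //=; rewrite F0.
rewrite iterS /= !mxE /= !mul0r !add0r mul1r IH /= mulr0 add0r.
case: j => [|j]; first by rewrite andbF.
rewrite IH ltnS subSS.
have -> : k - 2 - 2 *+ n = k - 2 *+ n.+1 by rewrite -[2 *+ n]mulr_natr -[2 *+ n.+1]mulr_natr -natr1; ring.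
by [].
Qed.

Let iter_tr_h n i k j (F : mindex -> K) :
  iter n (coef_act_tr (sl2_h K)) F (i, k, j) = (k%:~R - 2 * i%:R) ^+ n * F (i, k, j).
Proof.
elim: n => [|n IH]; first by rewrite expr0 mul1r.
by rewrite iterS /= IH !mxE /= !mul0r !add0r addr0 mul1r mulrA -exprS.
Qed.

Lemma coef_functional_inj (u : mindex -> K^o) : finsupp u -> coef_functional u = 0 -> u = 0.
Proof.
move=> hu u0.
(* Evaluation at f^a h^c e^b: only the monomials with i = b and j = a survive, since e^b must bring
   i to 0 and f^a must bring j to 0; in between h^c acts with i = 0 and contributes k^c. *)
have key (b c a : nat) : fsum u (fun m => ((m.1.1 == b) && (m.2 == a))%:R * (m.1.2%:~R) ^+ c) = 0.
  have fi n A v : finsupp v -> finsupp (iter n (coef_act A) v).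
    by move=> hv; elim: n => //= n IH; exact: finsupp_act.
  have it n A v F : finsupp v -> fsum (iter n (coef_act A) v) F = fsum v (iter n (coef_act_tr A) F).
    by move=> hv; elim: n F => // n IH F; rewrite iterS fsum_act ?IH -?iterSr //; exact: fi.
  pose x : uea (sl2 K) := ugen (sl2_f K) ^+ a * (ugen (sl2_h K) ^+ c * ugen (sl2_e K) ^+ b).
  have uX n A v : uact (@coef_act K) (ugen A ^+ n) v = iter n (coef_act A) v.
    elim: n v => [|n IH] v.
      by rewrite expr0; exact: (@uact_class _ _ (coef_module K) (@UOne _ _)).
    by rewrite exprS coef_uactM IH coef_uact_gen.
  have := congr1 (fun phi => phi x) u0; rewrite /= /coef_functional /x !coef_uactM !uX.
  rewrite /base_value !it //; try exact: fi; last by exact/fi/fi.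
  move=> E; rewrite -[RHS]E; congr (fsum u _); apply/funext => -[[i k] j] /=.
  rewrite iter_tr_e; case: ltngtP => [bi|bi|<-].
  - rewrite iter_tr_h iter_tr_f // subn_eq0 leqNgt bi /= mulr0.
    by rewrite mul0r.
  - by rewrite mul0r.
  - rewrite subnn iter_tr_h iter_tr_f //= mulr0 subr0 mulrC.
    by congr (_ * _); case: ltngtP => [aj|aj|<-] //=; rewrite ?subnn ?eqxx // subn_eq0 leqNgt aj.
apply/funext => -[[b k0] a]; case: hu => s hs; have U := undup_uniq s.
have hs' m : m \notin undup s -> u m = 0 by rewrite mem_undup => /hs.
pose G (p : {poly K}) := \sum_(m <- undup s) u m * (((m.1.1 == b) && (m.2 == a))%:R * p.[m.1.2%:~R]).
have G0 p : G p = 0.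
  rewrite /G; under eq_bigr do rewrite horner_coef mulr_sumr mulr_sumr.
  rewrite exchange_big big1 //= => c _.
  have := key b c a; rewrite (fsumE _ U) // => E.
  transitivity (p`_c * \sum_(m <- undup s) u m * (((m.1.1 == b) && (m.2 == a))%:R * (m.1.2%:~R) ^+ c)).
    by rewrite mulr_sumr; apply: eq_bigr => m _; rewrite [RHS]mulrCA; congr (_ * _); rewrite mulrCA.
  by rewrite E mulr0.
(* By linearity k^c may be replaced by any polynomial in k; this one vanishes at every other k of
   the support and isolates k0. *)
pose p : {poly K} := \prod_(m <- undup s | m.1.2 != k0) ('X - (m.1.2%:~R)%:P).
case: (boolP ((b, k0, a) \in undup s)) => [ms|/hs' //].
have := G0 p; rewrite /G (bigD1_seq _ ms U) /= !eqxx /= mul1r big1 ?addr0 => [/eqP|].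
  rewrite mulf_eq0 => /orP[/eqP //|]; rewrite horner_prod prodf_seq_eq0 => /hasP[m _ /andP[mk]].
  by rewrite hornerXsubC subr_eq0 eqr_int eq_sym (negbTE mk).
move=> [[i k] j] /= nm; case: eqP => [ib|_] /=; last by rewrite mul0r mulr0.
case: eqP => [ja|_] /=; last by rewrite mul0r mulr0.
case: (boolP ((i, k, j) \in undup s)) => [ms'|/hs' ->]; last by rewrite mul0r.
have kk : k != k0 by apply: contraNneq nm => ->; rewrite ib ja.
have -> : p.[k%:~R] = 0.
  apply/eqP; rewrite horner_prod prodf_seq_eq0; apply/hasP; exists (i, k, j) => //=.
  by rewrite kk hornerXsubC subrr eqxx.
by rewrite !mulr0.
Qed.

End Injectivity.

(** * Exponentials of traceless complex matrices *)

Section ComplexExp.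
Import numFieldNormedType.Exports.
Variable R : realType.
Local Notation C := (complexes R).
Local Notation toC := (real_complex R : R -> C).

Definition expc_coeff (z : C) (k : nat) : C := k`!%:R^-1 * z ^+ k.
Definition expc (z : C) : C := lim (series (expc_coeff z) @ \oo).

(** The norm of [C] takes its values in [C]; passing to its real part makes estimates in [R]
    available. *)
Lemma norm_toC (z : C) : toC (complex.Re `|z|) = `|z|.
Proof. exact/RRe_real/normr_real. Qed.

Lemma Re_norm_ge0 (z : C) : 0 <= complex.Re `|z|.
Proof. by rewrite -(ler0c (complex.Re `|z|)) [real_complex _ _]norm_toC. Qed.

Lemma norm_expc_coeff (z : C) k : `|expc_coeff z k| = toC (exp_coeff (complex.Re `|z|) k).
Proof.
rewrite /expc_coeff normrM normfV normrX normr_nat -norm_toC /exp_coeff /=.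
by rewrite mulrC [RHS](rmorphM (real_complex R)) rmorphXn fmorphV rmorph_nat.
Qed.

Lemma cvg_complex (u : nat -> C) (a b : R) :
  (@complex.Re R \o u) @ \oo --> a -> (@complex.Im R \o u) @ \oo --> b -> u @ \oo --> (Complex a b : C).
Proof.
move=> ua ub; apply/cvgrPdist_lt => e e0.
have [re re0 e1] : exists2 re : R, 0 < re & e = toC re + toC re.
  have e2 : 0 < e / 2 by rewrite divr_gt0.
  have/(@complex_realP R) [k hk] := gtr0_real e2.
  exists k; first by rewrite -ltcR -hk.
  by rewrite -[toC k]hk -splitr.
move: ua ub => /cvgrPdist_lt /(_ _ re0) ua /cvgrPdist_lt /(_ _ re0) ub.
near=> n.
have h1 : `|a - complex.Re (u n)| < re by near: n; exact: ua.
have h2 : `|b - complex.Im (u n)| < re by near: n; exact: ub.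
have -> : Complex a b - u n = toC (a - complex.Re (u n)) + Complex 0 1 * toC (b - complex.Im (u n)).
  by case: (u n) => x y; apply/eqP; rewrite eq_complex /= !(mul0r, mulr0, mul1r, addr0, add0r, subr0, sub0r, oppr0) !eqxx.
rewrite e1 (le_lt_trans (ler_normD _ _)) // ltrD //.
- rewrite normc_def /= expr0n addr0 sqrtr_sqr.
  by rewrite (ltcR `|_|).
- rewrite normrM !normc_def /= !expr0n addr0 add0r expr1n sqrtr1 mul1r sqrtr_sqr.
  by rewrite (ltcR `|_|).
Unshelve. all: by end_near. Qed.

Lemma Re_series (u : nat -> C) n : complex.Re (series u n) = series (@complex.Re R \o u) n.
Proof. by rewrite /series /= raddf_sum. Qed.
Lemma Im_series (u : nat -> C) n : complex.Im (series u n) = series (@complex.Im R \o u) n.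
Proof. by rewrite /series /= raddf_sum. Qed.

Lemma cvg_series_part (part : C -> R) (z : C) :
  (forall w, `|part w| <= complex.Re `|w|) ->
  cvgn (series (part \o expc_coeff z)).
Proof.
move=> hp; apply: normed_cvg.
apply: (series_le_cvg (v_ := exp_coeff (complex.Re `|z|))).
- by move=> n /=.
- by move=> n; apply/exp_coeff_ge0/Re_norm_ge0.
- by move=> n /=; rewrite (le_trans (hp _))// norm_expc_coeff.
- exact: is_cvg_series_exp_coeff.
Qed.

Lemma normr_Re_le (w : C) : `|complex.Re w| <= complex.Re `|w|.
Proof. by rewrite -lecR [X in _ <= X]norm_toC normc_ge_Re. Qed.
Lemma normr_Im_le (w : C) : `|complex.Im w| <= complex.Re `|w|.
Proof.
have -> : complex.Im w = complex.Re (w * - Complex 0 1).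
  by case: w => x y /=; rewrite oppr0 mulr0 mulrN1 opprK add0r.
apply: (le_trans (normr_Re_le _)).
rewrite normrM normrN [X in _ * X]normc_def /= expr0n add0r expr1n sqrtr1.
by rewrite mulr1 mul0r subr0.
Qed.

Lemma expc_cvg (z : C) : series (expc_coeff z) @ \oo --> expc z.
Proof.
have cr := cvg_series_part (z := z) normr_Re_le.
have ci := cvg_series_part (z := z) normr_Im_le.
have : series (expc_coeff z) @ \oo --> (Complex (limn (series (@complex.Re R \o expc_coeff z)))
   (limn (series (@complex.Im R \o expc_coeff z))) : C).
  apply: cvg_complex.
  - by rewrite (_ : _ \o _ = series (@complex.Re R \o expc_coeff z)) //; apply/funext => n; exact: Re_series.
  - by rewrite (_ : _ \o _ = series (@complex.Im R \o expc_coeff z)) //; apply/funext => n; exact: Im_series.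
by move=> h; rewrite /expc (cvg_lim _ h).
Qed.

(* Both sides are Cauchy products; the error consists of the terms [z^i w^j / (i! j!)]
   with [i + j >= n], whose absolute values add up to the same error for [|z|], [|w|]. *)
Lemma series_exp_mul (F : numFieldType) (z w : F) (n : nat) :
  let S t := \sum_(0 <= k < n) k`!%:R^-1 * t ^+ k in
  S z * S w - S (z + w) = \sum_(i < n) \sum_(j < n | (n <= i + j)%N)
     (i`!%:R^-1 * j`!%:R^-1) * (z ^+ i * w ^+ j).
Proof.
move=> S; rewrite /S !big_mkord.
pose F' i j : F := (i`!%:R^-1 * j`!%:R^-1) * (z ^+ i * w ^+ j).
have -> : (\sum_(k < n) k`!%:R^-1 * z ^+ k) * (\sum_(k < n) k`!%:R^-1 * w ^+ k)
    = \sum_(i < n) \sum_(j < n) F' i j.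
  rewrite big_distrlr /=; apply: eq_bigr => i _; apply: eq_bigr => j _.
  by rewrite /F' mulrACA.
have -> : \sum_(k < n) k`!%:R^-1 * (z + w) ^+ k =
    \sum_(i < n) \sum_(j < n | (i + j < n)%N) F' i j.
  transitivity (\sum_(0 <= j < n) \sum_(0 <= i < n) if (i + j < n)%N then F' i j else 0); last first.
    rewrite exchange_big /= big_mkord; apply: eq_bigr => i _.
    by rewrite [RHS]big_mkcond big_mkord.
  rewrite -(big_mkord xpredT (fun k => k`!%:R^-1 * (z + w) ^+ k)).
  have E1 k : k`!%:R^-1 * (z + w) ^+ k = \sum_(0 <= j < k.+1) F' (k - j)%N j.
    rewrite exprDn mulr_sumr big_mkord; apply: eq_bigr => j _.
    have jk : (j <= k)%N by rewrite -ltnS.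
    rewrite /F' -[_ *+ 'C(_, _)]mulr_natl [LHS]mulrA; congr (_ * _).
    have f0 m : m`!%:R != 0 :> F by rewrite pnatr_eq0 -lt0n fact_gt0.
    apply: (mulfI (f0 k)); rewrite mulrA divff // mul1r.
    rewrite -(bin_fact jk) !natrM [j`!%:R * _]mulrC -mulrA -invfM divff ?mulr1 //.
    by rewrite mulf_neq0.
  under eq_bigr do rewrite E1.
  transitivity (\sum_(0 <= k < n) \sum_(0 <= j < n) if (j <= k)%N then F' (k - j)%N j else 0).
    apply: eq_big_nat => k /andP[_ kn].
    rewrite (big_nat_widen _ _ n) // -big_mkcond; apply: eq_bigl => j; by rewrite ltnS.
  rewrite exchange_big /=.
  apply: eq_big_nat => j /andP[_ jn].
  rewrite (big_cat_nat (leq0n j) (ltnW jn)) /= [X in X + _]big_nat_cond big1 ?add0r; last first.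
    by move=> k /andP[/andP[_ kj] _]; rewrite leqNgt kj.
  rewrite -{1}[j]add0n big_addn.
  rewrite [RHS](big_cat_nat (leq0n (n - j)) (leq_subr j n)) /=.
  rewrite [X in _ = _ + X]big_nat_cond [X in _ = _ + X]big1 ?addr0; last first.
    by move=> k /andP[/andP[h _] _]; rewrite ltnNge addnC -leq_subLR h.
  apply: eq_big_nat => k /andP[_ h].
  by rewrite leq_addl addnC -ltn_subRL h addKn.
rewrite -sumrB; apply: eq_bigr => i _.
rewrite (bigID (fun j : 'I_n => (i + j < n)%N)) /= addrAC subrr add0r.
by apply: eq_bigl => j; rewrite -leqNgt.
Qed.

(** The error in the multiplicativity of partial sums is dominated by the error for the real numbers
    |z| and |w|, which tends to 0 because [expR] is multiplicative. *)
Lemma expcD (z w : C) : expc (z + w) = expc z * expc w.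
Proof.
pose S t := series (expc_coeff t) : nat -> C.
pose r := complex.Re `|z|; pose q := complex.Re `|w|.
pose T t := series (@exp_coeff R t) : nat -> R.
have TC t n : toC (T t n) = \sum_(0 <= k < n) k`!%:R^-1 * toC t ^+ k.
  rewrite /T /series /= raddf_sum; apply: eq_bigr => k _.
  by rewrite mulrC [LHS](rmorphM (real_complex R)) rmorphXn fmorphV rmorph_nat.
have bound n : `|S z n * S w n - S (z + w) n| <= toC (T r n * T q n - T (r + q) n).
  rewrite [X in `|X|]series_exp_mul rmorphB rmorphM /= !TC.
  rewrite (rmorphD (real_complex R)) series_exp_mul.
  rewrite (le_trans (ler_norm_sum _ _ _)) // ler_sum // => i _.
  rewrite (le_trans (ler_norm_sum _ _ _)) // ler_sum // => j _.
  by rewrite !normrM !normfV !normrX !normr_nat ![real_complex _ _]norm_toC.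
have Tcvg t : T t @ \oo --> expR t by exact: is_cvg_series_exp_coeff.
have B0 : (fun n => T r n * T q n - T (r + q) n) @ \oo --> (0 : R).
  rewrite [X in _ --> X](_ : 0 = expR r * expR q - expR (r + q)); last by rewrite expRD subrr.
  by apply: cvgB => //; apply: cvgM.
have S0 : (fun n => S z n * S w n - S (z + w) n) @ \oo --> (0 : C).
  apply/cvgrPdist_lt => e e0.
  have /(@complex_realP R) [k hk] := gtr0_real e0.
  have k0 : 0 < k by rewrite -ltcR -hk.
  move/cvgrPdist_lt: B0 => /(_ _ k0) B0.
  near=> n; rewrite sub0r normrN (le_lt_trans (bound n)) // hk ltcR.
  rewrite (le_lt_trans (ler_norm _)) // -normrN -sub0r.
  by near: n; exact: B0.
have S1 : (fun n => S z n * S w n - S (z + w) n) @ \oo --> expc z * expc w - expc (z + w).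
  by apply: cvgB; [apply: cvgM; exact: expc_cvg|exact: expc_cvg].
have E : expc z * expc w - expc (z + w) = 0.
  by apply: (cvg_unique _ S1 S0); exact: norm_hausdorff.
by move/eqP: E; rewrite subr_eq0 => /eqP.
Unshelve. all: by end_near. Qed.

Lemma exp_partial_le (r : R) n : 0 <= r ->
  \sum_(0 <= i < n) r ^+ i / i`!%:R <= expR r.
Proof.
move=> r0; apply: (nondecreasing_cvgn_le (u_ := series (exp_coeff r))).
  apply: nondecreasing_series => k _ _; exact: exp_coeff_ge0.
exact: is_cvg_series_exp_coeff.
Qed.

(** As 1 / (i + 2)! <= 1 / i!, the series deprived of its first two terms is at most r^2 times the
    exponential series of r. This quadratic bound yields the derivative at 0. *)
Lemma expc_sub1_bound (z : C) :
  complex.Re `|expc z - 1 - z| <= (complex.Re `|z|) ^+ 2 * expR (complex.Re `|z|).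
Proof.
set r := complex.Re `|z|.
have r0 : 0 <= r := Re_norm_ge0 z.
have bd n : complex.Re `|series (expc_coeff z) (n + 2)%N - 1 - z| <= r ^+ 2 * expR r.
  have -> : series (expc_coeff z) (n + 2)%N - 1 - z =
      \sum_(0 <= i < n) expc_coeff z i.+2.
    rewrite addn2 /series /= big_nat_recl // big_nat_recl //.
    rewrite [expc_coeff z 0]/expc_coeff [expc_coeff z 1]/expc_coeff fact0 invr1 !mul1r expr0 expr1.
    by rewrite [1 + _]addrC addrK addrC addKr.
  have le1 : complex.Re `|\sum_(0 <= i < n) expc_coeff z i.+2| <=
     \sum_(0 <= i < n) exp_coeff r i.+2.
    rewrite -lecR [X in X <= _]norm_toC (le_trans (ler_norm_sum _ _ _)) //.
    by rewrite (raddf_sum (real_complex R)) ler_sum // => i _; rewrite norm_expc_coeff.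
  apply: (le_trans le1).
  apply: le_trans (_ : r ^+ 2 * (\sum_(0 <= i < n) r ^+ i / i`!%:R) <= _); last first.
    by rewrite ler_wpM2l ?exprn_ge0 // exp_partial_le.
  rewrite mulr_sumr ler_sum // => i _.
  rewrite /exp_coeff /= -addn2 addnC exprD -mulrA ler_wpM2l ?exprn_ge0 //.
  rewrite ler_wpM2l ?exprn_ge0 // lef_pV2 ?posrE ?ltr0n ?fact_gt0 //.
  by rewrite ler_nat addnC addn2 !factS mulnA leq_pmull.
apply/ler_addgt0Pr => e e0.
have e0' : 0 < toC e by rewrite (ltcR 0).
have /cvgrPdist_lt /(_ _ e0') c := @expc_cvg z.
have [n hn] : exists n, `|expc z - series (expc_coeff z) (n + 2)%N| < toC e.
  by case: c => N _ hN; exists N; apply: hN; rewrite /= leq_addr.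
rewrite -lecR [X in X <= _]norm_toC.
have -> : expc z - 1 - z = (series (expc_coeff z) (n + 2)%N - 1 - z)
    + (expc z - series (expc_coeff z) (n + 2)%N) by ring.
rewrite (le_trans (ler_normD _ _)) // (rmorphD (real_complex R)).
apply: lerD; last exact: ltW.
by rewrite -norm_toC lecR.
Qed.

Lemma expc0 : expc 0 = 1.
Proof.
have := expc_sub1_bound 0; rewrite normr0 /= expr0n mul0r => h.
have /eqP : complex.Re `|expc 0 - 1 - 0| = 0 by apply/eqP; rewrite eq_le h Re_norm_ge0.
rewrite -(inj_eq (@complexI R)) [X in X == _]norm_toC normr_eq0 subr0 subr_eq0.
by move/eqP.
Qed.

Lemma is_derive_expcM (a : C) : is_derive (0 : C) 1 (fun t : C => expc (a * t)) a.
Proof.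
have h : (fun h : C => h^-1 *: (((fun t => expc (a * t)) \o shift 0) (h *: 1) - expc (a * 0))) @ 0^' --> a.
  apply/cvgrPdist_lt => e e0.
  have /(@complex_realP R) [k hk] := gtr0_real e0.
  have k0 : 0 < k by rewrite -ltcR -hk.
  pose q := complex.Re `|a|; have q0 : 0 <= q := Re_norm_ge0 a.
  (* For |x| < 1 the remainder is at most |x|^2 times q^2 exp(q); the summand 1 makes M positive. *)
  pose M := q ^+ 2 * expR q + 1.
  have M0 : 0 < M by rewrite ltr_wpDl // mulr_ge0 ?exprn_ge0 // expR_ge0.
  pose d := Num.min 1 (k / M).
  have d0 : 0 < toC d by rewrite (ltcR 0) lt_min ltr01 divr_gt0.
  exists (toC d) => // x /=; rewrite sub0r normrN => xd x0.
  rewrite /= scaler1 addr0 mulr0 expc0.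
  have -> : a - x^-1 *: (expc (a * x) - 1) = - (x^-1 * (expc (a * x) - 1 - a * x)).
    rewrite [x^-1 *: _]/GRing.scale /= [in RHS]mulrBr [x^-1 * (a * x)]mulrCA mulVf //.
    by rewrite mulr1 opprB.
  rewrite normrN normrM normfV.
  have n0 : 0 < `|x| by rewrite normr_gt0.
  rewrite mulrC ltr_pdivrMr // hk -(norm_toC x) -(norm_toC (expc (a * x) - 1 - a * x)) -(rmorphM (real_complex R)) ltcR.
  set r := complex.Re `|x|.
  have rd : r < d by rewrite -ltcR [X in X < _]norm_toC.
  have r1 : r < 1 by move: rd; rewrite lt_min => /andP[].
  have r2 : r < k / M by move: rd; rewrite lt_min => /andP[].
  have r0 : 0 < r by rewrite -(ltcR 0) [X in _ < X]norm_toC.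
  apply: (le_lt_trans (expc_sub1_bound _)).
  have -> : complex.Re `|a * x| = q * r.
    by rewrite normrM -(norm_toC a) -(norm_toC x) -(rmorphM (real_complex R)).
  have qr : q * r <= q by rewrite ler_piMr // ltW.
  apply: (@le_lt_trans _ _ ((q * r) ^+ 2 * expR q)).
    by rewrite ler_wpM2l ?exprn_ge0 ?ler_expR // mulr_ge0 // ltW.
  rewrite exprMn [r ^+ 2]expr2 mulrA mulrAC ltr_pM2r //.
  move: r2; rewrite ltr_pdivlMr //; apply: le_lt_trans.
  by rewrite mulrAC mulrC ler_wpM2l ?ltW // ltrDl ltr01.
apply: DeriveDef; first by apply/cvg_ex; exists a.
by apply: cvg_lim => //; exact: norm_hausdorff.
Qed.

End ComplexExp.

(** * Closed form of the exponential of a traceless matrix *)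

Section MatrixExp.
Import numFieldNormedType.Exports.
Variable R : realType.
Local Notation C := (complexes R).

Lemma det2 (K : comPzRingType) (M : 'M[K]_2) : \det M = M 0 0 * M 1 1 - M 0 1 * M 1 0.
Proof.
rewrite (expand_det_row _ 0) !big_ord_recl big_ord0 addr0 /cofactor !det_mx11 !mxE /= !ord2E.
rewrite addn0 addn1 expr0 expr1 mul1r mulN1r mulrN; congr (_ * M _ _ - _ * M _ _); exact: val_inj.
Qed.

Lemma sl2_sqr (K : fieldType) (A : sl2 K) : (A : 'M[K]_2) *m A = (- \det A)%:M.
Proof.
apply/matrixP => i j; rewrite det2 sl2_11 !mxE !big_ord_recl big_ord0 addr0 -!ord2E.
have [->|->] := ord2P i; have [->|->] := ord2P j; rewrite ?sl2_11 /=; ring.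
Qed.

(** With mu^2 = - det A, Cayley-Hamilton gives A^2 = mu^2, so the exponential is a combination of 1
    and A: c and s are cosh(mu t) and sinh(mu t) / mu, or 1 and t if mu = 0. The second clause says
    that the exponential has determinant 1. *)
Lemma mx_exp_sl2 (A : sl2 C) : exists c s : C -> C,
  [/\ forall t, mx_exp (t *: (A : 'M[C]_2)) = c t *: 1%:M + s t *: (A : 'M[C]_2),
      forall t, c t ^+ 2 + s t ^+ 2 * \det A = 1,
      c 0 = 1 /\ s 0 = 0,
      is_derive (0 : C) 1 c 0 & is_derive (0 : C) 1 s 1].
Proof.
pose mu : C := sqrtC (- \det A).
have mu2 : mu ^+ 2 = - \det A by rewrite sqrtCK.
have AA : (A : 'M[C]_2) * A = (mu ^+ 2) *: 1.
  by rewrite mu2 scalemx1; exact: sl2_sqr.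
have [mu0|mu0] := eqVneq mu 0.
  exists (fun=> 1), id; split => //.
  - move=> t; apply/matrixP => i j; rewrite !mxE.
    apply: cvg_lim; first exact: norm_hausdorff.
    apply: cvg_near_cst; near=> n.
    have [m ->] : exists m, n = m.+2.
      by exists n.-2; rewrite -(subnK (_ : 2 <= n)%N) ?addn2 //; near: n; exists 2%N.
    rewrite /series /= big_nat_recl // big_nat_recl // [X in _ + (_ + X)]big1_seq; last first.
      move=> k _; have An : (A : 'M[C]_2) ^+ k.+2 = 0.
        by rewrite 2!exprS mulrA AA mu0 expr0n /= scale0r mul0r.
      by rewrite exprZn An !scaler0 mxE.
    by rewrite !fact0 invr1 !scale1r expr0 expr1 addr0 !mxE /= mul1r.
  - by move=> t; rewrite -[\det A]opprK -mu2 mu0 expr0n oppr0 mulr0 addr0 expr1n.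
  - exact: is_derive_cst.
  - exact: is_derive_id.
pose E t := expc (mu * t); pose E' t := expc (- mu * t).
have EE t : E t * E' t = 1.
  by rewrite -expcD -mulrDl subrr mul0r expc0.
exists (fun t => (E t + E' t) / 2), (fun t => (E t - E' t) / (2 * mu)); split.
- move=> t; apply/matrixP => i j; rewrite !mxE.
  apply: cvg_lim; first exact: norm_hausdorff.
  have pow k : (A : 'M[C]_2) ^+ k = ((mu ^+ k + (- mu) ^+ k) / 2) *: 1
      + ((mu ^+ k - (- mu) ^+ k) / (2 * mu)) *: (A : 'M[C]_2).
    elim: k => [|k IH].
      have -> : (mu ^+ 0 + (- mu) ^+ 0) / 2 = 1 by rewrite !expr0; field.
      by rewrite !expr0 subrr mul0r scale0r addr0 scale1r.
    rewrite exprS IH mulrDr -!scalerAr mulr1 AA addrC scalerA; congr (_ *: _ + _ *: _).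
      rewrite !exprS; field; by rewrite mu0.
    by rewrite !exprS; field; rewrite mu0.
  rewrite (_ : series _ = fun n => (series (expc_coeff (mu * t)) n + series (expc_coeff (- mu * t)) n) / 2 * (i == j)%:R
     + (series (expc_coeff (mu * t)) n - series (expc_coeff (- mu * t)) n) / (2 * mu) * A i j); last first.
    apply/funext => n; rewrite /series /= -big_split /= -sumrB -!mulrA !mulr_suml -big_split /=.
    apply: eq_bigr => k _; rewrite exprZn pow !mxE /expc_coeff !exprMn; field.
    by rewrite mu0 pnatr_eq0 -lt0n fact_gt0.
  apply: cvgD; apply: cvgMl; apply: cvgMl; [apply: cvgD|apply: cvgB]; exact: expc_cvg.
- move=> t; have -> : \det A = - mu ^+ 2 by rewrite mu2 opprK.
  rewrite -[RHS](EE t); field; by rewrite mu0.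
- rewrite /E /E' !mulr0 expc0 subrr mul0r; split => //; by field.
- have h := is_deriveZ (2^-1) (is_deriveD (is_derive_expcM mu) (is_derive_expcM (- mu))).
  have -> : (fun t => (E t + E' t) / 2) = 2^-1 \*: (E \+ E').
    by apply/funext => t; rewrite mulrC.
  by apply: is_derive_eq; rewrite subrr scaler0.
- have h := is_deriveZ ((2 * mu)^-1) (is_deriveB (is_derive_expcM mu) (is_derive_expcM (- mu))).
  have -> : (fun t => (E t - E' t) / (2 * mu)) = (2 * mu)^-1 \*: (E \- E').
    by apply/funext => t; rewrite mulrC.
  apply: is_derive_eq; rewrite /GRing.scale /=; field; by rewrite mu0.
Unshelve. all: by end_near. Qed.

End MatrixExp.

(** * Regular functions on the big cell *)

Section Realization.
Import numFieldNormedType.Exports.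
Variable R : realType.
Local Notation C := (complexes R).
Implicit Types (u v : mindex -> C^o) (A : sl2 C) (g : 'M[C]_2).

Lemma bruhatE (x z y : C) :
  [/\ bruhat x z y 0 0 = x * z, bruhat x z y 0 1 = x * z * y - z^-1,
      bruhat x z y 1 0 = z & bruhat x z y 1 1 = z * y].
Proof.
split; rewrite /bruhat /w0 !ord2E !mxE !big_ord_recl !big_ord0 !mxE
  !big_ord_recl !big_ord0 !mxE !big_ord_recl !big_ord0 !mxE /=; ring.
Qed.

Lemma big_cellP g : in_big_cell g <-> \det g = 1 /\ g 1 0 != 0.
Proof.
split=> [[x [z [y [z0 ->]]]]|[d1 c0]].
  have [a b c d] := bruhatE x z y; rewrite det2 a b c d; split => //.
  by field.
exists (g 0 0 / g 1 0), (g 1 0), (g 1 1 / g 1 0); split => //.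
have [a b c d] := bruhatE (g 0 0 / g 1 0) (g 1 0) (g 1 1 / g 1 0).
move: d1; rewrite det2 => d1.
apply/matrixP => i j; have [->|->] := ord2P i; have [->|->] := ord2P j.
- by rewrite a; field.
- rewrite b; apply: (mulIf c0); rewrite mulrBl mulVf // -[in RHS]d1; by field.
- by rewrite c.
- by rewrite d; field.
Qed.

Definition mono g : mindex -> C := fun m =>
  (g 0 0 / g 1 0) ^+ m.1.1 * g 1 0 ^ m.1.2 * (g 1 1 / g 1 0) ^+ m.2.

Definition mono_norm (m : mindex) : C := (-1) ^+ m.1.1 / (m.1.1`!%:R * m.2`!%:R).

Lemma mono_norm_neq0 m : mono_norm m != 0.
Proof.
by rewrite mulf_neq0 ?signr_eq0 // invr_eq0 mulf_neq0 // pnatr_eq0 -lt0n fact_gt0.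
Qed.

Definition nmono g : mindex -> C := fun m => mono_norm m * mono g m.

Definition realf u : big_cell R -> C^o := fun g : big_cell R => fsum u (nmono (val g)).

Lemma cell_eval_in (psi : big_cell R -> C^o) g (hg : `[< in_big_cell g >]) :
  cell_eval psi g = psi (exist _ g hg).
Proof. by rewrite /cell_eval insubT. Qed.

Lemma cell_eval_realf u g : in_big_cell g -> cell_eval (realf u) g = fsum u (nmono g).
Proof. by move=> /asboolP hg; rewrite (cell_eval_in _ hg). Qed.

Lemma mono_bruhat x z y m : z != 0 ->
  mono (bruhat x z y) m = x ^+ m.1.1 * z ^ m.1.2 * y ^+ m.2.
Proof.
by move=> z0; have [a b c d] := bruhatE x z y; rewrite /mono a c d mulfK // [z * y / z]mulrAC divff // mul1r.
Qed.

Lemma regular_functionsE : @regular_functions R = [set realf u | u in @finsupp C].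
Proof.
apply/seteqP; split=> [psi [s hs]|_ [u [s hs] <-]].
  pose t := [seq (m.1 / mono_norm m.2, m.2) | m : C * mindex <- s].
  exists (\sum_(m <- t) m.1 *: @delta C m.2 : mindex -> C^o).
    elim: (t) => [|m t' IH]; first by rewrite big_nil; exact: finsupp0.
    by rewrite big_cons; apply: finsupp_lin => //; exact: finsupp_delta.
  apply/funext => g; have /asboolP[x [z [y [z0 gE]]]] := valP g.
  have := hs x z y z0; rewrite -gE (cell_eval_in _ (valP g)).
  have -> : exist _ (val g) (valP g) = g by apply: val_inj.
  move=> ->; rewrite /realf.
  have fl (l : seq (C * mindex)) F : finsupp (\sum_(m <- l) m.1 *: @delta C m.2) /\
      fsum (\sum_(m <- l) m.1 *: @delta C m.2) F = \sum_(m <- l) m.1 * F m.2.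
    elim: l => [|m l [IH1 IH2]]; first by rewrite !big_nil fsum0; split => //; exact: finsupp0.
    rewrite !big_cons; split; first by apply: finsupp_lin => //; exact: finsupp_delta.
    by rewrite fsum_lin // ?fsum_delta ?IH2 //; exact: finsupp_delta.
  rewrite (fl t _).2 /t big_map; apply: eq_bigr => m _.
  rewrite /nmono /= mulrA divfK ?mono_norm_neq0 // gE mono_bruhat //.
  by rewrite !mulrA.
have U := undup_uniq s.
exists [seq (u m * mono_norm m, m) | m <- undup s] => x z y z0.
rewrite cell_eval_realf; last by exists x, z, y.
rewrite (fsumE _ U); last by move=> m; rewrite mem_undup => /hs.
by rewrite big_map; apply: eq_bigr => m _; rewrite /nmono mono_bruhat //= !mulrA.
Qed.

Lemma is_derive_exprz (c : C -> C) (c' : C) (k : int) : c 0 != 0 ->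
  is_derive (0 : C) 1 c c' ->
  is_derive (0 : C) 1 (fun t => c t ^ k) (k%:~R * c 0 ^ k / c 0 * c').
Proof.
move=> c0 hc; case: k => n.
  have h := is_deriveX n hc.
  have -> : (fun t => c t ^ n) = c ^+ n by apply/funext => t; rewrite exprfctE.
  apply: (is_derive_eq h); rewrite /GRing.scale /=; congr (_ * _).
  case: n {h} => [|n]; first by rewrite mulr0n !mul0r.
  by rewrite /= -exprnP exprS [c 0 * _]mulrC mulrA mulfK.
have h := is_deriveX n.+1 hc.
have hn : (c ^+ n.+1) 0 != 0 by rewrite exprfctE expf_neq0.
have [dh vh] := h.
have -> : (fun t => c t ^ Negz n) = (fun t => ((c ^+ n.+1) t)^-1).
  by apply/funext => t; rewrite exprfctE NegzE.
apply: DeriveDef; first exact: derivableV.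
rewrite deriveV // vh /GRing.scale /= exprfctE NegzE.
rewrite rmorphN /= -exprnN /=.
rewrite -[n.+1%:~R]/(n.+1%:R : C) [c 0 ^+ n.+1]exprS.
have : c 0 ^+ n != 0 by rewrite expf_neq0.
move: (n.+1%:R : C) (c 0 ^+ n) => N a a0; field; by rewrite c0 a0.
Qed.

(** The derivative of [mono] at g in the direction B, by the quotient rule for x = a/c and y = d/c.
    The truncated predecessors are harmless, since at exponent 0 they are multiplied by 0. *)
Definition dmono g (B : 'M[C]_2) : mindex -> C := fun m =>
  let x := g 0 0 / g 1 0 in let z := g 1 0 in let y := g 1 1 / g 1 0 in
  let x' := (B 0 0 * z - g 0 0 * B 1 0) / z ^+ 2 in
  let y' := (B 1 1 * z - g 1 1 * B 1 0) / z ^+ 2 in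
  m.1.1%:R * x ^+ m.1.1.-1 * x' * z ^ m.1.2 * y ^+ m.2
  + x ^+ m.1.1 * (m.1.2%:~R * z ^ m.1.2 / z * B 1 0) * y ^+ m.2
  + x ^+ m.1.1 * z ^ m.1.2 * (m.2%:R * y ^+ m.2.-1 * y').

Lemma is_derive_div (a c : C -> C) (a' c' : C) : c 0 != 0 ->
  is_derive (0 : C) 1 a a' -> is_derive (0 : C) 1 c c' ->
  is_derive (0 : C) 1 (fun t => a t / c t) ((a' * c 0 - a 0 * c') / c 0 ^+ 2).
Proof.
move=> c0 ha [dc vc].
have hi : is_derive (0 : C) 1 (fun t => (c t)^-1) (- (c 0) ^- 2 *: c').
  by apply: DeriveDef; [exact: derivableV|rewrite deriveV // vc].
apply: (is_derive_eq (is_deriveM ha hi)); rewrite /GRing.scale /=; by field.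
Qed.

Lemma is_derive_mono g (B : 'M[C]_2) (M : C -> 'M[C]_2) m :
  g 1 0 != 0 -> M 0 = g -> (forall i j, is_derive (0 : C) 1 (fun t => M t i j) (B i j)) ->
  is_derive (0 : C) 1 (fun t => mono (M t) m) (dmono g B m).
Proof.
move=> c0 M0 hM; have c0' : M 0 1 0 != 0 by rewrite M0.
have hx := is_derive_div c0' (hM 0 0) (hM 1 0).
have hy := is_derive_div c0' (hM 1 1) (hM 1 0).
have hz := is_derive_exprz m.1.2 c0' (hM 1 0).
have h := is_deriveM (is_deriveM (is_deriveX m.1.1 hx) hz) (is_deriveX m.2 hy).
have -> : (fun t => mono (M t) m) = (fun t => M t 0 0 / M t 1 0) ^+ m.1.1
    * (fun t => M t 1 0 ^ m.1.2) * (fun t => M t 1 1 / M t 1 0) ^+ m.2.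
  by apply/funext => t; rewrite !fctE.
apply: (is_derive_eq h); rewrite /GRing.scale /= !fctE /= M0 /dmono.
ring.
Qed.

Lemma is_derive_fsum u (F : C -> mindex -> C) (F' : mindex -> C) : finsupp u ->
  (forall m, is_derive (0 : C) 1 (F^~ m) (F' m)) ->
  is_derive (0 : C) 1 (fun t => fsum u (F t)) (fsum u F').
Proof.
move=> [s hs] hF; have U := undup_uniq s.
have hs' m : m \notin undup s -> u m = 0 by rewrite mem_undup => /hs.
rewrite (fsumE _ U) //.
have -> : (fun t => fsum u (F t)) = fun t => \sum_(m <- undup s) u m * F t m.
  by apply/funext => t; rewrite (fsumE _ U).
elim: (undup s) => [|m l IH].
  rewrite big_nil; have -> : (fun t => \sum_(m <- [::]) u m * F t m) = cst 0.
    by apply/funext => t; rewrite big_nil.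
  exact: is_derive_cst.
have -> : (fun t => \sum_(n <- m :: l) u n * F t n) =
   (u m \*: (F^~ m)) \+ (fun t => \sum_(n <- l) u n * F t n).
  by apply/funext => t; rewrite big_cons.
by rewrite big_cons; apply: is_deriveD; apply: is_deriveZ.
Qed.

Lemma is_derive_curve u g (B : 'M[C]_2) (M : C -> 'M[C]_2) : finsupp u ->
  in_big_cell g -> M 0 = g -> (forall t, \det (M t) = 1) ->
  (forall i j, is_derive (0 : C) 1 (fun t => M t i j) (B i j)) ->
  is_derive (0 : C) 1 (fun t => cell_eval (realf u) (M t))
    (fsum u (fun m => mono_norm m * dmono g B m)).
Proof.
move=> hu /big_cellP[_ c0] M0 M1 hM.
(* [cell_eval] is 0 off the cell, so the formula for it holds only while the curve stays inside:
   near t = 0 the lower left entry is nonzero by continuity. *)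
apply: (near_eq_is_derive (f := fun t => fsum u (nmono (M t)))).
  have cM : {for (0 : C), continuous (fun t => M t 1 0)}.
    by have [d _] := hM 1 0; apply/differentiable_continuous/derivable1_diffP.
  have : \forall t \near (0 : C), M t 1 0 != 0.
    by apply: (cvgr_neq0 _ cM); rewrite M0.
  apply: filterS => t ct; rewrite cell_eval_realf //; exact/big_cellP.
apply: is_derive_fsum => // m; rewrite /nmono.
have h := is_derive_mono m c0 M0 hM.
exact: (is_deriveZ (mono_norm m) h).
Qed.

Lemma det_mx_exp A t : \det (mx_exp (t *: (A : 'M[C]_2))) = 1.
Proof.
have [c [s [E D _ _ _]]] := mx_exp_sl2 A.
rewrite -[RHS](D t) E !det2 !mxE /= sl2_11; ring.
Qed.

(** The case g1 = 1 serves [pi_l] and the case g2 = 1 serves [pi_r]. *)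
Lemma mx_exp_curve A (g1 g2 : 'M[C]_2) : let M t := g1 *m mx_exp (t *: (A : 'M[C]_2)) *m g2 in
  M 0 = g1 *m g2 /\ forall i j, is_derive (0 : C) 1 (fun t => M t i j) ((g1 *m A *m g2) i j).
Proof.
have [c [s [E D [c0 s0] dc ds]]] := mx_exp_sl2 A.
have ME t : g1 *m mx_exp (t *: (A : 'M[C]_2)) *m g2 = c t *: (g1 *m g2) + s t *: (g1 *m A *m g2).
  by rewrite E mulmxDr mulmxDl -!scalemxAr mulmx1 -!scalemxAl.
split; first by rewrite /= ME c0 s0 scale1r scale0r addr0.
move=> i j /=; have -> : (fun t => (g1 *m mx_exp (t *: (A : 'M[C]_2)) *m g2) i j) =
    ((g1 *m g2) i j \*: c) \+ ((g1 *m A *m g2) i j \*: s).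
  apply/funext => t; rewrite ME; move: (g1 *m g2) (g1 *m A *m g2) => P Q.
  by rewrite !mxE [c t * _]mulrC [s t * _]mulrC.
apply: (is_derive_eq (is_deriveD (is_deriveZ _ dc) (is_deriveZ _ ds))).
by rewrite scaler0 add0r /GRing.scale /= mulr1.
Qed.

Lemma derive1_curve u A (g g1 g2 : 'M[C]_2) : finsupp u -> in_big_cell g -> g = g1 *m g2 ->
  derive1 (fun t : C => cell_eval (realf u) (g1 *m mx_exp (t *: (A : 'M[C]_2)) *m g2)) 0 =
  fsum u (fun m => mono_norm m * dmono g (g1 *m A *m g2) m).
Proof.
move=> hu hg gE; have [M0 dM] := mx_exp_curve A g1 g2.
have dt t : \det (g1 *m mx_exp (t *: (A : 'M[C]_2)) *m g2) = 1.
  rewrite !det_mulmx det_mx_exp mulr1 -det_mulmx -gE.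
  by case/big_cellP: hg.
by rewrite derive1E; have [_ ->] := is_derive_curve hu hg (etrans M0 (esym gE)) dt dM.
Qed.

Lemma sl2_mulmxE A g i j :
  (((A : 'M[C]_2) *m g) i j = A i 0 * g 0 j + A i 1 * g 1 j) *
  ((g *m (A : 'M[C]_2)) i j = g i 0 * A 0 j + g i 1 * A 1 j).
Proof. by rewrite !mxE !big_ord_recl !big_ord0 !addr0 !ord2E. Qed.

Lemma onerDn_neq0 n : 1 + n%:R != 0 :> C.
Proof. by rewrite addrC natr1 pnatr_eq0. Qed.

Lemma tworDn_neq0 n : 2 + n%:R != 0 :> C.
Proof. by rewrite -natrD pnatr_eq0. Qed.

Lemma natf_neq0 n : n`!%:R != 0 :> C.
Proof. by rewrite pnatr_eq0 -lt0n fact_gt0. Qed.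

Lemma mono_norm_Sl i k j : mono_norm (i.+1, k, j) = - mono_norm (i, k, j) / i.+1%:R.
Proof.
rewrite /mono_norm /= exprS factS natrM; field.
by rewrite onerDn_neq0 !natf_neq0.
Qed.

Lemma mono_norm_Sr i k j : mono_norm (i, k, j.+1) = mono_norm (i, k, j) / j.+1%:R.
Proof.
rewrite /mono_norm /= factS natrM; field.
by rewrite onerDn_neq0 !natf_neq0.
Qed.

Lemma mono_norm_k i k k' j : mono_norm (i, k, j) = mono_norm (i, k', j).
Proof. by []. Qed.

Lemma pi_l_realf A u : finsupp u -> pi_l A (realf u) = realf (coef_act A u).
Proof.
move=> hu; apply/funext => g; have hg : in_big_cell (val g) by apply/asboolP/(valP g).
have -> : pi_l A (realf u) g = derive1 (fun t : C => cell_eval (realf u)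
    (1%:M *m mx_exp (t *: ((- A : sl2 C) : 'M[C]_2)) *m val g)) 0.
  rewrite /pi_l; congr (derive1 _ 0); apply/funext => t; congr (cell_eval _ (_ *m _)).
  rewrite mul1mx; congr mx_exp.
  by apply/matrixP => i j; rewrite !mxE mulNr mulrN.
rewrite (derive1_curve _ hu hg); last by rewrite mul1mx.
(* Both sides are pairings with u, so it suffices to compare single monomials, where the claim is a
   rational identity in x, y, z and z^k. *)
rewrite mul1mx /realf fsum_act //; congr (fsum u _); apply/funext => -[[i k] j].
have [x [z [y [z0 gE]]]] := hg; have [a b c d] := bruhatE x z y.
rewrite /dmono !sl2_mulmxE /coef_act_tr /nmono /mono gE a b c d /= !mxE !sl2_11.
have -> : z * y / z = y by rewrite mulrAC divff ?mul1r.
rewrite mulfK //.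
have zk2 : z ^ (k - 2) = z ^ k / z ^+ 2 by rewrite expfzDr // -exprnN.
rewrite mono_norm_Sl.
case: i => [|i]; case: j => [|j]; rewrite /= ?zk2 ?mono_norm_Sl ?mono_norm_Sr ?(mono_norm_k _ (k - 2) k) ?exprS;
  move: (mono_norm _) (z ^ k) (k%:~R : C) => N Z K; field.
all: repeat (apply/andP; split); rewrite ?onerDn_neq0 ?tworDn_neq0 //; exact: z0.
Qed.

Lemma pi_r_realf A u : finsupp u -> pi_r A (realf u) = realf (coef_act_r A u).
Proof.
move=> hu; apply/funext => g; have hg : in_big_cell (val g) by apply/asboolP/(valP g).
have -> : pi_r A (realf u) g = derive1 (fun t : C => cell_eval (realf u)
    (val g *m mx_exp (t *: (A : 'M[C]_2)) *m 1%:M)) 0.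
  by rewrite /pi_r; congr (derive1 _ 0); apply/funext => t; rewrite mulmx1.
rewrite (derive1_curve _ hu hg); last by rewrite mulmx1.
rewrite mulmx1 /realf /coef_act_r fsum_swap ?fsum_act ?fsum_swap //; try exact: finsupp_swap;
  last exact/finsupp_act/finsupp_swap.
congr (fsum u _); apply/funext => -[[i k] j].
have [x [z [y [z0 gE]]]] := hg; have [a b c d] := bruhatE x z y.
rewrite /dmono !sl2_mulmxE /coef_act_tr /nmono /mono gE a b c d /= !sl2_11.
have -> : z * y / z = y by rewrite mulrAC divff ?mul1r.
rewrite mulfK //.
have zk2 : z ^ (k - 2) = z ^ k / z ^+ 2 by rewrite expfzDr // -exprnN.
rewrite mono_norm_Sr.
case: i => [|i]; case: j => [|j]; rewrite /= ?zk2 ?mono_norm_Sl ?mono_norm_Sr ?(mono_norm_k _ (k - 2) k) ?exprS;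
  move: (mono_norm _) (z ^ k) (k%:~R : C) => N Z K; field.
all: repeat (apply/andP; split); rewrite ?onerDn_neq0 ?tworDn_neq0 //; exact: z0.
Qed.

Lemma realf_lin a u v : finsupp u -> finsupp v -> realf (a *: u + v) = a *: realf u + realf v.
Proof. by move=> hu hv; apply/funext => g; rewrite /realf fsum_lin. Qed.

Lemma realf0 : realf (0 : mindex -> C^o) = 0.
Proof. by apply/funext => g; rewrite /realf fsum0. Qed.

Lemma realfD u v : finsupp u -> finsupp v -> realf (u + v) = realf u + realf v.
Proof. by move=> hu hv; have := realf_lin 1 hu hv; rewrite !scale1r. Qed.

Lemma realfZ a u : finsupp u -> realf (a *: u) = a *: realf u.
Proof. by move=> hu; have := realf_lin a hu (finsupp0 _); rewrite realf0 !addr0. Qed.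

Lemma w0_cell : in_big_cell (@w0 R).
Proof.
exists 0, 1, 0; split; first exact: oner_neq0.
have [a b c d] := bruhatE 0 1 0.
apply/matrixP => i j; have [->|->] := ord2P i; have [->|->] := ord2P j;
  rewrite ?a ?b ?c ?d /w0 !mxE /= ?mulr0 ?mul0r ?invr1 ?sub0r //.
Qed.

Lemma base_value_realf u : finsupp u -> cell_eval (realf u) (@w0 R) = base_value u.
Proof.
move=> hu; rewrite (cell_eval_realf _ w0_cell) /base_value; congr (fsum u _).
apply/funext => -[[i k] j]; rewrite /nmono /mono /w0 /= !mxE /= !mul0r exp1rz mulr1.
case: i => [|i]; last by rewrite !expr0n /= mul0r mulr0.
case: j => [|j]; last by rewrite !expr0n /= !mulr0.
by rewrite /mono_norm /= !expr0 !mulr1 ?mulr1n divr1.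
Qed.

(** The induction is on terms because [uact] works on a representative, and [pi_l] is an action only
    on regular functions. *)
Lemma uact_pi_l (t : ue_term (sl2 C)) u : finsupp u ->
  ue_term_act (@pi_l R) t (realf u) = realf (ue_term_act (@coef_act C) t u).
Proof.
elim: t u => [B|||s IHs t IHt|s IHs t IHt|c s IHs] u hu //=.
- exact: pi_l_realf.
- by rewrite realf0.
- by rewrite IHs ?IHt // realfD //; exact: finsupp_uact.
- by rewrite IHt // IHs //; exact: finsupp_uact.
- by rewrite IHs // realfZ //; exact: finsupp_uact.
Qed.

Lemma regular_to_dual_realf u : finsupp u -> regular_to_dual (realf u) = coef_functional u.
Proof.
move=> hu; apply/funext => x; rewrite /regular_to_dual /uact uact_pi_l //.
by rewrite base_value_realf //; exact: finsupp_uact.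
Qed.

Lemma pi_lr_realf (A : gg C) u : finsupp u ->
  pi_lr A (realf u) = realf (coef_act A.1 u + coef_act_r A.2 u).
Proof.
move=> hu; rewrite /pi_lr pi_l_realf // pi_r_realf // -realfD //.
  exact: finsupp_act.
exact: finsupp_act_r.
Qed.

(** Reduces the isomorphism to the determination of the image, to be done entirely on
    coefficients. *)
Lemma regular_iso (T : set (uea (sl2 C) -> C^o)) :
  [set coef_functional u | u in @finsupp C] = T ->
  iso_on (@pi_lr R) (@uea_dual_act C) (@regular_functions R) T (@regular_to_dual R).
Proof.
move=> hT; rewrite regular_functionsE; split.
- split; first split.
  + by exists 0; [exact: finsupp0|exact: realf0].
  + move=> a _ _ [u hu <-] [v hv <-]; exists (a *: u + v); first exact: finsupp_lin.
    exact: realf_lin.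
  + move=> A _ [u hu <-]; rewrite pi_lr_realf //; eexists; last reflexivity.
    by apply: finsuppD; [exact: finsupp_act|exact: finsupp_act_r].
- move=> a _ _ [u hu <-] [v hv <-].
  rewrite -realf_lin // !regular_to_dual_realf //; last exact: finsupp_lin.
  exact: coef_functional_lin.
- move=> A _ [u hu <-]; rewrite pi_lr_realf // !regular_to_dual_realf //.
    exact: coef_functional_act.
  by apply: finsuppD; [exact: finsupp_act|exact: finsupp_act_r].
- move=> _ _ [u hu <-] [v hv <-]; rewrite !regular_to_dual_realf // => E.
  suff /eqP : u - v = 0 by rewrite subr_eq0 => /eqP ->.
  apply: coef_functional_inj; first exact: finsuppB.
  rewrite -scaleN1r addrC coef_functional_lin // E scaleN1r; exact: addNr.
- rewrite -hT; apply/seteqP; split=> [_ [_ [u hu <-] <-]|_ [u hu <-]].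
    by exists u => //; rewrite regular_to_dual_realf.
  by exists (realf u); [exists u|rewrite regular_to_dual_realf].
Qed.

End Realization.

(** * Matrix elements of integral modules *)

Section WeightVectors.
Variables (K : fieldType) (W : lie_module (sl2 K)).
Local Notation e := (@act K (sl2 K) W (sl2_e K)).
Local Notation f := (@act K (sl2 K) W (sl2_f K)).
Local Notation h := (@act K (sl2 K) W (sl2_h K)).
Implicit Types (v w : W) (mu : K).

Lemma bracket_ef : bracket (sl2_e K) (sl2_f K) = sl2_h K :> sl2 K.
Proof.
apply: val_inj; apply/matrixP => i j.
by have [->|->] := ord2P i; have [->|->] := ord2P j;
  rewrite /= !mxE !big_ord_recl !big_ord0 !mxE /=; ring.
Qed.

Lemma act_he v : h (e v) = e (h v) + 2 *: e v.
Proof. by have := act_bracket (sl2_h K) (sl2_e K) v; rewrite bracket_he actZl => ->; rewrite addrC subrK. Qed.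
Lemma act_hf v : h (f v) = f (h v) - 2 *: f v.
Proof.
by have := act_bracket (sl2_h K) (sl2_f K) v; rewrite bracket_hf actZl scaleNr => ->; rewrite addrC subrK.
Qed.
Lemma act_ef v : e (f v) = f (e v) + h v.
Proof. by have := act_bracket (sl2_e K) (sl2_f K) v; rewrite bracket_ef => ->; rewrite addrC subrK. Qed.

Lemma act_sl2 (A : sl2 K) v : act A v = A 0 1 *: e v + A 0 0 *: h v + A 1 0 *: f v.
Proof. by rewrite {1}[A]sl2_decomp !actDl !actZl. Qed.

Lemma weight_act_e mu v : weight_space mu v -> weight_space (mu + 2) (e v).
Proof. by rewrite /weight_space /= act_he => ->; rewrite actZr -scalerDl. Qed.
Lemma weight_act_f mu v : weight_space mu v -> weight_space (mu - 2) (f v).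
Proof. by rewrite /weight_space /= act_hf => ->; rewrite actZr -scalerBl. Qed.
Lemma weight_iter_e mu v b : weight_space mu v -> weight_space (mu + 2 * b%:R) (iter b e v).
Proof.
move=> hv; elim: b => [|b IH]; first by rewrite mulr0 addr0.
by rewrite iterS -[b.+1%:R]natr1 mulrDr mulr1 addrA; apply: weight_act_e.
Qed.
Lemma weight_iter_f mu v b : weight_space mu v -> weight_space (mu - 2 * b%:R) (iter b f v).
Proof.
move=> hv; elim: b => [|b IH]; first by rewrite mulr0 subr0.
by rewrite iterS -[b.+1%:R]natr1 mulrDr mulr1 opprD addrA; apply: weight_act_f.
Qed.
Lemma weightZ mu a v : weight_space mu v -> weight_space mu (a *: v).
Proof. by rewrite /weight_space /= => hv; rewrite actZr hv !scalerA mulrC. Qed.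
Lemma weightD mu v w : weight_space mu v -> weight_space mu w -> weight_space mu (v + w).
Proof. by rewrite /weight_space /= => hv hw; rewrite actDr hv hw scalerDr. Qed.
Lemma weight0 mu : weight_space mu (0 : W).
Proof. by rewrite /weight_space /= act0r scaler0. Qed.

(** This is the recursion encoded in [raise_f]: as e^b f v has weight k = mu - 2 + 2b, the factor
    equals b (k - b + 1). At b = 0 the term with [b.-1] has coefficient 0. *)
Lemma iter_e_f mu v b : weight_space mu v ->
  iter b e (f v) = f (iter b e v) + (b%:R * (mu + b%:R - 1)) *: iter b.-1 e v.
Proof.
move=> hv; elim: b => [|b IH]; first by rewrite mul0r scale0r addr0.
rewrite iterS IH actDr act_ef -addrA -iterS actZr; congr (_ + _).
rewrite (weight_iter_e b hv) /=.
have -> : (b%:R * (mu + b%:R - 1)) *: e (iter b.-1 e v) = (b%:R * (mu + b%:R - 1)) *: iter b e v.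
  by case: b {IH} => [|b] //; rewrite !mul0r !scale0r.
by rewrite -scalerDl; congr (_ *: _); rewrite -[b.+1%:R]natr1; ring.
Qed.

End WeightVectors.

(** * Coefficient functions of matrix elements *)

Section MatrixCoefficients.
Variables (K : numFieldType) (W : lie_module (sl2 K)) (phi : restricted_dual W).
Local Notation e := (@act K (sl2 K) W (sl2_e K)).
Local Notation f := (@act K (sl2 K) W (sl2_f K)).
Local Notation h := (@act K (sl2 K) W (sl2_h K)).
Implicit Types (v w : W) (u : mindex -> K^o).

(** As e^b v has weight n + 2b, f^a h^c e^b takes the value (n + 2b)^c phi(f^a e^b v): for given (b,
    a) only k = n + 2b carries a coefficient. *)
Definition weight_coef (n : int) v : mindex -> K^o := fun m =>
  if m.1.2 == n + (m.1.1%:Z *+ 2) then phi (iter m.2 f (iter m.1.1 e v)) else 0.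

(** A relation rather than a function of v, so that no decomposition into weight vectors has to be
    chosen; [matrix_element_coef] shows that every u obtained this way represents the matrix
    element. *)
Inductive has_coef : W -> (mindex -> K^o) -> Prop :=
| has_coef_weight n v : weight_space n%:~R v -> has_coef v (weight_coef n v)
| has_coef0 : has_coef 0 0
| has_coefD v w u u' : has_coef v u -> has_coef w u' -> has_coef (v + w) (u + u').

Let phiZ a v : phi (a *: v) = a * phi v.
Proof. by have := rdual_linear phi a v 0; rewrite (linear_map0 (rdual_linear phi)) !addr0. Qed.
Let phiD v w : phi (v + w) = phi v + phi w.
Proof. by have := rdual_linear phi 1 v w; rewrite !scale1r. Qed.

Let iter_lin A b a v : iter b (@act K (sl2 K) W A) (a *: v) = a *: iter b (@act K (sl2 K) W A) v.
Proof. by elim: b => //= b ->; rewrite actZr. Qed.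
Let iter_add A b v w : iter b (@act K (sl2 K) W A) (v + w) = iter b (@act K (sl2 K) W A) v + iter b (@act K (sl2 K) W A) w.
Proof. by elim: b => //= b ->; rewrite actDr. Qed.

Lemma has_coefZ a v u : has_coef v u -> has_coef (a *: v) (a *: u).
Proof.
elim=> [n w hw||v1 v2 u1 u2 _ IH1 _ IH2]; last 2 first.
- by rewrite !scaler0; exact: has_coef0.
- by rewrite !scalerDr; exact: has_coefD.
have -> : a *: weight_coef n w = weight_coef n (a *: w).
  apply/funext => m; rewrite !fctE /weight_coef.
  by case: ifP => _; rewrite ?scaler0 // !iter_lin phiZ.
exact/has_coef_weight/weightZ.
Qed.

Lemma has_coef_act A v u : has_coef v u -> has_coef (act A v) (coef_act A u).
Proof.
elim=> [n w hw||v1 v2 u1 u2 _ IH1 _ IH2]; last 2 first.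
- by rewrite act0r (linear_map0 (coef_act_linearr A)); exact: has_coef0.
- rewrite actDr; have := coef_act_linearr A 1 u1 u2; rewrite !scale1r => ->.
  exact: has_coefD.
have we : weight_space (n + 2)%:~R (e w) by rewrite intrD; exact: weight_act_e.
have wf : weight_space (n - 2)%:~R (f w) by rewrite intrB; exact: weight_act_f.
have -> : coef_act A (weight_coef n w) = A 0 1 *: weight_coef (n + 2) (e w)
    + A 0 0 *: (n%:~R *: weight_coef n w) + A 1 0 *: weight_coef (n - 2) (f w).
  apply/funext => -[[b k] a]; rewrite coef_actE !fctE /weight_coef /=.
  congr (_ * _ + _ * _ + _ * _).
  - rewrite -iterSr (_ : (k == n + b.+1%:Z *+ 2) = (k == n + 2 + b%:Z *+ 2)) //.
    by apply/eqP/eqP; lia.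
  - rewrite /GRing.scale /=; case: eqP => [->|_]; last by rewrite !mulr0.
    by congr (_ * _); rewrite intrD mulrnAr; ring.
  - have -> : (k + 2 == n + b%:Z *+ 2) = (k == n - 2 + b%:Z *+ 2) by apply/eqP/eqP; lia.
    rewrite (iter_e_f b hw) [f _ + _]addrC iter_add iter_lin phiD phiZ -iterSr.
    case: b => [|b] /=.
      by rewrite !mul0r add0r; case: ifP => // _; rewrite add0r.
    have -> : (k == n + b%:Z *+ 2) = (k == n - 2 + b.+1%:Z *+ 2) by apply/eqP/eqP; lia.
    case: eqP => [->|_]; last by rewrite mulr0 addr0.
    congr (_ * _ + _); rewrite intrD intrB; congr (_ * _).
    rewrite -[b.+1%:Z *+ 2]mulr_natr intrM /=; rewrite -[b.+1%:R]natr1; ring.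
rewrite act_sl2 hw; apply: has_coefD; first apply: has_coefD.
- exact/has_coefZ/has_coef_weight.
- exact/has_coefZ/has_coefZ/has_coef_weight.
- exact/has_coefZ/has_coef_weight.
Qed.

Lemma has_coef_uact (t : ue_term (sl2 K)) v u : has_coef v u ->
  has_coef (ue_term_act (@act K (sl2 K) W) t v) (ue_term_act (@coef_act K) t u).
Proof.
elim: t v u => [B|||s IHs t IHt|s IHs t IHt|c s IHs] v u hv //=.
- exact: has_coef_act.
- exact: has_coef0.
- by apply: has_coefD; [exact: IHs|exact: IHt].
- exact/IHs/IHt.
- exact/has_coefZ/IHs.
Qed.

Let int_bound (s : seq K) : exists M : nat, forall z : int, z%:~R \in s -> (`|z| <= M)%N.
Proof.
elim: s => [|mu s [M hM]]; first by exists 0%N.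
have [[z hz]|nz] := pselect (exists z : int, z%:~R = mu).
  exists (maxn `|z| M) => y; rewrite inE => /orP[/eqP|/hM]; last by rewrite leq_max orbC => ->.
  by rewrite -hz => /eqP; rewrite eqr_int => /eqP ->; rewrite leq_maxl.
exists M => y; rewrite inE => /orP[/eqP yz|/hM //].
by case: nz; exists y.
Qed.

(** Nilpotency bounds b by N. Then f^a e^b v has weight n + 2b - 2a, and phi vanishes outside
    finitely many weights, whose integral members are at most M in absolute value; for a >= L the
    weight exceeds M in absolute value. *)
Lemma finsupp_weight_coef n v : (exists N, iter N e v = 0) -> weight_space n%:~R v ->
  finsupp (weight_coef n v).
Proof.
move=> [N hN] hv; have /asboolP[_ [s hs]] := valP phi.
have [M hM] := int_bound s.
pose L := (`|n| + 2 * N + M).+1.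
exists [seq ((b, n + b%:Z *+ 2), a) | b <- iota 0 N, a <- iota 0 L] => -[[b k] a] hm.
rewrite /weight_coef /=; case: eqP => // kE.
have [bN|bN] := leqP N b.
  have -> : iter b e v = 0.
    rewrite -(subnK bN) iterD hN; elim: (b - N)%N => //= c ->; exact: act0r.
  have -> : iter a f 0 = 0 by elim: a {hm} => //= a ->; exact: act0r.
  exact: linear_map0 (rdual_linear phi).
have w1 := weight_iter_f a (weight_iter_e b hv).
have dbl (c : nat) : (c%:Z *+ 2)%:~R = 2 * c%:R :> K by rewrite rmorphMn /= mulr_natl.
have w2 : n%:~R + 2 * b%:R - 2 * a%:R = (n + b%:Z *+ 2 - a%:Z *+ 2)%:~R :> K.
  by rewrite intrB intrD !dbl.
rewrite w2 in w1; apply: hs w1; apply/negP => /hM hz.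
case/negP: hm; rewrite kE; apply/allpairsP; exists (b, a).
have bL : (b : nat) \in iota 0 N by rewrite mem_iota.
have aL : (a : nat) \in iota 0 L by rewrite mem_iota add0n /= /L; lia.
by [].
Qed.

Lemma fsum_single u (F : mindex -> K) m0 : (forall m, m != m0 -> u m * F m = 0) ->
  fsum u F = u m0 * F m0.
Proof.
move=> h1; rewrite /fsum -(fsbig_widen [set m0]) //=; first by rewrite fsbig_set1.
by move=> m [_ /eqP mm0] /=; exact: h1.
Qed.

Lemma base_value_weight_coef n v : base_value (weight_coef n v) = phi v.
Proof.
rewrite /base_value (@fsum_single _ _ (0%N, n, 0%N)) /=.
  by rewrite /weight_coef /= addr0 eqxx mulr1.
move=> [[b k] a] /=; rewrite /weight_coef /=; case: b => [|b] /=; last by rewrite mulr0.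
case: a => [|a] /=; last by rewrite mulr0.
by rewrite mul0rn addr0; case: (k =P n) => [->|_ _]; [rewrite eqxx|rewrite mul0r].
Qed.

Hypothesis e_nil : locally_e_nilpotent W.

Lemma has_coef_finsupp v u : has_coef v u -> finsupp u.
Proof.
elim=> [n w hw||v1 v2 u1 u2 _ IH1 _ IH2]; last 2 first.
- exact: finsupp0.
- exact: finsuppD.
- apply: finsupp_weight_coef => //; exact: e_nil.
Qed.

Lemma has_coef_base_value v u : has_coef v u -> base_value u = phi v.
Proof.
elim=> [n w hw||v1 v2 u1 u2 h1 IH1 h2 IH2].
- exact: base_value_weight_coef.
- by rewrite /base_value fsum0 (linear_map0 (rdual_linear phi)).
- have f1 := has_coef_finsupp h1; have f2 := has_coef_finsupp h2.
  by rewrite /base_value fsumD // -!/(base_value _) IH1 IH2 phiD.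
Qed.

Lemma matrix_element_coef v u : has_coef v u ->
  matrix_element v (phi : star W) = coef_functional u.
Proof.
move=> hv; apply/funext => x; rewrite /matrix_element /coef_functional /uact.
by rewrite (has_coef_base_value (has_coef_uact (urepr x) hv)).
Qed.

End MatrixCoefficients.

Section IntegralModules.
Variables (K : numFieldType) (W : lie_module (sl2 K)).

Inductive int_sum : W -> Prop :=
| int_sum_weight (n : int) v : weight_space n%:~R v -> int_sum v
| int_sum0 : int_sum 0
| int_sumD v w : int_sum v -> int_sum w -> int_sum (v + w).

Definition integral_weights := forall v, int_sum v.

Lemma matrix_elements_regular : locally_e_nilpotent W -> integral_weights ->
  matrix_elements W `<=` [set coef_functional u | u in @finsupp K].
Proof.
move=> eW iW phi [n [a [m [hm ->]]]].
have gen (psi : uea (sl2 K) -> K^o) : (exists (v : W) (v' : star W), psi = matrix_element v v') ->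
    [set coef_functional u | u in @finsupp K] psi.
  move=> [v [v' ->]].
  have [u hu] : exists u, has_coef (v' : restricted_dual W) v u.
    elim: (iW v) => [k w hw||v1 v2 _ [u1 h1] _ [u2 h2]].
    - by exists (weight_coef v' k w); exact: has_coef_weight.
    - by exists 0; exact: has_coef0.
    - by exists (u1 + u2); exact: has_coefD.
  by exists u; [exact: has_coef_finsupp hu|rewrite (matrix_element_coef _ hu)].
elim/big_rec: _ => [|i x _ [u hu <-]].
  exists 0; first exact: finsupp0.
  by apply/funext => x; rewrite /coef_functional (linear_map0 (@uact_linear _ _ (coef_module K) x)) /base_value fsum0.
have [u' hu' <-] := gen _ (hm i).
exists (a i *: u' + u); first exact: finsupp_lin.
exact: coef_functional_lin.
Qed.

End IntegralModules.

(** * The Casimir operator on projective covers *)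

Lemma subrACA (V : zmodType) (x y z t : V) : x - y - (z - t) = x - z - (y - t).
Proof. by rewrite !opprB addrACA [RHS]addrACA [- y - z]addrC. Qed.

Section Homs.
Variables (K : fieldType) (L : lie_algebra K).

Section Linear.
Variables (V W : lmodType K) (p : V -> W).
Hypothesis lp : linear p.
Lemma homD v w : p (v + w) = p v + p w.
Proof. by have := lp 1 v w; rewrite !scale1r. Qed.
Lemma homZ a v : p (a *: v) = a *: p v.
Proof. by have := lp a v 0; rewrite (linear_map0 lp) !addr0. Qed.
Lemma homB v w : p (v - w) = p v - p w.
Proof. by rewrite homD -scaleN1r homZ scaleN1r. Qed.
Lemma hom_sum (I : Type) (r : seq I) (Q : pred I) (F : I -> V) :
  p (\sum_(i <- r | Q i) F i) = \sum_(i <- r | Q i) p (F i).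
Proof. exact: (big_morph p homD (linear_map0 lp)). Qed.
End Linear.

Lemma image_submodule (V W : lie_module L) (p : V -> W) (N : set V) :
  is_hom p -> is_lie_submodule N -> is_lie_submodule (p @` N).
Proof.
move=> [lp hp] [[N0 NL] NA]; split; first split.
- by exists 0 => //; exact: linear_map0.
- by move=> a _ _ [x Nx <-] [y Ny <-]; exists (a *: x + y); [exact: NL|exact: lp].
- by move=> A _ [x Nx <-]; exists (act A x); [exact: NA|exact: hp].
Qed.

Lemma full_submodule (V : lie_module L) : is_lie_submodule [set: V].
Proof. by []. Qed.

(** The image of N is a nonzero submodule of the irreducible V, hence all of V, and p is
    essential. *)
Lemma essential_generator (P V : lie_module L) (p : P -> V) : irreducible V -> is_hom p ->
  (forall N : set P, is_lie_submodule N -> (forall v, exists2 x, N x & p x = v) -> N = setT) ->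
  forall (N : set P) x, is_lie_submodule N -> N x -> p x != 0 -> N = setT.
Proof.
move=> [_ irr] hp ess N x hN Nx px; apply: ess => // v.
have [E|E] := irr _ (image_submodule hp hN).
  have : (p @` N) (p x) by exists x.
  by rewrite E /= => /eqP; rewrite (negbTE px).
have : (p @` N) v by rewrite E.
by case=> y Ny <-; exists y.
Qed.

End Homs.

Section Weights.
Variables (K : numFieldType) (W : lie_module (sl2 K)).
Local Notation h := (@act K (sl2 K) W (sl2_h K)).

(** The product of the operators h - mu i kills the sum, while on a vector of weight lambda it is
    multiplication by a nonzero scalar. *)
Lemma weight_sum_neq (lambda : K) n (mu : 'I_n -> K) (w : 'I_n -> W) (Q : pred 'I_n) :
  (forall i, weight_space (mu i) (w i)) -> (forall i, Q i -> mu i != lambda) ->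
  weight_space lambda (\sum_(i < n | Q i) w i) -> \sum_(i < n | Q i) w i = 0.
Proof.
move=> hw hQ hs; set y := \sum_(i < n | Q i) w i.
pose T (s : seq K) (v : W) := foldr (fun a v => h v - a *: v) v s.
have TE s nu v : weight_space nu v -> T s v = (\prod_(a <- s) (nu - a)) *: v.
  move=> hv; elim: s => [|a s IH]; first by rewrite big_nil scale1r.
  by rewrite /= -/(T s v) IH actZr hv big_cons scalerA mulrC scalerA -scalerBl mulrBl.
have T0 s : T s 0 = 0 by rewrite (TE s 0) ?scaler0 //; exact: weight0.
have TD s v v' : T s (v + v') = T s v + T s v'.
  by elim: s => //= a s ->; rewrite actDr scalerDr opprD addrACA.
pose s := [seq mu i | i <- enum 'I_n & Q i].
have Ty : T s y = 0.
  rewrite (big_morph (T s) (TD s) (T0 s)) big1 // => i Qi.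
  rewrite (TE s (mu i)) // (_ : \prod_(a <- s) _ = 0) ?scale0r //.
  apply/eqP; rewrite prodf_seq_eq0; apply/hasP; exists (mu i); rewrite ?subrr ?eqxx //.
  by apply/mapP; exists i; rewrite // mem_filter Qi mem_enum.
move/eqP: Ty; rewrite (TE s lambda) // scaler_eq0 => /orP[|/eqP //].
rewrite prodf_seq_eq0 => /hasP[a /mapP[i + ->]] /=.
by rewrite mem_filter subr_eq0 => /andP[/hQ /negbTE mi _]; rewrite eq_sym mi.
Qed.

Lemma int_sum_submodule : is_lie_submodule (@int_sum K W).
Proof.
have Z (a : K) (v : W) : int_sum v -> int_sum (a *: v).
  elim=> [n w hw||v1 v2 _ IH1 _ IH2].
  - by apply: (@int_sum_weight _ _ n); exact: weightZ.
  - by rewrite scaler0; exact: int_sum0.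
  - by rewrite scalerDr; exact: int_sumD.
split; first split.
- exact: int_sum0.
- by move=> a x y hx hy; apply: int_sumD => //; exact: Z.
- move=> A v; elim=> [n w hw||v1 v2 _ IH1 _ IH2].
  + rewrite act_sl2 hw; apply: int_sumD; first apply: int_sumD.
    * by apply/Z/(@int_sum_weight _ _ (n + 2)); rewrite intrD; exact: weight_act_e.
    * by apply/Z/Z/(@int_sum_weight _ _ n).
    * by apply/Z/(@int_sum_weight _ _ (n - 2)); rewrite intrB; exact: weight_act_f.
  + by rewrite act0r; exact: int_sum0.
  + by rewrite actDr; exact: int_sumD.
Qed.

Definition casimir (v : W) : W :=
  4 *: act (sl2_f K) (act (sl2_e K) v) + h (h v) + 2 *: h v.

Lemma casimir_lin : linear casimir.
Proof.
move=> a v w; rewrite /casimir !(actDr, actZr, scalerDr) !scalerA ![_ * a]mulrC -!scalerA.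
by rewrite [X in X + _]addrACA [LHS]addrACA.
Qed.

End Weights.

Section CasimirCommutes.
Variables (K : numFieldType).

Lemma casimir_hom (V W : lie_module (sl2 K)) (p : V -> W) v : is_hom p ->
  p (casimir v) = casimir (p v).
Proof. by move=> [lp hp]; rewrite /casimir !(homD lp) !(homZ lp) !hp. Qed.

Variable W : lie_module (sl2 K).
Local Notation e := (@act K (sl2 K) W (sl2_e K)).
Local Notation f := (@act K (sl2 K) W (sl2_f K)).
Local Notation h := (@act K (sl2 K) W (sl2_h K)).

(** Hides four vectors behind F, so that an identity between their combinations reduces to four
    scalar identities within reach of [ring]. *)
Let combination4 (V : lmodType K) (a b c d : V) : exists2 F : K -> K -> K -> K -> V,
  [/\ a = F 1 0 0 0, b = F 0 1 0 0, c = F 0 0 1 0 & d = F 0 0 0 1] &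
  (forall x y z t x' y' z' t', F x y z t + F x' y' z' t' = F (x + x') (y + y') (z + z') (t + t')) /\
  (forall k x y z t, k *: F x y z t = F (k * x) (k * y) (k * z) (k * t)).
Proof.
exists (fun x y z t => x *: a + y *: b + z *: c + t *: d).
  by split; rewrite !scale0r !scale1r ?addr0 ?add0r.
split=> [*|*]; last by rewrite !scalerDr !scalerA.
by rewrite !scalerDl [LHS]addrACA; congr (_ + _); rewrite [LHS]addrACA; congr (_ + _); rewrite addrACA.
Qed.

Lemma casimir_f (v : W) : casimir (f v) = f (casimir v).
Proof.
have hh : h (h (f v)) = f (h (h v)) - 2 *: f (h v) - 2 *: (f (h v) - 2 *: f v).
  by rewrite act_hf (homB (act_linearr _)) actZr !act_hf.
rewrite /casimir hh !actDr !actZr act_hf act_ef !actDr.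
have [F [-> -> -> ->] [D Z]] := combination4 (f (f (e v))) (f (h v)) (f (h (h v))) (f v).
rewrite -!scaleN1r !(Z, D); congr F; ring.
Qed.

Lemma casimir_e (v : W) : casimir (e v) = e (casimir v).
Proof.
have hh : h (h (e v)) = e (h (h v)) + 2 *: e (h v) + 2 *: (e (h v) + 2 *: e v).
  by rewrite act_he actDr actZr !act_he.
rewrite /casimir hh !actDr !actZr [e (f _)]act_ef act_he.
have [F [-> -> -> ->] [D Z]] := combination4 (f (e (e v))) (e (h v)) (e (h (h v))) (e v).
rewrite !(Z, D); congr F; ring.
Qed.

Lemma casimir_h (v : W) : casimir (h v) = h (casimir v).
Proof.
rewrite /casimir !actDr !actZr act_hf act_he actDr actZr.
by rewrite addrK.
Qed.

Lemma casimir_act (A : sl2 K) (v : W) : casimir (act A v) = act A (casimir v).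
Proof.
rewrite !(act_sl2 A) !(homD (@casimir_lin K W)) !(homZ (@casimir_lin K W)).
by rewrite casimir_e casimir_f casimir_h.
Qed.

Definition casimir_sub (c : K) (v : W) : W := casimir v - c *: v.

Lemma casimir_sub_hom c : is_hom (casimir_sub c).
Proof.
split=> [a v w|A v]; rewrite /casimir_sub.
- by rewrite casimir_lin [c *: (_ + _)]scalerDr opprD addrACA scalerBr !scalerA [c * a]mulrC.
- by rewrite casimir_act -actZr -scaleN1r -actZr -actDr scaleN1r.
Qed.

Lemma casimir_subC c d v : casimir_sub c (casimir_sub d v) = casimir_sub d (casimir_sub c v).
Proof.
rewrite {1 3}/casimir_sub /casimir_sub !(homB (@casimir_lin K W)) !(homZ (@casimir_lin K W)).
by rewrite !scalerBr !scalerA [d * c]mulrC subrACA.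
Qed.

Lemma iter_casimir_subC n c d v :
  iter n (casimir_sub c) (casimir_sub d v) = casimir_sub d (iter n (casimir_sub c) v).
Proof. by elim: n => //= n ->; rewrite casimir_subC. Qed.

Lemma kernel_submodule (V : lie_module (sl2 K)) (p : W -> V) : is_hom p ->
  is_lie_submodule [set v | p v = 0].
Proof.
move=> [lp hp]; split; first split.
- exact: linear_map0.
- by move=> a x y /= hx hy; rewrite lp hx hy scaler0 addr0.
- by move=> A x /= hx; rewrite hp hx act0r.
Qed.

Lemma comp_hom (V1 V2 V3 : lie_module (sl2 K)) (p : V1 -> V2) (q : V2 -> V3) :
  is_hom p -> is_hom q -> is_hom (q \o p).
Proof.
move=> [lp hp] [lq hq]; split=> [a v w|A v] /=; first by rewrite lp lq.
by rewrite hp hq.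
Qed.

Lemma iter_hom (p : W -> W) n : is_hom p -> is_hom (iter n p).
Proof.
move=> hp; elim: n => [|n IH]; first by split.
exact: comp_hom IH hp.
Qed.

Definition casimir_prod (s : seq K) (v : W) : W := foldr (fun c y => casimir_sub c y) v s.

Lemma casimir_prod_hom s : is_hom (casimir_prod s).
Proof.
elim: s => [|c s IH]; first by split.
exact: comp_hom IH (casimir_sub_hom c).
Qed.

(** The eigenvalue of [casimir] on a highest weight vector of weight mu, equal to (mu + 1)^2 - 1. *)
Definition casimir_value (mu : K) := mu ^+ 2 + 2 * mu.

Lemma casimir_weight mu v : weight_space mu v ->
  casimir_sub (casimir_value mu) v = 4 *: f (e v).
Proof.
move=> hv; rewrite /casimir_sub /casimir hv actZr hv !scalerA -expr2 /casimir_value scalerDl.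
by rewrite -[X in X - _]addrA addrK.
Qed.

(* On a vector of weight [mu], [casimir - casimir_value mu] is [4 f e], and [f] commutes with
   the Casimir operator: this reduces the claim to [e v]. *)
Lemma casimir_annihilator N mu v : weight_space mu v -> iter N e v = 0 ->
  exists s, casimir_prod s v = 0.
Proof.
elim: N mu v => [|N IH] mu v hv; first by move=> /= ->; exists [::].
rewrite iterSr => /(IH _ _ (weight_act_e hv)) [s hs].
exists (rcons s (casimir_value mu)); rewrite /casimir_prod foldr_rcons.
rewrite -/(casimir_prod _ _) (casimir_weight hv).
have [lp hp] := casimir_prod_hom s.
by rewrite (homZ lp) hp hs act0r scaler0.
Qed.

End CasimirCommutes.

(** * Integral weights and the Casimir eigenvalue of a projective cover *)

Section ProjectiveCover.
Variables (K : numFieldType) (lambda : int) (V P : lie_module (sl2 K)) (p : P -> V) (v0 : V).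
Hypotheses (irrV : irreducible V) (v0_neq0 : v0 != 0) (ev0 : act (sl2_e K) v0 = 0)
  (hv0 : weight_space lambda%:~R v0).
Hypotheses (hp : is_hom p) (p_surj : forall v, exists x, p x = v).
Hypothesis p_ess : forall N : set P, is_lie_submodule N ->
  (forall v, exists2 x, N x & p x = v) -> N = setT.
Hypotheses (nilP : locally_e_nilpotent P) (diagP : h_diagonalizable P).

(** Keep the component of weight lambda of any preimage of v0. The other components map to a vector
    which has weight lambda and is a sum of vectors of other weights, hence is 0. *)
Lemma highest_vector_lift : exists2 x, weight_space lambda%:~R x & p x = v0.
Proof.
have [lp hpA] := hp; have [x px] := p_surj v0; have [n [mu [w [hw xE]]]] := diagP x.
exists (\sum_(i < n | mu i == lambda%:~R) w i).
  elim/big_rec: _ => [|i y /eqP mi hy]; first exact: weight0.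
  by apply: weightD => //; rewrite -mi.
have hpw i : weight_space (mu i) (p (w i)).
  by rewrite /weight_space /= -hpA hw (homZ lp).
have : v0 = \sum_(i < n | mu i == lambda%:~R) p (w i) + \sum_(i < n | mu i != lambda%:~R) p (w i).
  by rewrite -px xE (hom_sum lp) (bigID (fun i => mu i == lambda%:~R)).
rewrite (hom_sum lp) => E.
suff S0 : \sum_(i < n | mu i != lambda%:~R) p (w i) = 0 by rewrite E S0 addr0.
apply: (@weight_sum_neq _ _ lambda%:~R _ mu) => //.
have -> : \sum_(i < n | mu i != lambda%:~R) p (w i) =
    v0 + (-1) *: \sum_(i < n | mu i == lambda%:~R) p (w i).
  by rewrite E scaleN1r addrC addKr.
apply: weightD => //; apply: weightZ.
elim/big_rec: _ => [|i y /eqP mi hy]; first exact: weight0.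
by apply: weightD => //; rewrite -mi.
Qed.

Lemma cover_generator (N : set P) x : is_lie_submodule N -> N x -> p x != 0 -> N = setT.
Proof. exact: (essential_generator irrV hp p_ess). Qed.

Lemma cover_integral_weights : integral_weights P.
Proof.
have [x hx px] := highest_vector_lift.
have E := @cover_generator _ x (int_sum_submodule P) (int_sum_weight hx).
by move=> v; rewrite E ?px.
Qed.

Lemma casimir_irreducible (v : V) : casimir v = casimir_value lambda%:~R *: v.
Proof.
have hN := kernel_submodule (casimir_sub_hom V (casimir_value lambda%:~R)).
have [_ irr] := irrV; have N0 : casimir_sub (casimir_value lambda%:~R) v0 = 0.
  by rewrite (casimir_weight hv0) ev0 act0r scaler0.
have [E|E] := irr _ hN.
  have : [set v | casimir_sub (casimir_value lambda%:~R) v = 0] v0 by [].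
  by rewrite E /= => /eqP; rewrite (negbTE v0_neq0).
have : [set v | casimir_sub (casimir_value lambda%:~R) v = 0] v by rewrite E.
by move=> /= /eqP; rewrite subr_eq0 => /eqP.
Qed.

Lemma cover_casimir_nilpotent :
  exists m, forall y : P, iter m (casimir_sub (casimir_value lambda%:~R)) y = 0.
Proof.
set c := casimir_value _.
have [lp hpA] := hp.
(* Factors casimir - a with a != c are absorbed into y: on V the Casimir operator is c, so p y is
   only multiplied by c - a != 0. Once they are gone, the kernel of a power of casimir - c contains
   a vector outside the kernel of p, hence is all of P. *)
have key s : forall k y, p y != 0 -> casimir_prod s (iter k (casimir_sub c) y) = 0 ->
    exists m, forall y : P, iter m (casimir_sub c) y = 0.
  elim/last_ind: s => [|s a IH] k y py.
    move=> /= E; exists k => z.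
    have hN := kernel_submodule (iter_hom k (casimir_sub_hom P c)).
    have NT := cover_generator hN E py.
    by have : [set v | iter k (casimir_sub c) v = 0] z by rewrite NT.
  rewrite /casimir_prod foldr_rcons -/(casimir_prod _ _).
  have [->|ac] := eqVneq a c.
    by rewrite -iterS => /IH; apply.
  rewrite -iter_casimir_subC => /IH; apply.
  rewrite /casimir_sub (homB lp) (homZ lp) casimir_hom // casimir_irreducible -scalerBl.
  by rewrite scaler_eq0 negb_or py andbT subr_eq0 eq_sym.
have [x hx px] := highest_vector_lift; have [N hN] := nilP x.
have [s hs] := casimir_annihilator hx hN.
by apply: (key s 0%N x); rewrite ?px.
Qed.

End ProjectiveCover.

(** * Casimir eigenvalues of functionals and independence of eigenspaces *)

Section Blocks.
Variable K : numFieldType.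

Section UeaLinear.
Variable W : lie_module (sl2 K).
Lemma uactDl x y (v : W) : uact (@act _ _ W) (x + y) v = uact (@act _ _ W) x v + uact (@act _ _ W) y v.
Proof. by rewrite -(ureprK x) -(ureprK y) -[X in uact _ X]uclassD !uact_class. Qed.
Lemma uactZl a x (v : W) : uact (@act _ _ W) (a *: x) v = a *: uact (@act _ _ W) x v.
Proof. by rewrite -(ureprK x) -[X in uact _ X]uclassZ !uact_class. Qed.
End UeaLinear.

Definition casimir_elt : uea (sl2 K) :=
  4 *: (ugen (sl2_f K) * ugen (sl2_e K)) + ugen (sl2_h K) * ugen (sl2_h K)
  + 2 *: ugen (sl2_h K).

Lemma uact_casimir_elt (W : lie_module (sl2 K)) (v : W) :
  uact (@act _ _ W) casimir_elt v = casimir v.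
Proof. by rewrite /casimir_elt !uactDl !uactZl !uactM !uact_gen. Qed.

(** It sends the matrix element of v and v' to that of [casimir v] and v', whatever the module: one
    operator on functionals for all the P_lambda at once. *)
Definition casimir_dual (phi : uea (sl2 K) -> K^o) : uea (sl2 K) -> K^o :=
  fun x => phi (x * casimir_elt).

Lemma casimir_dual_lin : linear casimir_dual.
Proof. by []. Qed.

End Blocks.

Section GeneralizedEigenspaces.
Variables (K : fieldType) (V : lmodType K) (T : V -> V).
Hypothesis lT : linear T.

Definition shift_op (c : K) (v : V) : V := T v - c *: v.

Lemma shift_op_lin c : linear (shift_op c).
Proof.
by move=> a v w; rewrite /shift_op lT [c *: (_ + _)]scalerDr opprD addrACA scalerBr !scalerA [c * a]mulrC.
Qed.

Lemma iter_shift_op_lin c n : linear (iter n (shift_op c)).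
Proof. by elim: n => [|n IH] a v w //; rewrite !iterS IH shift_op_lin. Qed.

Lemma shift_opC c d v : shift_op c (shift_op d v) = shift_op d (shift_op c v).
Proof.
rewrite /shift_op !(homB lT) !(homZ lT) !scalerBr !scalerA [d * c]mulrC.
by rewrite subrACA.
Qed.

Lemma iter_shift_opC c d n k v :
  iter n (shift_op c) (iter k (shift_op d) v) = iter k (shift_op d) (iter n (shift_op c) v).
Proof.
have C1 v' : shift_op c (iter k (shift_op d) v') = iter k (shift_op d) (shift_op c v').
  by elim: k => //= k IH; rewrite shift_opC IH.
by elim: n => //= n ->; rewrite C1.
Qed.

(** Otherwise the last nonzero vector (T - d)^k v would be an eigenvector on which T - c is the
    nonzero scalar d - c, whereas a power of T - c kills v and hence that vector. *)
Lemma generalized_eigen_disjoint c d n k v : c != d ->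
  iter n (shift_op c) v = 0 -> iter k (shift_op d) v = 0 -> v = 0.
Proof.
move=> cd hn; elim: k => [//|k IH]; rewrite iterS => E; apply: IH.
set w := iter k _ v in E *.
have wn : iter n (shift_op c) w = 0.
  by rewrite iter_shift_opC hn (linear_map0 (iter_shift_op_lin d k)).
have Tw : shift_op c w = (d - c) *: w.
  by move/eqP: E; rewrite /shift_op subr_eq0 => /eqP ->; rewrite scalerBl.
have : (d - c) ^+ n *: w = 0.
  rewrite -wn; elim: (n) => [|l IH]; first by rewrite scale1r.
  by rewrite iterS -IH (homZ (shift_op_lin c)) Tw scalerA exprSr.
move/eqP; rewrite scaler_eq0 => /orP[|/eqP //].
by rewrite expf_eq0 subr_eq0 eq_sym (negbTE cd) andbF.
Qed.

Lemma generalized_eigen_direct (I : choiceType) (c : I -> K) (N : I -> nat) (m : I -> V) :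
  injective c -> finite_set [set i | m i != 0] ->
  (forall i, iter (N i) (shift_op (c i)) (m i) = 0) ->
  \sum_(i \in [set: I]) m i = 0 -> forall i, m i = 0.
Proof.
move=> cI /finite_support_seq[s us hs] hN; rewrite (fsbig_uniq us hs) => S0 i.
case: (boolP (i \in s)) => [si|/hs //].
(* The product of the (T - c j)^(N j) over all j != i kills every other summand, hence m i as well;
   its factors are then removed one at a time by [generalized_eigen_disjoint]. *)
pose Q (t : seq I) (v : V) := foldr (fun j y => iter (N j) (shift_op (c j)) y) v t.
have QS j t v : Q (j :: t) v = iter (N j) (shift_op (c j)) (Q t v) by [].
have Qlin t : linear (Q t).
  by elim: t => [|j t IH] a v w //; rewrite !QS IH iter_shift_op_lin.
have QC t k d v : iter k (shift_op d) (Q t v) = Q t (iter k (shift_op d) v).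
  by elim: t => // j t IH; rewrite !QS iter_shift_opC IH.
have Qkill t j : j \in t -> Q t (m j) = 0.
  elim: t => // j' t IH; rewrite QS inE => /orP[/eqP ->|/IH ->].
    by rewrite QC hN (linear_map0 (Qlin t)).
  exact: linear_map0 (iter_shift_op_lin _ _).
pose t := [seq j <- s | j != i].
have Qi : Q t (m i) = 0.
  have : Q t (\sum_(j <- s) m j) = 0 by rewrite S0 (linear_map0 (Qlin t)).
  rewrite (hom_sum (Qlin t)) (bigD1_seq i) //= big_seq_cond big1 ?addr0 // => j /andP[js ji].
  by apply: Qkill; rewrite mem_filter ji.
have : all (fun j => j != i) t by apply: filter_all.
elim: t Qi => // j t IH; rewrite QS => E /andP[ji hall]; apply: IH => //.
apply: (generalized_eigen_disjoint (c := c i) (n := N i) _ _ E).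
  by rewrite (inj_eq cI) eq_sym.
by rewrite QC hN (linear_map0 (Qlin t)).
Qed.

End GeneralizedEigenspaces.

Lemma matrix_elements_block (K : numFieldType) (W : lie_module (sl2 K)) c m phi :
  (forall y : W, iter m (casimir_sub c) y = 0) -> matrix_elements W phi ->
  iter m (shift_op (@casimir_dual K) c) phi = 0.
Proof.
move=> hm [n [a [f [hf ->]]]].
have lin := iter_shift_op_lin (@casimir_dual_lin K) c m.
rewrite (hom_sum lin) big1 // => i _; rewrite (homZ lin).
have [v [v' ->]] := hf i; have bil := (matrix_element_bilinear W).1 v'.
have -> : iter m (shift_op (@casimir_dual K) c) (matrix_element v v') =
   matrix_element (iter m (casimir_sub c) v) v'.
  elim: m {hm lin} => //= m ->.
  rewrite [RHS](homB bil) [in RHS](homZ bil) /shift_op; congr (_ - _).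
  by apply/funext => x; rewrite /casimir_dual /matrix_element uactM uact_casimir_elt.
by rewrite hm (linear_map0 bil) scaler0.
Qed.

(** * A model of the big projective modules *)

Lemma cat_family (U : nmodType) (T : Type) n n' (x : 'I_n -> T) (x' : 'I_n' -> T) :
  exists y : 'I_(n + n') -> T,
    (forall i, (exists j, y i = x j) \/ (exists j, y i = x' j)) /\
    forall F : T -> U, \sum_i F (y i) = \sum_i F (x i) + \sum_i F (x' i).
Proof.
exists (fun i => match fintype.split i with inl j => x j | inr j => x' j end); split.
  by move=> i; case: (fintype.split i) => j; [left|right]; exists j.
move=> F; rewrite big_split_ord /=; congr (_ + _); apply: eq_bigr => i _.
  by have -> : fintype.split (lshift n' i) = inl i := unsplitK (inl i).
by have -> : fintype.split (rshift n i) = inr i := unsplitK (inr i).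
Qed.

Section Diagonalizable.
Variables (K : fieldType) (W : lie_module (sl2 K)).

Definition weight_sum (v : W) := exists (n : nat) (mu : 'I_n -> K) (w : 'I_n -> W),
  (forall i, weight_space (mu i) (w i)) /\ v = \sum_(i < n) w i.

Lemma weight_sum_weight mu v : weight_space mu v -> weight_sum v.
Proof. by move=> hv; exists 1%N, (fun=> mu), (fun=> v); rewrite big_ord_recl big_ord0 addr0. Qed.

Lemma weight_sumD v v' : weight_sum v -> weight_sum v' -> weight_sum (v + v').
Proof.
move=> [n [mu [w [hw ->]]]] [n' [mu' [w' [hw' ->]]]].
have [y [hy yS]] := cat_family W (fun i => (mu i, w i)) (fun i => (mu' i, w' i)).
exists (n + n')%N, (fun i => (y i).1), (fun i => (y i).2).
split; first by move=> i; case: (hy i) => -[j ->]; [exact: hw|exact: hw'].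
exact/esym/(yS snd).
Qed.

Lemma weight_sum_big (I : Type) (r : seq I) (F : I -> W) :
  (forall i, weight_sum (F i)) -> weight_sum (\sum_(i <- r) F i).
Proof.
move=> hF; elim/big_rec: _ => [|i v _ hv]; last exact: weight_sumD.
by apply: (@weight_sum_weight 0); exact: weight0.
Qed.

End Diagonalizable.

Section Quotient.
Variables (K : fieldType) (D V : lie_module (sl2 K)) (q : D -> V).
Hypotheses (hq : is_hom q) (q_surj : forall v, exists d, q d = v).

(** Projectivity applies to surjections within O, so V_lambda, the target, must be placed there; it
    is a quotient of the model. *)
Lemma quotient_in_O : in_category_O D -> in_category_O V.
Proof.
have [lq hqA] := hq; move=> [[s hs] nD dD]; split.
- exists [seq q d | d <- s] => N [[N0 NL] NA] hN.
  have : [set d | N (q d)] = setT.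
    apply: hs; last by move=> d ds; apply: hN; apply: map_f.
    split; first split => /=.
    + by rewrite (linear_map0 lq).
    + by move=> a x y /= hx hy; rewrite lq; apply: NL.
    + by move=> A x /= hx; rewrite hqA; apply: NA.
  move=> E; apply/seteqP; split=> // v _; have [d <-] := q_surj v.
  by have : [set d | N (q d)] d by rewrite E.
- move=> v; have [d <-] := q_surj v; have [n hn] := nD d; exists n.
  have -> : iter n (act (sl2_e K)) (q d) = q (iter n (act (sl2_e K)) d).
    by elim: n {hn} => //= n ->; rewrite hqA.
  by rewrite hn (linear_map0 lq).
- move=> v; have [d <-] := q_surj v; have [n [mu [w [hw ->]]]] := dD d.
  exists n, mu, (q \o w); split; last by rewrite (hom_sum lq).
  by move=> i; rewrite /weight_space /= -hqA hw (homZ lq).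
Qed.

End Quotient.

Section PolynomialModel.
Variables (K : numFieldType) (m : nat).

(** The Verma module of highest weight c on polynomials: 'X^i stands for f^i of the highest weight
    vector, and f is multiplication by 'X. *)
Definition verma_e (c : K) (p : {poly K}) : {poly K} := c%:P * p^`() - 'X * p^`()^`().
Definition verma_h (c : K) (p : {poly K}) : {poly K} := c%:P * p - ('X * p^`()) *+ 2.

Definition low_wt : K := - (m%:R + 1).
Definition high_wt : K := m%:R - 1.
(* The singular vector ['X^m] of the Verma module of highest weight [m - 1] is the
   highest weight vector of the other factor; [link] glues the two factors. *)
Definition link : {poly K} := ('X^m)^`().

(** [link] is a multiple of 'X^(m-1), of weight [low_wt] + 2, as the image under e of a vector of
    weight [low_wt] must be. *)
Lemma link_weight : 'X * link^`() = high_wt%:P * link.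
Proof.
rewrite /link /high_wt !derivXn; case: m => [|n]; first by rewrite mulr0n deriv0 !mulr0.
rewrite derivMn derivXn /= polyCB -natr1 polyCD addrK polyC_natr.
case: n => [|n] /=; first by rewrite mulr0n mul0rn mulr0 mul0r.
by rewrite mulr_natl !mulrnAr -exprS mulrnAC.
Qed.

(** The pairs (0, q) form a Verma submodule; the first component gives the Verma quotient, which
    maps onto V_lambda. *)
Definition big_act (A : sl2 K) (d : {poly K} * {poly K}) : {poly K} * {poly K} :=
  ((A 0 1)%:P * verma_e low_wt d.1 + (A 0 0)%:P * verma_h low_wt d.1 + (A 1 0)%:P * ('X * d.1),
   (A 0 1)%:P * (verma_e high_wt d.2 + link * d.1) + (A 0 0)%:P * verma_h high_wt d.2
     + (A 1 0)%:P * ('X * d.2)).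

Let drv := (derivD, derivB, derivM, derivC, derivX, derivN, derivZ, derivMn).

Lemma big_act_linearl d : linear (big_act^~ d).
Proof.
move=> a A B; rewrite /big_act !mxE /=.
by congr pair; rewrite /= !polyCD !polyCM -mul_polyC; ring.
Qed.

Lemma big_act_linearr A : linear (big_act A).
Proof.
move=> a d d'; rewrite /big_act /verma_e /verma_h /=.
by congr pair; rewrite /= !drv -!mul_polyC; ring.
Qed.

Lemma big_act_bracket A B d : big_act (bracket A B) d =
  big_act A (big_act B d) - big_act B (big_act A d).
Proof.
have [D01 D00 D10] := sl2_bracketE A B.
rewrite {1}/big_act D01 D00 D10 !polyCM !polyCB !polyCM.
case: d => p q; congr pair.
  by rewrite /= /verma_e /verma_h /= !drv; ring.
apply/eqP; rewrite -subr_eq0; apply/eqP.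
(* The defect in the second component is a multiple of the identity that expresses the weight of
   [link]. *)
transitivity (((A 0 0)%:P * (B 0 1)%:P - (A 0 1)%:P * (B 0 0)%:P) * 2 * p *
   ('X * link^`() - high_wt%:P * link)); last by rewrite link_weight subrr mulr0.
rewrite /= /verma_e /verma_h /= !drv.
have -> : low_wt%:P = - high_wt%:P - 2 :> {poly K}.
  by rewrite /low_wt /high_wt -polyCN -polyC_natr -polyCB; congr (_%:P); ring.
ring.
Qed.

Definition big_module : lie_module (sl2 K) :=
  @LieModule K (sl2 K) ({poly K} * {poly K})%type big_act
    big_act_linearl big_act_linearr big_act_bracket.

Lemma big_e (d : {poly K} * {poly K}) : big_act (sl2_e K) d = (verma_e low_wt d.1, verma_e high_wt d.2 + link * d.1).
Proof. by rewrite /big_act !mxE /= !mul0r !addr0 !mul1r. Qed.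
Lemma big_h (d : {poly K} * {poly K}) : big_act (sl2_h K) d = (verma_h low_wt d.1, verma_h high_wt d.2).
Proof. by rewrite /big_act !mxE /= !mul0r !addr0 !add0r !mul1r. Qed.
Lemma big_f (d : {poly K} * {poly K}) : big_act (sl2_f K) d = ('X * d.1, 'X * d.2).
Proof. by rewrite /big_act !mxE /= !mul0r !add0r !mul1r. Qed.

Lemma verma_e_Xn (c : K) i : verma_e c 'X^i = (i%:R * (c - i%:R + 1)) *: 'X^(i.-1).
Proof.
rewrite /verma_e derivXn; case: i => [|i] /=.
  by rewrite mulr0n deriv0 !mulr0 mul0r scale0r subr0.
case: i => [|i].
  by rewrite expr0 mulr1n derivC mulr0 subr0 mulr1 mul1r subrK alg_polyC.
rewrite derivMn derivXn /= !mulrnAr -exprS mul_polyC.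
have E (k : nat) : 'X^(i.+1) *+ k = k%:R *: 'X^(i.+1) :> {poly K} by rewrite scaler_nat.
rewrite E !scalerMnl -scalerBl; congr (_ *: _).
by rewrite -[c *+ _]mulr_natr -[i.+1%:R *+ _]mulr_natr -[i.+2%:R]natr1 -[i.+1%:R]natr1; ring.
Qed.

Lemma verma_h_Xn (c : K) i : verma_h c 'X^i = (c - 2 * i%:R) *: 'X^i.
Proof.
rewrite /verma_h derivXn -mul_polyC polyCB polyCM !polyC_natr; case: i => [|i] /=.
  by rewrite ?mulr0n !mulr0 mul0rn !subr0.
by rewrite mulrnAr -exprS -[_ *+ i.+1]mulr_natr; ring.
Qed.

Lemma verma_e_lin (c : K) : linear (verma_e c).
Proof. by move=> a p p'; rewrite /verma_e !drv -!mul_polyC; ring. Qed.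
Lemma verma_h_lin (c : K) : linear (verma_h c).
Proof. by move=> a p p'; rewrite /verma_h !drv -!mul_polyC; ring. Qed.

Lemma verma_e_nilpotent (c : K) p : exists n, iter n (verma_e c) p = 0.
Proof.
suff H n : forall p : {poly K}, (size p <= n)%N -> iter n (verma_e c) p = 0 by exists (size p); exact: H.
elim: n => [|n IH] r; first by rewrite leqn0 size_poly_eq0 => /eqP.
move=> rn; rewrite iterSr; apply: IH; rewrite /verma_e.
have d1 (s : {poly K}) k : (size s <= k.+1)%N -> (size s^`() <= k)%N.
  case: (eqVneq s 0) => [-> _|s0 sk]; first by rewrite deriv0 size_poly0.
  by rewrite -ltnS; apply: leq_trans (lt_size_deriv s0) sk.
have s1 := d1 _ _ rn.
rewrite (leq_trans (size_polyD _ _)) // geq_max size_polyN; apply/andP; split.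
  by rewrite mul_polyC (leq_trans (size_scale_leq _ _)).
case: n {rn} s1 => [|n] s1.
  by move: s1; rewrite leqn0 size_poly_eq0 => /eqP ->; rewrite deriv0 mulr0 size_poly0.
rewrite mulrC; case: (eqVneq (r^`()^`()) 0) => [->|r0]; first by rewrite mul0r size_poly0.
by rewrite size_mulX // ltnS; exact: d1.
Qed.

Lemma big_e_nilpotent : locally_e_nilpotent big_module.
Proof.
case=> p q; have [n hn] := verma_e_nilpotent low_wt p.
have E1 k d : (iter k (big_act (sl2_e K)) d).1 = iter k (verma_e low_wt) d.1.
  by elim: k => // k IH; rewrite !iterS big_e /= IH.
have E2 k r : iter k (big_act (sl2_e K)) (0, r) = (0, iter k (verma_e high_wt) r).
  elim: k => // k IH; rewrite !iterS IH big_e /= mulr0 addr0.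
  by rewrite (linear_map0 (@verma_e_lin _)).
(* After n steps the first component is 0, and the remaining nilpotency takes place in the Verma
   submodule. *)
set r := (iter n (big_act (sl2_e K)) (p, q)).2.
have [n' hn'] := verma_e_nilpotent high_wt r.
exists (n' + n)%N; rewrite iterD.
have -> : iter n (act (sl2_e K)) ((p, q) : big_module) = (0, r).
  by rewrite [LHS]surjective_pairing /r; congr pair; rewrite -hn -(E1 n (p, q)).
by rewrite [LHS](E2 n' r) hn'.
Qed.

Lemma big_diagonalizable : h_diagonalizable big_module.
Proof.
have zE : verma_h low_wt 0 = 0 by rewrite (linear_map0 (@verma_h_lin _)).
have zE' : verma_h high_wt 0 = 0 by rewrite (linear_map0 (@verma_h_lin _)).
case=> p q.
have S1 : weight_sum ((p, 0) : big_module).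
  have -> : ((p, 0) : big_module) = \sum_(i < size p) ((p`_i *: 'X^i, 0) : big_module).
    rewrite [RHS]surjective_pairing; congr pair.
      by rewrite (big_morph fst (fun _ _ => erefl) erefl) -poly_def coefK.
    by rewrite (big_morph snd (fun _ _ => erefl) erefl) big1.
  apply: weight_sum_big => i; apply: (@weight_sum_weight _ _ (low_wt - 2 * i%:R)).
  rewrite /weight_space /= big_h /= zE' (homZ (@verma_h_lin _)) verma_h_Xn.
  by congr pair; rewrite /= ?scaler0 // !scalerA mulrC.
have S2 : weight_sum ((0, q) : big_module).
  have -> : ((0, q) : big_module) = \sum_(i < size q) ((0, q`_i *: 'X^i) : big_module).
    rewrite [RHS]surjective_pairing; congr pair.
      by rewrite (big_morph fst (fun _ _ => erefl) erefl) big1.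
    by rewrite (big_morph snd (fun _ _ => erefl) erefl) -poly_def coefK.
  apply: weight_sum_big => i; apply: (@weight_sum_weight _ _ (high_wt - 2 * i%:R)).
  rewrite /weight_space /= big_h /= zE (homZ (@verma_h_lin _)) verma_h_Xn.
  by congr pair; rewrite /= ?scaler0 // !scalerA mulrC.
have := weight_sumD S1 S2; congr (weight_sum _).
by congr pair; rewrite /= ?addr0 ?add0r.
Qed.

Lemma big_finitely_generated : finitely_generated big_module.
Proof.
exists [:: ((1, 0) : big_module); ((0, 1) : big_module)] => N [[N0 NL] NA] hN.
have ND (x y : big_module) : N x -> N y -> N (x + y).
  by move=> hx hy; rewrite -[x]scale1r; exact: NL.
have NZ a (x : big_module) : N x -> N (a *: x).
  by move=> hx; rewrite -[_ *: _]addr0; exact: NL.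
have gen (d : big_module) : N d -> forall p : {poly K}, N ((p * d.1, p * d.2) : big_module).
  move=> Nd; elim/poly_ind => [|p c IH]; first by rewrite !mul0r.
  have -> : (((p * 'X + c%:P) * d.1, (p * 'X + c%:P) * d.2) : big_module) =
     act (sl2_f K) ((p * d.1, p * d.2) : big_module) + c *: d.
    rewrite [act _ _]big_f; congr pair; rewrite /= -mul_polyC; ring.
  by apply: ND; [exact: NA|exact: NZ].
apply/seteqP; split=> // -[p q] _.
have -> : ((p, q) : big_module) = (p * 1, p * 0) + (q * 0, q * 1).
  by congr pair; rewrite /= !mulr1 mulr0 ?addr0 ?add0r.
by apply: ND; [apply: (gen (1, 0))|apply: (gen (0, 1))]; apply: hN; rewrite !inE eqxx ?orbT.
Qed.

Lemma big_in_O : in_category_O big_module.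
Proof. by split; [exact: big_finitely_generated|exact: big_e_nilpotent|exact: big_diagonalizable]. Qed.

Lemma coef_X_deriv (r : {poly K}) i : ('X * r^`())`_i = i%:R * r`_i.
Proof.
by rewrite coefXM coef_deriv; case: i => [|i] /=; rewrite ?mul0r // mulr_natl.
Qed.

Lemma coef_verma_h (c : K) r i : (verma_h c r)`_i = (c - 2 * i%:R) * r`_i.
Proof. by rewrite /verma_h coefB coefCM coefMn coef_X_deriv -mulr_natr; ring. Qed.

(** In the second factor the weight [low_wt] occurs where [high_wt] - 2 i = [low_wt], that is at i =
    m. *)
Lemma low_weight_vector (d : big_module) : weight_space low_wt d ->
  exists c alpha : K, d = (c%:P, alpha *: 'X^m).
Proof.
case: d => p q; rewrite /weight_space /= big_h /= => -[hp hq].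
have eqw (c : K) r i : verma_h c r = low_wt *: r -> c - 2 * i%:R != low_wt -> r`_i = 0.
  move=> E ci; have := congr1 (fun s : {poly K} => s`_i) E; rewrite coef_verma_h coefZ => /eqP.
  by rewrite -subr_eq0 -mulrBl mulf_eq0 subr_eq0 (negbTE ci) => /eqP.
exists p`_0, q`_m; congr pair; apply/polyP => i.
  rewrite coefC; case: eqP => [-> //|/eqP i0]; apply: eqw hp _.
  by rewrite -subr_eq0 addrAC subrr add0r oppr_eq0 mulf_neq0 // pnatr_eq0.
rewrite coefZ coefXn; case: eqP => [->|/eqP im]; first by rewrite mulr1.
rewrite mulr0; apply: eqw hq _.
have -> : (high_wt - 2 * i%:R == low_wt) = (2 * i%:R == 2 * m%:R :> K).
  rewrite -subr_eq0 -[RHS]subr_eq0 -[RHS]oppr_eq0; congr (_ == 0).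
  by rewrite /high_wt /low_wt; ring.
by rewrite (inj_eq (mulfI _)) ?pnatr_eq0 // eqr_nat.
Qed.

Lemma iter_big_f a (d : big_module) : iter a (big_act (sl2_f K)) d = ('X^a * d.1, 'X^a * d.2).
Proof.
elim: a => [|a IH]; first by rewrite expr0 !mul1r -surjective_pairing.
by rewrite iterS IH big_f /= exprS !mulrA.
Qed.

(* [e] sends [(1, alpha X^m)] to [(0, link)], and descends from there down to [(0, 1)]. *)
Definition link_coef (b : nat) : K :=
  m%:R * \prod_(j < b.-1) ((m - j.+1)%N%:R * j.+1%:R).

Lemma link_coef_neq0 b : (0 < b <= m)%N -> link_coef b != 0.
Proof.
move=> /andP[b0 bm]; rewrite mulf_neq0 ?pnatr_eq0 -?lt0n ?(leq_trans b0) //.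
apply/prodf_neq0 => j _; rewrite mulf_neq0 ?pnatr_eq0 // -lt0n subn_gt0.
by apply: leq_trans bm; case: b b0 j => // b _ j; rewrite ltnS.
Qed.

(** The factor j = m - 1 contains a truncated difference equal to 0, in accordance with e killing
    (0, 1), which is reached at b = m; for m = 0 the leading factor is 0. *)
Lemma link_coef_gt b : (m < b)%N -> link_coef b = 0.
Proof.
rewrite /link_coef; case: b => // b; rewrite ltnS /= => mb.
have [m0|m0] := posnP m; first by rewrite {1}m0 mul0r.
have h : (m.-1 < b)%N by rewrite prednK.
by rewrite (bigD1 (Ordinal h)) //= prednK // subnn !mul0r mulr0.
Qed.

Lemma iter_big_e b alpha : iter b.+1 (big_act (sl2_e K)) (1, alpha *: 'X^m) =
  (0, link_coef b.+1 *: 'X^(m - b.+1)).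
Proof.
elim: b => [|b IH].
  rewrite /= big_e /= /link_coef big_ord0 mulr1 mulr1; congr pair.
    by rewrite /verma_e derivC deriv0 !mulr0 subr0.
  rewrite (homZ (@verma_e_lin _)) verma_e_Xn /high_wt.
  have -> : m%:R - 1 - m%:R + 1 = 0 :> K by ring.
  by rewrite mulr0 scale0r scaler0 add0r /link derivXn scaler_nat subn1.
rewrite iterS IH big_e /=; congr pair; first by rewrite (linear_map0 (@verma_e_lin _)).
rewrite mulr0 addr0 (homZ (@verma_e_lin _)) verma_e_Xn scalerA -subnS; congr (_ *: _).
have [bm|bm] := leqP b.+1 m; last first.
  by rewrite !link_coef_gt ?mul0r // ltnW.
rewrite /link_coef /= big_ord_recr /= -mulrA; congr (_ * (_ * (_ * _))).
by rewrite /high_wt natrB //; ring.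
Qed.

End PolynomialModel.

(** * The universal map from a Verma module *)

Section VermaMap.
Variables (K : numFieldType) (V : lie_module (sl2 K)) (v0 : V) (mu : K).
Hypotheses (ev0 : act (sl2_e K) v0 = 0) (hv0 : weight_space mu v0).
Local Notation e := (@act K (sl2 K) V (sl2_e K)).
Local Notation f := (@act K (sl2 K) V (sl2_f K)).

Definition verma_map (p : {poly K}) : V := \sum_(i < size p) p`_i *: iter i f v0.

Lemma verma_mapE n (p : {poly K}) : (size p <= n)%N ->
  verma_map p = \sum_(i < n) p`_i *: iter i f v0.
Proof.
move=> pn; rewrite /verma_map (big_ord_widen n (fun i => p`_i *: iter i f v0) pn) big_mkcond.
apply: eq_bigr => i _; case: ifPn => //; rewrite -leqNgt => h.
by rewrite nth_default // scale0r.
Qed.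

Lemma verma_map_lin : linear verma_map.
Proof.
move=> a p q; pose n := maxn (size p) (size q).
have hp : (size p <= n)%N by rewrite leq_maxl.
have hq : (size q <= n)%N by rewrite leq_maxr.
have hpq : (size ((a *: p + q)%R : {poly K}) <= n)%N.
  rewrite (leq_trans (size_polyD _ _)) // geq_max hq andbT.
  exact: leq_trans (size_scale_leq _ _) hp.
rewrite (verma_mapE hp) (verma_mapE hq) (verma_mapE hpq) scaler_sumr -big_split /=.
by apply: eq_bigr => i _; rewrite coefD coefZ scalerDl scalerA.
Qed.

Lemma verma_map_Xn i : verma_map 'X^i = iter i f v0.
Proof.
rewrite /verma_map size_polyXn big_ord_recr /= coefXn eqxx scale1r big1 ?add0r // => j _.
by rewrite coefXn ltn_eqF ?scale0r.
Qed.

Lemma poly_lin_ext (U : lmodType K) (F G : {poly K} -> U) : linear F -> linear G ->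
  (forall i, F 'X^i = G 'X^i) -> F =1 G.
Proof.
move=> lF lG FG p; rewrite -[p]coefK poly_def (hom_sum lF) (hom_sum lG).
by apply: eq_bigr => i _; rewrite (homZ lF) (homZ lG) FG.
Qed.

Let comp_lin (U1 U2 U3 : lmodType K) (F : U1 -> U2) (G : U2 -> U3) :
  linear F -> linear G -> linear (G \o F).
Proof. by move=> lF lG a x y /=; rewrite lF lG. Qed.

Lemma iter_f_e i : e (iter i f v0) = (i%:R * (mu - i%:R + 1)) *: iter i.-1 f v0.
Proof.
elim: i => [|i IH]; first by rewrite /= ev0 mul0r scale0r.
rewrite iterS act_ef IH actZr (weight_iter_f i hv0) /=.
have -> : (i%:R * (mu - i%:R + 1)) *: f (iter i.-1 f v0) = (i%:R * (mu - i%:R + 1)) *: iter i f v0.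
  by case: i {IH} => [|i] //; rewrite !mul0r !scale0r.
by rewrite -scalerDl; congr (_ *: _); rewrite -natr1; ring.
Qed.

Lemma verma_map_e p : verma_map (verma_e mu p) = e (verma_map p).
Proof.
apply: (poly_lin_ext (F := verma_map \o verma_e mu) (G := e \o verma_map)) => [||i].
- exact: comp_lin (@verma_e_lin _ _) verma_map_lin.
- exact: comp_lin verma_map_lin (act_linearr _).
- by rewrite /= verma_e_Xn (homZ verma_map_lin) !verma_map_Xn iter_f_e.
Qed.

Lemma verma_map_h p : verma_map (verma_h mu p) = act (sl2_h K) (verma_map p).
Proof.
apply: (poly_lin_ext (F := verma_map \o verma_h mu) (G := act (sl2_h K) \o verma_map)) => [||i].
- exact: comp_lin (@verma_h_lin _ _) verma_map_lin.
- exact: comp_lin verma_map_lin (act_linearr _).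
- by rewrite /= verma_h_Xn (homZ verma_map_lin) !verma_map_Xn (weight_iter_f i hv0).
Qed.

Lemma verma_map_f p : verma_map ('X * p) = f (verma_map p).
Proof.
apply: (poly_lin_ext (F := verma_map \o *%R 'X) (G := f \o verma_map)) => [||i].
- by apply: comp_lin verma_map_lin => a x y; rewrite mulrDr -scalerAr.
- exact: comp_lin verma_map_lin (act_linearr _).
- by rewrite /= -exprS !verma_map_Xn.
Qed.

End VermaMap.

(** * Matrix elements found by lifting the cover to the model *)

Section Lift.
Variables (K : numFieldType) (m : nat) (V P : lie_module (sl2 K)).
Let lambda : int := - m.+1%:Z.
Hypothesis hV : highest_weight_irreducible lambda%:~R V.
Hypothesis hP : is_projective_cover P V.

Let low : lambda%:~R = low_wt K m.
Proof. by rewrite /lambda /low_wt natr1 rmorphN. Qed.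

(** Coefficients of the matrix element between (1, alpha 'X^m) and the coefficient of 'X^m in the
    second component: for 0 < b <= m, f^a e^b yields [link_coef K m b] times 'X^(m - b + a), which
    is seen only if a = b, and for b = 0 it yields alpha 'X^(m + a), seen only if a = 0. *)
Definition link_function (alpha : K) : mindex -> K^o := fun i =>
  if (i.1.2 == lambda + (i.1.1%:Z *+ 2)) && (i.2 == i.1.1) then
    if i.1.1 is 0%N then alpha else link_coef K m i.1.1
  else 0.

Lemma cover_coefficients : exists alpha : K,
  matrix_elements P (coef_functional (@delta K (0%N, lambda, 0%N))) /\
  matrix_elements P (coef_functional (link_function alpha)).
Proof.
have [irrV [v0 [v0n ev0 hv0]]] := hV.
have [[inOP proj] _ [p [hp p_surj p_ess]]] := hP.
have [fgP nilP diagP] := inOP.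
pose D := big_module K m.
pose q (d : D) : V := verma_map v0 d.1.
have lq : linear q by move=> a d d'; rewrite /q /= verma_map_lin.
have hv0' : weight_space (low_wt K m) v0 by rewrite -low.
have hq : is_hom q.
  split=> // A d; rewrite (act_sl2 A d) (act_sl2 A (q d)) !(homD lq) !(homZ lq).
  congr (_ *: _ + _ *: _ + _ *: _).
  - by rewrite /q [act _ _](big_e m d) /= (verma_map_e ev0 hv0').
  - by rewrite /q [act _ _](big_h m d) /= (verma_map_h hv0').
  - by rewrite /q [act _ _](big_f m d) /= verma_map_f.
have q1 c r : q ((c%:P, r) : D) = c *: v0.
  rewrite /q /= -[c%:P]mulr1 mul_polyC (homZ (verma_map_lin v0)).
  by have := verma_map_Xn v0 0; rewrite expr0 => ->.
have q_surj v : exists d, q d = v.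
  have [_ irr] := irrV.
  have [E|E] := irr _ (image_submodule hq (full_submodule D)).
    have : (q @` setT) v0 by exists ((1%:P, 0) : D) => //; rewrite q1 scale1r.
    by rewrite E /= => /eqP; rewrite (negbTE v0n).
  have : (q @` setT) v by rewrite E.
  by case=> d _ <-; exists d.
have inOV := quotient_in_O hq q_surj (big_in_O K m).
have [g [lg hg] qg] := proj D V q p (big_in_O K m) inOV hq q_surj hp.
have [x hx px] := highest_vector_lift hv0 hp p_surj diagP.
have hgx : weight_space (low_wt K m) (g x).
  have E : act (sl2_h K) (g x) = low_wt K m *: g x by rewrite -hg hx (homZ lg) low.
  exact: E.
have [c [alpha gx]] := low_weight_vector hgx.
(* The first coordinate is fixed by q (g x) = v0; q does not see the second one, so alpha remains
   unknown. *)
have c1 : c = 1.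
  have := qg x; rewrite gx q1 px => /eqP; rewrite -subr_eq0 -{2}[v0]scale1r -scalerBl.
  by rewrite scaler_eq0 (negbTE v0n) orbF subr_eq0 => /eqP.
have iter_g a b : g (iter a (act (sl2_f K)) (iter b (act (sl2_e K)) x)) =
    iter a (big_act m (sl2_f K)) (iter b (big_act m (sl2_e K)) (1, alpha *: 'X^m)).
  have -> : (1, alpha *: 'X^m) = g x by rewrite gx c1.
  elim: a => [|a IH]; last by rewrite !iterS -IH hg.
  by elim: b => [|b IH] //; rewrite !iterS -[iter b _ _ in RHS]IH hg.
(* A form on the model that vanishes outside the weight [low_wt] pulls back to a form with the same
   property, hence to an element of the restricted dual. *)
have pull (psi : D -> K) : linear (psi : D -> K^o) ->
    (forall nu (d : D), weight_space nu d -> nu != low_wt K m -> psi d = 0) ->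
    ((fun y => psi (g y)) : P -> K^o) \in @restricted K P.
  move=> lpsi wpsi; apply/asboolP; split; first by move=> a y y'; rewrite lg lpsi.
  exists [:: low_wt K m] => nu y; rewrite inE => nl hy.
  have E : act (sl2_h K) (g y) = nu *: g y by rewrite -hg hy (homZ lg).
  exact: wpsi E nl.
have w_low nu (d : D) : weight_space nu d -> nu != low_wt K m -> d.1`_0 = 0 /\ d.2`_m = 0.
  case: d => r s; rewrite /weight_space /= big_h /= => -[hr hs] nl; split; apply/eqP.
    have := congr1 (fun s : {poly K} => s`_0) hr; rewrite coef_verma_h coefZ mulr0 subr0 => /eqP.
    by rewrite -subr_eq0 -mulrBl mulf_eq0 subr_eq0 eq_sym (negbTE nl).
  have := congr1 (fun s : {poly K} => s`_m) hs; rewrite coef_verma_h coefZ => /eqP.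
  have -> : high_wt K m - 2 * m%:R = low_wt K m by rewrite /high_wt /low_wt; ring.
  by rewrite -subr_eq0 -mulrBl mulf_eq0 subr_eq0 eq_sym (negbTE nl).
have h1 : linear ((fun d => d.1`_0) : D -> K^o).
  by move=> a d d'; rewrite /= coefD coefZ.
have h2 : linear ((fun d => d.2`_m) : D -> K^o).
  by move=> a d d'; rewrite /= coefD coefZ.
pose phi1 := RDual (pull _ h1 (fun nu d hd nl => (w_low nu d hd nl).1)).
pose phi2 := RDual (pull _ h2 (fun nu d hd nl => (w_low nu d hd nl).2)).
have inM (phi : restricted_dual P) u : weight_coef phi lambda x = u ->
    matrix_elements P (coef_functional u).
  move=> <-; rewrite -(matrix_element_coef nilP (has_coef_weight phi hx)).
  exists 1%N, (fun=> 1), (fun=> matrix_element x (phi : star P)).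
  by split; [move=> _; exists x, phi|rewrite big_ord_recl big_ord0 addr0 scale1r].
exists alpha; split.
- apply: (inM phi1); apply/funext => -[[b k] a]; rewrite /weight_coef /= iter_g iter_big_f.
  rewrite /delta !xpair_eqE; case: b => [|b].
    rewrite mul0rn addr0 /= mulr1 coefXn eq_sym; case: eqP => //= _.
    by rewrite eq_sym.
  by rewrite iter_big_e /= mulr0 coef0 if_same.
- apply: (inM phi2); apply/funext => -[[b k] a]; rewrite /weight_coef /link_function /= iter_g iter_big_f.
  case: eqP => //= _; case: b => [|b].
    rewrite /= -scalerAr -exprD coefZ coefXn; case: a => [|a]; first by rewrite add0n eqxx mulr1.
    by rewrite ltn_eqF ?mulr0 // ltnS leq_addl.
  rewrite iter_big_e /= -scalerAr -exprD coefZ coefXn.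
  have [bm|bm] := leqP b.+1 m; last by rewrite link_coef_gt // mul0r if_same.
  have -> : (m == a + (m - b.+1))%N = (a == b.+1) by apply/eqP/eqP; lia.
  by case: eqP; rewrite ?mulr1 ?mulr0.
Qed.

End Lift.

(** * Generation of all monomials by the two actions *)

Section Generation.
Variables (K : numFieldType) (S : set (uea (sl2 K) -> K^o)).
Hypothesis S_sub : is_submodule S.
Hypothesis S_act : forall A phi, S phi -> S (uea_dual_act A phi).
Hypothesis S_gen : forall m, exists alpha : K,
  S (coef_functional (@delta K (0%N, - m.+1%:Z, 0%N))) /\
  S (coef_functional (link_function m alpha)).
Implicit Types (u v : mindex -> K^o).

Let T u := finsupp u /\ S (coef_functional u).
Let d i (k : int) j := @delta K (i, k, j).

Let T0 : T 0.
Proof.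
split; first exact: finsupp0.
have := @coef_functional_lin K (-1) 0 0 (finsupp0 K) (finsupp0 K).
by rewrite scaler0 addr0 scaleN1r addNr => ->; case: S_sub.
Qed.
Let TL a u v : T u -> T v -> T (a *: u + v).
Proof.
move=> [fu Su] [fv Sv]; split; first exact: finsupp_lin.
by rewrite coef_functional_lin //; case: S_sub => _; apply.
Qed.
Let TD u v : T u -> T v -> T (u + v).
Proof. by move=> hu hv; rewrite -[u]scale1r; exact: TL. Qed.
Let TZ a u : T u -> T (a *: u).
Proof. by move=> hu; rewrite -[_ *: _]addr0; exact: TL. Qed.
Let TB u v : T u -> T v -> T (u - v).
Proof. by move=> hu hv; rewrite -scaleN1r addrC; exact: TL. Qed.
Let TZI a u : a != 0 -> T (a *: u) -> T u.
Proof. by move=> a0 /(TZ a^-1); rewrite scalerA mulVf // scale1r. Qed.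

Let coef_act0 u : coef_act 0 u = 0.
Proof. exact: linear_map0 (coef_act_linearl u). Qed.

Let T_act A u : T u -> T (coef_act A u).
Proof.
move=> [fu Su]; split; first exact: finsupp_act.
have := coef_functional_act (A, 0) fu; rewrite /= /coef_act_r coef_act0 addr0 => ->.
exact: S_act.
Qed.
Let T_act_r A u : T u -> T (coef_act_r A u).
Proof.
move=> [fu Su]; split; first exact: finsupp_act_r.
have := coef_functional_act (0, A) fu; rewrite /= coef_act0 add0r => ->.
exact: S_act.
Qed.

Let f_delta i k j : coef_act (sl2_f K) (d i k j) =
  (i.+1%:R * (k%:~R - i%:R)) *: d i.+1 k j + (if j is j'.+1 then d i (k - 2) j' else 0).
Proof. by rewrite coef_act_delta !mxE /= !mul0r !scale0r !add0r scale1r. Qed.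
Let swap_delta i k j : swap_xy (d i k j) = d j k i.
Proof.
apply/funext => -[[a c] b]; rewrite /swap_xy /d /delta !xpair_eqE /=.
by rewrite andbC andbA andbAC.
Qed.
Let swapD u v : swap_xy (u + v) = swap_xy u + swap_xy v. Proof. by []. Qed.
Let swapZ a u : swap_xy (a *: u) = a *: swap_xy u. Proof. by []. Qed.
Let f_delta_r i k j : coef_act_r (sl2_f K) (d i k j) =
  (j.+1%:R * (k%:~R - j%:R)) *: d i k j.+1 + (if i is i'.+1 then d i' (k - 2) j else 0).
Proof.
rewrite /coef_act_r swap_delta f_delta swapD swapZ swap_delta; congr (_ + _).
by case: i => [|i] //; rewrite swap_delta.
Qed.

Let coef_neq0 (k : int) (i : nat) : k != i%:Z -> i.+1%:R * (k%:~R - i%:R) != 0 :> K.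
Proof.
by move=> ki; rewrite mulf_neq0 ?pnatr_eq0 // subr_eq0 -[i%:R]/(i%:Z%:~R) eqr_int.
Qed.

(** [f] raises i with a factor that vanishes only at k = i; its other term, with k - 2 and the
    preceding j, is subtracted. *)
Let up_l i k j : k != i%:Z -> (forall j', j = j'.+1 -> T (d i (k - 2) j')) ->
  T (d i k j) -> T (d i.+1 k j).
Proof.
move=> ki hj /(T_act (sl2_f K)); rewrite f_delta => h.
apply: (TZI (coef_neq0 ki)); case: j hj h => [|j] hj h; first by rewrite addr0 in h.
by rewrite -[_ *: _](addrK (d i (k - 2) j)); apply: TB h (hj _ erefl).
Qed.

Let up_r i k j : k != j%:Z -> (forall i', i = i'.+1 -> T (d i' (k - 2) j)) ->
  T (d i k j) -> T (d i k j.+1).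
Proof.
move=> kj hi /(T_act_r (sl2_f K)); rewrite f_delta_r => h.
apply: (TZI (coef_neq0 kj)); case: i hi h => [|i] hi h; first by rewrite addr0 in h.
by rewrite -[_ *: _](addrK (d i (k - 2) j)); apply: TB h (hi _ erefl).
Qed.

(** No factor vanishes for negative k. The induction on j is the outer one because raising i
    produces a correction with j lowered by 1. *)
Let T_neg j : forall (k : int) i, k < 0 -> T (d i k j).
Proof.
have ne (k : int) (i : nat) : k < 0 -> k != i%:Z by lia.
elim: j => [|j IH] k i k0; last first.
  elim: i => [|i IHi]; first by apply: up_r; [exact: ne| |exact: IH].
  by apply: up_l IHi; [exact: ne|move=> j' [<-]; apply: IH; lia].
elim: i => [|i IHi]; last by apply: up_l IHi; [exact: ne|].
have -> : k = - (`|k|.-1).+1%:Z by lia.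
have [alpha [h _]] := S_gen `|k|.-1.
by split; first exact: finsupp_delta.
Qed.

(** The step is blocked at n, where the factor of [f] vanishes; the second seed restarts the chain
    beyond it. *)
Let two_seeds (Q : nat -> Prop) n : Q 0%N -> Q n.+1 ->
  (forall j, (j != n)%N -> Q j -> Q j.+1) -> forall j, Q j.
Proof.
move=> Q0 Qn step; elim=> [//|j IH].
by have [->|jn] := eqVneq j n; [|exact: step].
Qed.

Let link_functionE m alpha : link_function m alpha =
  \sum_(b < m.+1) (if b == 0%N :> nat then alpha else link_coef K m b) *:
     d b (- m.+1%:Z + (b%:Z *+ 2)) b.
Proof.
apply/funext => -[[b k] a]; rewrite fct_sumE /link_function /=.
under eq_bigr => c _ do rewrite fctE /d /delta !xpair_eqE.
have [bm|bm] := leqP b m; last first.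
  rewrite big1 => [|c _]; last first.
    have cb : (c < b)%N := leq_trans (ltn_ord c) bm.
    by rewrite (gtn_eqF cb) scaler0.
  case: ifP => // _; case: b bm => // b bm.
  by rewrite link_coef_gt.
rewrite (bigD1 (inord b)) //= inordK ?ltnS // big1 ?addr0 => [|c cb].
  rewrite eqxx /=; case: ifP => _; last by rewrite scaler0.
  by rewrite /GRing.scale /= mulr1; case: b {bm}.
have -> : (b == c :> nat) = false.
  apply: contraNF cb => /eqP bc; apply/eqP/val_inj; rewrite /= inordK ?ltnS //.
by rewrite scaler0.
Qed.

Let iter_e_coef n u i k j : iter n (coef_act (sl2_e K)) u (i, k, j) = u ((i + n)%N, k, j).
Proof.
elim: n i => [|n IH] i; first by rewrite addn0.
by rewrite iterS coef_actE !mxE /= !mul0r !addr0 mul1r IH addSnnS.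
Qed.

Let iter_e_coef_r n u i k j : iter n (coef_act_r (sl2_e K)) u (i, k, j) = u (i, k, (j + n)%N).
Proof.
have -> : iter n (coef_act_r (sl2_e K)) u = swap_xy (iter n (coef_act (sl2_e K)) (swap_xy u)).
  by elim: n => [|n IH]; [apply/funext => -[[]]|rewrite iterS IH].
by rewrite /swap_xy iter_e_coef.
Qed.

Let T_iter (F : (mindex -> K^o) -> mindex -> K^o) n u : (forall v, T v -> T (F v)) ->
  T u -> T (iter n F u).
Proof. by move=> hF hu; elim: n => //= n; exact: hF. Qed.

Let T_nonneg n : forall i j, T (d i n%:Z j).
Proof.
elim/ltn_ind: n => n IHn.
have IH (k : int) i j : k < n%:Z -> T (d i k j).
  move=> kn; have [k0|k0] := ltP k 0; first exact: T_neg.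
  have -> : k = `|k|%N%:Z by lia.
  by apply: IHn; lia.
(* With m = n + 1 the top term b = n + 1 of the link function has k = - (n + 2) + 2 (n + 1) = n. *)
have [alpha [_ Su]] := S_gen n.+1; set u := link_function n.+1 alpha in Su.
have lc : link_coef K n.+1 n.+1 != 0 by apply: link_coef_neq0; rewrite leqnn.
have Tu : T u.
  split=> //; rewrite /u link_functionE; elim/big_rec: _ => [|b v _ hv]; first exact: finsupp0.
  by apply: finsupp_lin hv; exact: finsupp_delta.
(* Applying e^(n+1) on one side annihilates every term except the top one and brings its index on
   that side to 0; applying it on both sides gives the seed (0, n, 0). *)
have T0m : T (d 0 n%:Z n.+1).
  apply: (TZI lc); have := T_iter n.+1 (@T_act (sl2_e K)) Tu; congr T.
  apply/funext => -[[i k] j]; rewrite iter_e_coef /u /link_function fctE /d /delta !xpair_eqE /=.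
  case: i => [|i].
    rewrite add0n (_ : - n.+2%:Z + n.+1%:Z *+ 2 = n%:Z); last by lia.
    by case: ifP => _; rewrite ?scaler0 // /GRing.scale /= mulr1.
  by rewrite scaler0 addSn link_coef_gt ?if_same // ltnS addnS ltnS leq_addl.
have Tm0 : T (d n.+1 n%:Z 0).
  apply: (TZI lc); have := T_iter n.+1 (@T_act_r (sl2_e K)) Tu; congr T.
  apply/funext => -[[i k] j]; rewrite iter_e_coef_r /u /link_function fctE /d /delta !xpair_eqE /=.
  case: i => [|i] /=; first by rewrite addnS andbF scaler0.
  have [->|jn] := eqVneq j 0%N.
    rewrite add0n !eqSS [n == i]eq_sym andbT; case: (i =P n) => [->|_] /=; last by rewrite andbF scaler0.
    rewrite (_ : - n.+2%:Z + n.+1%:Z *+ 2 = n%:Z); last by lia.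
    by rewrite andbT; case: ifP => _; rewrite ?scaler0 // /GRing.scale /= mulr1.
  rewrite andbF scaler0; case: ifP => // /andP[_ /eqP E].
  by rewrite link_coef_gt // -E -[X in (X < _)%N]add0n ltn_add2r lt0n.
have T00 : T (d 0 n%:Z 0).
  have := T_iter n.+1 (@T_act (sl2_e K)) Tm0; congr T.
  apply/funext => -[[i k] j]; rewrite iter_e_coef /d /delta !xpair_eqE.
  by rewrite -[X in (_ == X) && _ && _]add0n eqn_add2r.
(* The terms of u below the top one have k < n, so the induction hypothesis allows them to be
   removed. *)
have Tmm : T (d n.+1 n%:Z n.+1).
  apply: (TZI lc); move: Tu; rewrite /u link_functionE big_ord_recr /=.
  rewrite (_ : - n.+2%:Z + n.+1%:Z *+ 2 = n%:Z); last by lia.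
  set w := \sum_(_ < _) _ => Tu.
  have Tw : T w.
    rewrite /w; elim/big_rec: _ => [|b v _ hv]; first exact: T0.
    by apply: TL hv; apply: IH; have := ltn_ord b; lia.
  by rewrite -[_ *: _](addKr w) addrC; apply: TB.
have ne (i : nat) : (i != n)%N -> n%:Z != i%:Z by lia.
have lt2 : n%:Z - 2 < n%:Z by lia.
(* The columns i = 0 and i = n + 1 are filled along j; they then serve as the two seeds for every j
   along i. *)
have col i0 : T (d i0 n%:Z 0) -> T (d i0 n%:Z n.+1) -> forall j, T (d i0 n%:Z j).
  move=> h0 hm; apply: (two_seeds h0 hm) => j jn hj.
  by apply: up_r hj; [exact: ne|move=> *; exact: IH].
move=> i j; move: i; apply: (@two_seeds (fun i => T (d i n%:Z j)) n).
- exact: col.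
- exact: col.
- by move=> i i_n hi; apply: up_l hi; [exact: ne|move=> *; exact: IH].
Qed.

Lemma coef_functional_generated u : finsupp u -> S (coef_functional u).
Proof.
move=> fu; suff [] : T u by [].
move: u fu; apply: finsupp_span.
- exact: T0.
- by move=> a u v; exact: TL.
- move=> [[i k] j]; have [k0|k0] := ltP k 0; first exact: T_neg.
  have -> : k = `|k|%N%:Z by lia.
  exact: T_nonneg.
Qed.

End Generation.

(** * Direct sums of spaces of matrix elements *)

Section Families.
Variables (K : fieldType) (I : choiceType).

Lemma finite_support_sub (U V : zmodType) (F : I -> U) (G : I -> V) :
  (forall i, F i = 0 -> G i = 0) -> finite_set [set i | F i != 0] -> finite_set [set i | G i != 0].
Proof. by move=> h; apply: sub_finite_set => i /=; apply: contra_neq; exact: h. Qed.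

Lemma fsum_linear (U V : lmodType K) (F : U -> V) (m : I -> U) : linear F ->
  finite_set [set i | m i != 0] ->
  F (\sum_(i \in [set: I]) m i) = \sum_(i \in [set: I]) F (m i).
Proof.
move=> lF /finite_support_seq[s us hs].
rewrite (fsbig_uniq us hs) (hom_sum lF) (fsbig_uniq us) // => i /hs ->.
exact: linear_map0.
Qed.

Lemma fsum_combination (U : lmodType K) a (m m' : I -> U) :
  finite_set [set i | m i != 0] -> finite_set [set i | m' i != 0] ->
  finite_set [set i | a *: m i + m' i != 0] /\
  \sum_(i \in [set: I]) (a *: m i + m' i) =
    a *: \sum_(i \in [set: I]) m i + \sum_(i \in [set: I]) m' i.
Proof.
move=> /finite_support_seq[s us hs] /finite_support_seq[t ut ht].
have U' := undup_uniq (s ++ t).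
have hst i : i \notin undup (s ++ t) -> m i = 0 /\ m' i = 0.
  by rewrite mem_undup mem_cat negb_or => /andP[/hs -> /ht ->].
split.
  apply: (@sub_finite_set _ _ [set` undup (s ++ t)]); last exact: finite_seq.
  move=> i /=; apply: contraNT => /hst[-> ->].
  by rewrite scaler0 addr0.
rewrite !(fsbig_uniq U') => [|i /hst[] //|i /hst[] //|i /hst[-> ->]]; last by rewrite scaler0 addr0.
by rewrite scaler_sumr -big_split.
Qed.

Lemma sum_of_subspaces_submodule (V : lmodType K) (M : I -> set V) :
  (forall i, is_submodule (M i)) -> is_submodule (sum_of_subspaces M).
Proof.
move=> hM; split.
  exists (fun=> 0); last by rewrite (@fsbig_uniq _ _ [::]) // big_nil.
  split; last by move=> i; case: (hM i).
  by rewrite (_ : [set _ | _] = set0) //; apply/seteqP; split=> i //=; rewrite eqxx.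
move=> a _ _ [m [fm Mm] ->] [m' [fm' Mm'] ->].
have [f E] := fsum_combination a fm fm'.
exists (fun i => a *: m i + m' i) => //; split=> // i.
by case: (hM i) => _; apply.
Qed.

Lemma sub_sum_of_subspaces (V : lmodType K) (M : I -> set V) i :
  (forall i, is_submodule (M i)) -> M i `<=` sum_of_subspaces M.
Proof.
move=> hM x Mx; exists (fun j => if j == i then x else 0).
  split; last by move=> j; case: eqP => [->|_] //; case: (hM j).
  apply: (@sub_finite_set _ _ [set i]); last exact: finite_set1.
  by move=> j /=; case: (j =P i) => //; rewrite eqxx.
rewrite (@fsbig_uniq _ _ [:: i]) ?big_seq1 ?eqxx // => j.
by rewrite inE => /negbTE ->.
Qed.

Lemma sum_of_subspaces_stable (V : lmodType K) (M : I -> set V) (F : V -> V) : linear F ->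
  (forall i x, M i x -> M i (F x)) ->
  forall x, sum_of_subspaces M x -> sum_of_subspaces M (F x).
Proof.
move=> lF hF _ [m [fm Mm] ->]; exists (F \o m); last exact: fsum_linear.
split; last by move=> i; exact: hF.
by apply: finite_support_sub fm => i /= ->; exact: linear_map0.
Qed.

End Families.

Lemma lspan_submodule (K : fieldType) (V : lmodType K) (A : set V) : is_submodule (lspan A).
Proof.
split; first by exists 0%N, (fun=> 0), (fun=> 0); split; [case|rewrite big_ord0].
move=> c _ _ [n [a [v [hv ->]]]] [n' [a' [v' [hv' ->]]]].
have [y [hy yS]] := cat_family V (fun i => (c * a i, v i)) (fun i => (a' i, v' i)).
exists (n + n')%N, (fun i => (y i).1), (fun i => (y i).2); split.
  by move=> i; case: (hy i) => -[j ->]; [exact: hv|exact: hv'].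
rewrite (yS (fun z => z.1 *: z.2)) scaler_sumr; congr (_ + _).
by apply: eq_bigr => i _; rewrite scalerA.
Qed.

Lemma sub_lspan (K : fieldType) (V : lmodType K) (A : set V) : A `<=` lspan A.
Proof.
move=> x Ax; exists 1%N, (fun=> 1), (fun=> x).
by split=> //; rewrite big_ord_recl big_ord0 addr0 scale1r.
Qed.

(** * The quotient by identically vanishing matrix elements *)

Section MatrixElements.
Variables (K : fieldType) (V : lie_module (sl2 K)).

Lemma matrix_element_map_lin : linear (@matrix_element_map K V).
Proof. exact: tensor_lift_linear (matrix_element_bilinear V). Qed.

Lemma matrix_elementsE : matrix_elements V = range (@matrix_element_map K V).
Proof.
have bil := @matrix_element_bilinear K V.
have pureE (v : V) (v' : star V) : matrix_element_map (pure v v') = matrix_element v v'.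
  by rewrite /matrix_element_map tensor_lift_pure.
have lin := matrix_element_map_lin.
have [M0 ML] := lspan_submodule [set phi | exists (v : V) (v' : star V), phi = matrix_element v v'].
apply/seteqP; split=> [_ [n [a [f [hf ->]]]]|_ [t _ <-]].
  elim/big_rec: _ => [|i x _ [t _ <-]]; first by exists 0 => //; exact: linear_map0 lin.
  have [v [v' ->]] := hf i; exists (a i *: pure v v' + t) => //.
  by rewrite lin pureE.
elim/(@tensor_ind K): t => [v w||s t IHs IHt|c t IHt].
- by apply: sub_lspan; exists v, w; rewrite pureE.
- by rewrite (linear_map0 lin); exact: M0.
- by rewrite (homD lin) -[X in X + _]scale1r; exact: ML.
- by rewrite (homZ lin) -[_ *: _]addr0; apply: ML.
Qed.

Lemma matrix_elements_act (A : gg K) phi :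
  matrix_elements V phi -> matrix_elements V (uea_dual_act A phi).
Proof.
rewrite matrix_elementsE => -[t _ <-]; exists (tensor_act A t) => //.
exact: matrix_element_map_hom.
Qed.

(** The injection induced on the quotient; [quotient_element_proj] shows that the chosen
    representative does not matter. *)
Definition quotient_element (q : tensor_mod_vanishing V) : uea (sl2 K) -> K^o :=
  matrix_element_map (quotient_repr q).

Lemma quotient_element_proj t :
  quotient_element (quotient_proj (vanishing_elements_submodule V).1 t) = matrix_element_map t.
Proof.
apply/eqP; rewrite -subr_eq0 -(homB matrix_element_map_lin); apply/eqP.
by apply/(quotient_proj_eq (vanishing_elements_submodule V).1); rewrite quotient_reprK.
Qed.

Lemma quotient_element_lin : linear quotient_element.
Proof.
move=> a p q; have -> : a *: p + q = quotient_proj (vanishing_elements_submodule V).1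
    (a *: quotient_repr p + quotient_repr q).
  by rewrite quotient_projD quotient_projZ !quotient_reprK.
by rewrite quotient_element_proj matrix_element_map_lin.
Qed.

Lemma quotient_element_act A q :
  quotient_element (act A q) = uea_dual_act A (quotient_element q).
Proof. by rewrite [act A q]/(quotient_proj _ _) quotient_element_proj matrix_element_map_hom. Qed.

Lemma quotient_element_inj q : quotient_element q = 0 -> q = 0.
Proof.
move=> E; rewrite -[q]quotient_reprK -[RHS](quotient_reprK (0 : tensor_mod_vanishing V)).
apply/(quotient_proj_eq (vanishing_elements_submodule V).1).
rewrite /vanishing_elements /= (homB matrix_element_map_lin) -/(quotient_element q) E.
rewrite -/(quotient_element 0) (linear_map0 quotient_element_lin); exact: subrr.
Qed.

Lemma range_quotient_element : range quotient_element = matrix_elements V.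
Proof.
rewrite matrix_elementsE; apply/seteqP; split=> [_ [q _ <-]|_ [t _ <-]].
  by exists (quotient_repr q).
by exists (quotient_proj (vanishing_elements_submodule V).1 t); rewrite ?quotient_element_proj.
Qed.

End MatrixElements.

Section DirectSumElements.
Variables (K : fieldType) (I : choiceType) (P : I -> lie_module (sl2 K)).
Local Notation M := (fun l => matrix_elements (P l)).
Local Notation DS := (direct_sum_module (fun l => tensor_mod_vanishing (P l))).

Definition direct_sum_element (d : DS) : uea (sl2 K) -> K^o :=
  \sum_(l \in [set: I]) quotient_element (d l).

Let fin (d : DS) : finite_set [set l | quotient_element (d l) != 0].
Proof.
apply: sub_finite_set (dsum_finite d) => l /=; apply: contraNneq => ->.
by rewrite (linear_map0 (@quotient_element_lin _ _)).
Qed.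

Lemma direct_sum_element_lin : linear direct_sum_element.
Proof.
move=> a d d'; rewrite /direct_sum_element -(fsum_combination a (fin d) (fin d')).2.
by apply: eq_fsbigr => l _; exact: quotient_element_lin.
Qed.

Lemma uea_dual_act_lin (A : gg K) : linear (uea_dual_act A).
Proof.
move=> a p q; apply/funext => x; rewrite /uea_dual_act !fctE.
by rewrite opprD scalerDr scalerN addrACA.
Qed.

Lemma direct_sum_element_act A d :
  direct_sum_element (act A d) = uea_dual_act A (direct_sum_element d).
Proof.
rewrite /direct_sum_element (fsum_linear (uea_dual_act_lin A) (fin d)).
by apply: eq_fsbigr => l _; exact: quotient_element_act.
Qed.

Lemma direct_sum_element_inj d : sum_is_direct M -> direct_sum_element d = 0 -> d = 0.
Proof.
move=> dir E; apply: dsumP => l; apply: quotient_element_inj.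
apply: (dir (fun l => quotient_element (d l))) => //; split; first exact: fin.
by move=> i; rewrite -range_quotient_element; exists (d i).
Qed.

Lemma range_direct_sum_element : range direct_sum_element = sum_of_subspaces M.
Proof.
apply/seteqP; split=> [_ [d _ <-]|_ [m [fm Mm] ->]].
  exists (fun l => quotient_element (d l)) => //; split; first exact: fin.
  by move=> i; rewrite -range_quotient_element; exists (d i).
(* Requiring q = 0 wherever m l = 0 keeps the support of the chosen family finite. *)
have ex l : exists q : tensor_mod_vanishing (P l),
    quotient_element q = m l /\ (m l = 0 -> q = 0).
  have := Mm l; rewrite -range_quotient_element => -[q _ qm].
  by exists q; split=> // m0; apply: quotient_element_inj; rewrite qm.
pose g l := projT1 (cid (ex l)); have hg l := projT2 (cid (ex l)).
have fg : finite_set [set l | g l != 0].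
  by apply: sub_finite_set fm => l /=; apply: contra_neq => /(hg l).2.
exists (DirectSum fg : DS) => //; rewrite /direct_sum_element.
by apply: eq_fsbigr => l _; exact: (hg l).1.
Qed.

End DirectSumElements.

(** On S the map g is f followed by the inverse of F; elsewhere its values are arbitrary, as
    [iso_on] only constrains S. *)
Lemma iso_on_inverse (K : fieldType) (L : lie_algebra K) (V U W : lmodType K)
    (aV : L -> V -> V) (aU : L -> U -> U) (aW : L -> W -> W) S T (f : V -> U) (F : W -> U) :
  iso_on aV aU S T f -> linear F -> (forall x w, F (aW x w) = aU x (F w)) ->
  (forall w, F w = 0 -> w = 0) -> range F = T ->
  exists g : V -> W, iso_on aV aW S setT g.
Proof.
move=> [[hS SA] fL fA fI fT] lF FA FI FT.
have FI' w w' : F w = F w' -> w = w'.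
  by move=> E; apply/eqP; rewrite -subr_eq0; apply/eqP/FI; rewrite (homB lF) E subrr.
have ex v : exists w, S v -> F w = f v.
  have [Sv|nSv] := pselect (S v); last by exists 0.
  have : (f @` S) (f v) by exists v.
  by rewrite fT -FT => -[w _ E]; exists w.
have [g hg] := choice ex; exists g; split=> //.
- move=> a v w Sv Sw; have [_ SL] := hS.
  by apply: FI'; rewrite lF !hg ?fL //; exact: SL.
- by move=> x v Sv; apply: FI'; rewrite FA !hg ?fA //; exact: SA.
- by move=> v w Sv Sw E; apply: fI => //; rewrite -!hg // E.
- apply/seteqP; split=> // w _.
  have : range F (F w) by exists w.
  by rewrite FT -fT => -[v Sv E]; exists v => //; apply: FI'; rewrite hg.
Qed.

(** The value is (l + 1)^2 - 1, and squaring is injective on the integers l + 1 <= 0. *)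
Lemma casimir_value_inj (K : numFieldType) :
  injective (fun l : big_weight => casimir_value (val l)%:~R : K).
Proof.
move=> [l hl] [l' hl'] /=; rewrite /casimir_value => E; apply: val_inj => /=.
have /eqP : ((l ^+ 2 + 2 * l)%:~R : K) = (l' ^+ 2 + 2 * l')%:~R.
  by rewrite !intrD !intrM.
by rewrite eqr_int => /eqP; nia.
Qed.

Theorem theorem1p8 (R : realType)
    (V P : big_weight -> lie_module (sl2 (complexes R)))
    (hV : forall l : big_weight, highest_weight_irreducible ((val l)%:~R) (V l))
    (hP : forall l : big_weight, is_projective_cover (P l) (V l)) :
  [/\ sum_is_direct (fun l => matrix_elements (P l)),
      iso_on (@pi_lr R) (@uea_dual_act (complexes R))
        (@regular_functions R)
        (sum_of_subspaces (fun l => matrix_elements (P l)))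
        (@regular_to_dual R) &
      exists f : (big_cell R -> (complexes R)^o) ->
                 direct_sum_module (fun l => tensor_mod_vanishing (P l)),
        iso_on (@pi_lr R) (@act _ _ _) (@regular_functions R) setT f].
Proof.
have dir : sum_is_direct (fun l => matrix_elements (P l)).
  move=> m [fm Mm] m0.
  (* Each summand lies in the generalized eigenspace of [casimir_dual] for the eigenvalue attached
     to its own weight. *)
  have nil l : exists N, iter N (shift_op (@casimir_dual (complexes R)) (casimir_value (val l)%:~R)) (m l) = 0.
    have [irrV [v0 [v0n ev0 hv0]]] := hV l.
    have [[[_ nilP diagP] _] _ [p [hp p_surj p_ess]]] := hP l.
    have [N hN] := cover_casimir_nilpotent irrV v0n ev0 hv0 hp p_surj p_ess nilP diagP.
    by exists N; exact: matrix_elements_block hN (Mm l).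
  have [N hN] := choice nil.
  exact: (generalized_eigen_direct (@casimir_dual_lin (complexes R)) (@casimir_value_inj (complexes R)) fm hN m0).
have sub l : is_submodule (matrix_elements (P l)) by exact: lspan_submodule.
have iso : iso_on (@pi_lr R) (@uea_dual_act (complexes R)) (@regular_functions R)
    (sum_of_subspaces (fun l => matrix_elements (P l))) (@regular_to_dual R).
  apply: regular_iso; apply/seteqP; split=> [_ [u fu <-]|_ [m [fm Mm] ->]].
    apply: coef_functional_generated fu.
    - exact: sum_of_subspaces_submodule.
    - move=> A phi; apply: (sum_of_subspaces_stable (uea_dual_act_lin A)) => l x.
      exact: matrix_elements_act.
    - move=> k; have hk : (- k.+1%:Z <= -1 :> int) by lia.
      pose l : big_weight := exist _ (- k.+1%:Z) hk.
      have [alpha [h1 h2]] := cover_coefficients (hV l) (hP l).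
      by exists alpha; split; apply: (sub_sum_of_subspaces (i := l)).
  (* Conversely, only finitely many components occur, and each is a matrix element of a module with
     integral weights, hence comes from finitely supported coefficients. *)
  have [s us hs] := finite_support_seq fm.
  rewrite (fsbig_uniq us hs); elim: (s) => [|l t [u fu uE]].
    rewrite big_nil; exists 0; first exact: finsupp0.
    by apply/funext => x; rewrite /coef_functional (linear_map0 (@uact_linear _ _ (coef_module _) x)) /base_value fsum0.
  have [irrV [v0 [v0n ev0 hv0]]] := hV l.
  have [[[_ nilP diagP] _] _ [p [hp p_surj p_ess]]] := hP l.
  have intP := cover_integral_weights irrV v0n hv0 hp p_surj p_ess diagP.
  have [u' fu' u'E] := matrix_elements_regular nilP intP (Mm l).
  rewrite big_cons; exists (1 *: u' + u); first exact: finsupp_lin.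
  by rewrite coef_functional_lin // scale1r uE u'E.
split=> //; apply: iso_on_inverse iso (@direct_sum_element_lin _ _ P) _ _ _.
- exact: direct_sum_element_act.
- by move=> d; exact: direct_sum_element_inj.
- exact: range_direct_sum_element.
Qed.
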